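(* Let $f,g,h,U_1,U_2$ satisfy the standing hypotheses (a)–(e) listed in the context. Then the upper and lower value functions $V^{\pm}$ (defined in the context) are well-defined (finite) on $[0,T]\times\mathbb{R}^n$ and there exists a constant $C>0$ such that $$|V^{\pm}(t,x)|\le C\langle x\rangle^{\mu},\qquad(t,x)\in[0,T]\times\mathbb{R}^n.$$ Moreover, for all $(t,x)\in[0,T]\times\mathbb{R}^n$, $$V^+(t,x)=\sup_{\alpha_2\in\mathcal{A}_2[t,T;N(|x|)]}\ \inf_{u_1\in\mathcal{U}_1[t,T;N(|x|)]}J(t,x;u_1,\alpha_2[u_1]),$$ $$V^-(t,x)=\inf_{\alpha_1\in\mathcal{A}_1[t,T;N(|x|)]}\ \sup_{u_2\in\mathcal{U}_2[t,T;N(|x|)]}J(t,x;\alpha_1[u_2],u_2),$$ where $N(|x|)=C'\langle x\rangle^{\mu}$ for some constant $C'>0$.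
   Context: Notation: $\langle x\rangle=\sqrt{1+|x|^2}$; $\langle\cdot,\cdot\rangle$ with two arguments is the Euclidean inner product; $a\vee b=\max\{a,b\}$. Hypotheses. $T>0$ is fixed. There are constants $L,c,\rho_1,\rho_2>0$, $\sigma_1,\sigma_2\ge0$, $\mu\ge1$, $\mu_0,\mu_1,\mu_2\in\mathbb{R}$ such that, for all $t\in[0,T]$, $x,y\in\mathbb{R}^n$, $u_1\in U_1$, $u_2\in U_2$: (a) $U_i\subseteq\mathbb{R}^{m_i}$ is closed and $0\in U_i$, $i=1,2$. (b) $f:[0,T]\times\mathbb{R}^n\times U_1\times U_2\to\mathbb{R}^n$ is continuous, $|f(t,x,u_1,u_2)|\le L(\langle x\rangle+|u_1|^{\sigma_1}+|u_2|^{\sigma_2})$, $|f(t,x,u_1,u_2)-f(t,y,u_1,u_2)|\le[(\langle x\rangle\vee\langle y\rangle)^{\mu_0}+(\langle x\rangle\vee\langle y\rangle)^{\mu_1}|u_1|^{\sigma_1}+(\langle x\rangle\vee\langle y\rangle)^{\mu_2}|u_2|^{\sigma_2}]\,|x-y|$, and $\langle f(t,x,u_1,u_2)-f(t,y,u_1,u_2),x-y\rangle\le L|x-y|^2$. (c) $g:[0,T]\times\mathbb{R}^n\times U_1\times U_2\to\mathbb{R}$ is continuous, $c|u_1|^{\rho_1}-L(\langle x\rangle^\mu+|u_2|^{\rho_2})\le g(t,x,u_1,u_2)\le L(\langle x\rangle^\mu+|u_1|^{\rho_1})-c|u_2|^{\rho_2}$, and $|g(t,x,u_1,u_2)-g(t,y,u_1,u_2)|\le[(\langle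 x\rangle\vee\langle y\rangle)^{\mu-1}+|u_1|^{\rho_1(\mu-1)/\mu}+|u_2|^{\rho_2(\mu-1)/\mu}]\,|x-y|$. (d) $h:\mathbb{R}^n\to\mathbb{R}$ is continuous, $|h(x)-h(y)|\le L(\langle x\rangle\vee\langle y\rangle)^{\mu-1}|x-y|$ and $|h(0)|\le L$. (e) $\sigma_i\mu<\rho_i$, $i=1,2$. Game. For $t\in[0,T]$, $\mathcal{U}_i^1[t,T]$ is the set of measurable $u_i:[t,T]\to U_i$ with $\int_t^T|u_i(s)|ds<\infty$, and $\mathcal{U}_i[t,T]=\mathcal{U}_i^\infty[t,T]$ is the set of essentially bounded measurable $u_i:[t,T]\to U_i$. For $u_i\in\mathcal{U}_i[t,T]$ and $x\in\mathbb{R}^n$, $y(\cdot)=y(\cdot;t,x,u_1,u_2)$ is the solution on $[t,T]$ of $\dot y(s)=f(s,y(s),u_1(s),u_2(s))$, $y(t)=x$, and $$J(t,x;u_1,u_2)=\int_t^Tg(s,y(s),u_1(s),u_2(s))ds+h(y(T)).$$ An Elliott–Kalton strategy for Player 1 is a map $\alpha_1:\mathcal{U}_2^1[t,T]\to\mathcal{U}_1^\infty[t,T]$ that is non-anticipating: for any $u_2,\bar u_2\in\mathcal{U}^1_2[t,T]$ and $\hat t\in[t,T]$, if $u_2=\bar u_2$ a.e. on $[t,\hat t]$ then $\alpha_1[u_2]=\alpha_1[\bar u_2]$ a.e. on $[t,\hat t]$. The set of these is $\mathcal{A}_1[t,T]$. Symmetrically, $\mathcal{A}_2[t,T]$ is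 the set of non-anticipating maps $\alpha_2:\mathcal{U}_1^1[t,T]\to\mathcal{U}_2^\infty[t,T]$. The upper and lower value functions are $$V^+(t,x)=\sup_{\alpha_2\in\mathcal{A}_2[t,T]}\inf_{u_1\in\mathcal{U}_1[t,T]}J(t,x;u_1,\alpha_2[u_1]),\qquad V^-(t,x)=\inf_{\alpha_1\in\mathcal{A}_1[t,T]}\sup_{u_2\in\mathcal{U}_2[t,T]}J(t,x;\alpha_1[u_2],u_2).$$ Restricted classes. For $r>0$, $\mathcal{U}_i[t,T;r]=\{u_i\in\mathcal{U}_i[t,T]:\int_t^T|u_i(s)|^{\rho_i}ds\le r\}$; $\mathcal{A}_1[t,T;r]$ is the set of $\alpha_1\in\mathcal{A}_1[t,T]$ with $\alpha_1[u_2]\in\mathcal{U}_1[t,T;r]$ for all $u_2\in\mathcal{U}_2^1[t,T]$; $\mathcal{A}_2[t,T;r]$ is the set of $\alpha_2\in\mathcal{A}_2[t,T]$ with $\alpha_2[u_1]\in\mathcal{U}_2[t,T;r]$ for all $u_1\in\mathcal{U}_1^1[t,T]$. *)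

(* Defs.v *)
From HB Require Import structures.
From mathcomp Require Import all_boot all_order all_algebra.
From mathcomp Require Import all_classical all_reals all_analysis.

Set Implicit Arguments.
Unset Strict Implicit.
Unset Printing Implicit Defensive.

Import Order.TTheory GRing.Theory Num.Theory.
Import numFieldNormedType.Exports.

Local Open Scope classical_set_scope.
Local Open Scope ring_scope.

Section Euclidean.
Context {R : realType} {n : nat}.

Definition edot (x y : 'rV[R]_n) : R := \sum_(i < n) x 0 i * y 0 i.

(* The library norm on 'rV[R]_n is the sup norm, hence this definition; the
   two induce the same topology. *)
Definition enorm (x : 'rV[R]_n) : R := Num.sqrt (edot x x).

Definition jap (x : 'rV[R]_n) : R := Num.sqrt (1 + enorm x ^+ 2).

Definition japmax (x y : 'rV[R]_n) : R := Num.max (jap x) (jap y).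

End Euclidean.

(* A function on [t, T] is represented by a total function on R of which only
   the restriction to [t, T] is ever constrained or used.  Likewise a strategy
   is a total map of which only the values on its domain are used. *)
Section Controls.
Context {R : realType}.
Variable T : R.

Let mu := @lebesgue_measure R.

(* Measurability of a vector-valued function is componentwise. *)
Definition control_on {m : nat} (U : set 'rV[R]_m) (t : R) (u : R -> 'rV[R]_m) :
    Prop :=
  (forall i, measurable_fun `[t, T] (fun s => u s 0 i)) /\
  (forall s, s \in `[t, T] -> U (u s)).

Definition control1 {m : nat} (U : set 'rV[R]_m) (t : R) :
    set (R -> 'rV[R]_m) :=
  [set u | control_on U t u /\
     (\int[mu]_(s in `[t, T]) (enorm (u s))%:E < +oo)%E].

Definition control {m : nat} (U : set 'rV[R]_m) (t : R) :
    set (R -> 'rV[R]_m) :=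
  [set u | control_on U t u /\
     exists M : R, \forall s \ae mu, `[t, T]%classic s -> enorm (u s) <= M].

Definition control_le {m : nat} (U : set 'rV[R]_m) (rho t r : R) :
    set (R -> 'rV[R]_m) :=
  [set u | control U t u /\
     (\int[mu]_(s in `[t, T]) (enorm (u s) `^ rho)%:E <= r%:E)%E].

(* Elliott-Kalton strategies answering a control with values in V by a control
   with values in U. *)
Definition strategy {p m : nat} (V : set 'rV[R]_p) (U : set 'rV[R]_m) (t : R) :
    set ((R -> 'rV[R]_p) -> R -> 'rV[R]_m) :=
  [set a | (forall v, control1 V t v -> control U t (a v)) /\
     (forall v w s, control1 V t v -> control1 V t w -> s \in `[t, T] ->
        v = w %[ae mu in `[t, s]%classic] -> a v = a w %[ae mu in `[t, s]%classic])].

Definition strategy_le {p m : nat} (V : set 'rV[R]_p) (U : set 'rV[R]_m)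
    (rho t r : R) : set ((R -> 'rV[R]_p) -> R -> 'rV[R]_m) :=
  [set a | strategy V U t a /\
     forall v, control1 V t v -> control_le U rho t r (a v)].

End Controls.

Section Game.
Context {R : realType} {n m1 m2 : nat}.
Variable T : R.
Variables (f : R -> 'rV[R]_n -> 'rV[R]_m1 -> 'rV[R]_m2 -> 'rV[R]_n)
  (g : R -> 'rV[R]_n -> 'rV[R]_m1 -> 'rV[R]_m2 -> R) (h : 'rV[R]_n -> R).

Let mu := @lebesgue_measure R.

(* Caratheodory solutions of y' = f(s, y, u1, u2), y(t) = x on [t, T], in
   integral form. *)
Definition is_trajectory (t : R) (x : 'rV[R]_n) (u1 : R -> 'rV[R]_m1)
    (u2 : R -> 'rV[R]_m2) (y : R -> 'rV[R]_n) : Prop :=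
  forall i : 'I_n,
    mu.-integrable `[t, T] (fun s => (f s (y s) (u1 s) (u2 s) 0 i)%:E) /\
    (forall s, s \in `[t, T] ->
       y s 0 i =
       x 0 i + \int[mu]_(r in `[t, s]) f r (y r) (u1 r) (u2 r) 0 i).

(* For essentially bounded controls the standing hypotheses make the solution
   exist and be unique on [t, T], so the default value of xget is not used. *)
Definition trajectory (t : R) (x : 'rV[R]_n) (u1 : R -> 'rV[R]_m1)
    (u2 : R -> 'rV[R]_m2) : R -> 'rV[R]_n :=
  xget (fun=> x) [set y | is_trajectory t x u1 u2 y].

Definition cost (t : R) (x : 'rV[R]_n) (u1 : R -> 'rV[R]_m1)
    (u2 : R -> 'rV[R]_m2) : \bar R :=
  let y := trajectory t x u1 u2 in
  (\int[mu]_(s in `[t, T]) (g s (y s) (u1 s) (u2 s))%:E + (h (y T))%:E)%E.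

Definition sup_inf_cost (A2 : set ((R -> 'rV[R]_m1) -> R -> 'rV[R]_m2))
    (C1 : set (R -> 'rV[R]_m1)) (t : R) (x : 'rV[R]_n) : \bar R :=
  ereal_sup [set ereal_inf [set cost t x u1 (a2 u1) | u1 in C1] | a2 in A2].

Definition inf_sup_cost (A1 : set ((R -> 'rV[R]_m2) -> R -> 'rV[R]_m1))
    (C2 : set (R -> 'rV[R]_m2)) (t : R) (x : 'rV[R]_n) : \bar R :=
  ereal_inf [set ereal_sup [set cost t x (a1 u2) u2 | u2 in C2] | a1 in A1].

Variables (U1 : set 'rV[R]_m1) (U2 : set 'rV[R]_m2).

Definition upper_value (t : R) (x : 'rV[R]_n) : \bar R :=
  sup_inf_cost (strategy T U1 U2 t) (control T U1 t) t x.

Definition lower_value (t : R) (x : 'rV[R]_n) : \bar R :=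
  inf_sup_cost (strategy T U2 U1 t) (control T U2 t) t x.

Definition upper_value_le (rho1 rho2 r t : R) (x : 'rV[R]_n) : \bar R :=
  sup_inf_cost (strategy_le T U1 U2 rho2 t r) (control_le T U1 rho1 t r) t x.

Definition lower_value_le (rho1 rho2 r t : R) (x : 'rV[R]_n) : \bar R :=
  inf_sup_cost (strategy_le T U2 U1 rho1 t r) (control_le T U2 rho2 t r) t x.

Definition game_domain : set (R * 'rV[R]_n * 'rV[R]_m1 * 'rV[R]_m2) :=
  [set p | [/\ p.1.1.1 \in `[0, T], U1 p.1.2 & U2 p.2]].

(* Real powers use the convention 0 `^ 0 = 1. *)
Record standing_hyp (L c rho1 rho2 sigma1 sigma2 mu mu0 mu1 mu2 : R) : Prop :=
  StandingHyp {
  hyp_L : 0 < L;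
  hyp_c : 0 < c;
  hyp_rho1 : 0 < rho1;
  hyp_rho2 : 0 < rho2;
  hyp_sigma1 : 0 <= sigma1;
  hyp_sigma2 : 0 <= sigma2;
  hyp_mu : 1 <= mu;
  U1_closed : closed U1;
  U1_zero : U1 0;
  U2_closed : closed U2;
  U2_zero : U2 0;
  f_continuous :
    {within game_domain, continuous (fun p => f p.1.1.1 p.1.1.2 p.1.2 p.2)};
  f_growth : forall t x u1 u2, t \in `[0, T] -> U1 u1 -> U2 u2 ->
    enorm (f t x u1 u2) <=
      L * (jap x + enorm u1 `^ sigma1 + enorm u2 `^ sigma2);
  f_lipschitz : forall t x y u1 u2, t \in `[0, T] -> U1 u1 -> U2 u2 ->
    enorm (f t x u1 u2 - f t y u1 u2) <=
      (japmax x y `^ mu0 + japmax x y `^ mu1 * enorm u1 `^ sigma1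
       + japmax x y `^ mu2 * enorm u2 `^ sigma2) * enorm (x - y);
  f_monotone : forall t x y u1 u2, t \in `[0, T] -> U1 u1 -> U2 u2 ->
    edot (f t x u1 u2 - f t y u1 u2) (x - y) <= L * enorm (x - y) ^+ 2;
  g_continuous :
    {within game_domain, continuous (fun p => g p.1.1.1 p.1.1.2 p.1.2 p.2)};
  g_lower : forall t x u1 u2, t \in `[0, T] -> U1 u1 -> U2 u2 ->
    c * enorm u1 `^ rho1 - L * (jap x `^ mu + enorm u2 `^ rho2)
      <= g t x u1 u2;
  g_upper : forall t x u1 u2, t \in `[0, T] -> U1 u1 -> U2 u2 ->
    g t x u1 u2 <=
      L * (jap x `^ mu + enorm u1 `^ rho1) - c * enorm u2 `^ rho2;
  g_lipschitz : forall t x y u1 u2, t \in `[0, T] -> U1 u1 -> U2 u2 ->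
    `|g t x u1 u2 - g t y u1 u2| <=
      (japmax x y `^ (mu - 1) + enorm u1 `^ (rho1 * (mu - 1) / mu)
       + enorm u2 `^ (rho2 * (mu - 1) / mu)) * enorm (x - y);
  h_continuous : continuous h;
  h_lipschitz : forall x y,
    `|h x - h y| <= L * japmax x y `^ (mu - 1) * enorm (x - y);
  h_zero : `|h 0| <= L;
  sigma1_rho1 : sigma1 * mu < rho1;
  sigma2_rho2 : sigma2 * mu < rho2 }.

End Game.

(* Main.v *)
(** Coercivity of [g] bounds every payoff by
    [c/2 E1 - C (<x>^mu + E2) <= J <= C (<x>^mu + E1) - c/2 E2], where [E1], [E2]
    are the energies of the two controls; zero controls then bound the values.

    For the restriction to energies at most [N], let [alpha] guarantee [W] to
    Player 2 against the controls of energy at most [N].  Player 2 simulates a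
    guide: on a grid, from the position [x] of the game and the position [z] of
    the guide, take [q] the gradient at [x - z] of a smoothed and discounted
    multiple [K] of the norm, and a near-saddle of the Hamiltonian
    [g - <q, f>] at [(z, q)].  The minimizing component drives the guide, which
    answers it with [alpha]; the maximizing component answers the actual control.
    Both have pointwise energy of order [E = G <x>^mu] by coercivity.  Since [f]
    is one-sided Lipschitz and [g] is Lipschitz with a constant below [K] at that
    scale, comparing the two running payoffs along the penalty [K |x - z|] gives
    a payoff at least [W - eps] against every control, of any energy; an actual
    control of too large energy already yields more than [W].  So a strategy of
    energy at most [N] does as well against all controls as [alpha] does against
    the restricted ones, and all the values squeezed in between coincide.
    Exchanging the players and the signs of [g], [h] gives the lower value. *)

Require Import Defs.
From mathcomp Require Import all_boot all_order all_algebra.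
From mathcomp Require Import all_classical all_reals all_analysis.
From mathcomp Require Import measurable_realfun.
From mathcomp Require Import ring lra.

Set Implicit Arguments.
Unset Strict Implicit.
Unset Printing Implicit Defensive.

Import Order.TTheory GRing.Theory Num.Theory.
Import numFieldNormedType.Exports.

Local Open Scope classical_set_scope.
Local Open Scope ring_scope.

(** * Euclidean inner product, norm and bracket *)

Section EuclideanTheory.
Context {R : realType} {n : nat}.
Implicit Types (x y z : 'rV[R]_n) (a : R).

(** The payoff bounds alone do not allow truncating a strategy. They make energy of Player 1
    harmless to a Player 2 limited to [N] only beyond a large multiple of [N]; before that [alpha]
    may already answer with energy above [N], and the two thresholds chase each other. The guide
    cuts the loop: whatever the opponent does, [alpha] is consulted only on a control bounded
    pointwise by the scale, and the answer played in the game is not that of [alpha]. The gap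
    [sigma_i * mu < rho_i] provides the scale. With [E = K * Z], the drift paired with a gradient of
    size [K] is, up to a multiple of [E], below the coercive part of [g], while [K] dominates the
    Lipschitz constants of [g] and [h] met there. The discount rate [L + 1] spends [L] on the
    expansion by [f] and [1] on the variation of [g]. The grid is fixed before the opponent's
    control, whose pointwise bound is arbitrary. So moduli of continuity come from energy alone, and
    constants depending on that control enter only errors quadratic in time, which vanish on
    refining inside each grid cell. *)

Lemma edotC x y : edot x y = edot y x.
Proof. by apply: eq_bigr => i _; rewrite mulrC. Qed.

Lemma edotDl x y z : edot (x + y) z = edot x z + edot y z.
Proof. by rewrite -big_split/=; apply: eq_bigr => i _; rewrite mxE mulrDl. Qed.

Lemma edotZl a x y : edot (a *: x) y = a * edot x y.
Proof. by rewrite mulr_sumr; apply: eq_bigr => i _; rewrite mxE mulrA. Qed.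

Lemma edotNl x y : edot (- x) y = - edot x y.
Proof. by rewrite -scaleN1r edotZl mulN1r. Qed.

Lemma edotBl x y z : edot (x - y) z = edot x z - edot y z.
Proof. by rewrite edotDl edotNl. Qed.

Lemma edotDr x y z : edot x (y + z) = edot x y + edot x z.
Proof. by rewrite edotC edotDl !(edotC x). Qed.

Lemma edotZr a x y : edot x (a *: y) = a * edot x y.
Proof. by rewrite edotC edotZl edotC. Qed.

Lemma edotBr x y z : edot x (y - z) = edot x y - edot x z.
Proof. by rewrite edotC edotBl !(edotC x). Qed.

Lemma edot_ge0 x : 0 <= edot x x.
Proof. by apply: sumr_ge0 => i _; rewrite -expr2 sqr_ge0. Qed.

Lemma enorm_ge0 x : 0 <= enorm x.
Proof. exact: sqrtr_ge0. Qed.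

Lemma enorm_sqr x : enorm x ^+ 2 = edot x x.
Proof. by rewrite sqr_sqrtr// edot_ge0. Qed.

Lemma enorm0 : enorm (0 : 'rV[R]_n) = 0.
Proof.
rewrite /enorm (_ : edot 0 0 = 0) ?sqrtr0//.
by apply: big1 => i _; rewrite !mxE mul0r.
Qed.

Lemma enormZ a x : enorm (a *: x) = `|a| * enorm x.
Proof. by rewrite /enorm edotZl edotZr mulrA -expr2 sqrtrM ?sqr_ge0// sqrtr_sqr. Qed.

Lemma enormN x : enorm (- x) = enorm x.
Proof. by rewrite -scaleN1r enormZ normrN1 mul1r. Qed.

Lemma enormBC x y : enorm (x - y) = enorm (y - x).
Proof. by rewrite -enormN opprB. Qed.

Lemma coord_le_enorm x i : `|x 0 i| <= enorm x.
Proof.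
rewrite -[leLHS]sqrtr_sqr ler_sqrt ?edot_ge0// /edot (bigD1 i)//= -expr2.
by rewrite lerDl sumr_ge0// => j _; rewrite -expr2 sqr_ge0.
Qed.

Lemma enorm_eq0 x : enorm x = 0 -> x = 0.
Proof.
move=> x0; apply/rowP => i; rewrite mxE; apply/eqP.
by rewrite -normr_le0 -x0 coord_le_enorm.
Qed.

Lemma edot_le x y : edot x y <= enorm x * enorm y.
Proof.
have [y0|y0] := eqVneq (enorm y) 0.
  rewrite y0 mulr0 (enorm_eq0 y0) /edot big1// => i _.
  by rewrite mxE mulr0.
have yp : 0 < enorm y by rewrite lt_neqAle eq_sym y0 enorm_ge0.
have [x0|x0] := eqVneq (enorm x) 0.
  rewrite x0 mul0r (enorm_eq0 x0) /edot big1// => i _.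
  by rewrite mxE mul0r.
have xp : 0 < enorm x by rewrite lt_neqAle eq_sym x0 enorm_ge0.
have := edot_ge0 (enorm y *: x - enorm x *: y).
rewrite edotBl !edotBr !edotZl !edotZr (edotC y x) -!enorm_sqr.
have xyp : 0 < enorm x * enorm y by rewrite mulr_gt0.
move: (edot x y) => c.
move: (enorm x) (enorm y) xyp => u v uv h.
have : 0 <= (u * v) * (u * v - c) by nra.
by rewrite pmulr_rge0// subr_ge0.
Qed.

Lemma edot_le_abs x y : `|edot x y| <= enorm x * enorm y.
Proof.
rewrite ler_norml edot_le andbT lerNl -edotNl.
by rewrite (le_trans (edot_le _ _))// enormN.
Qed.

Lemma enormD x y : enorm (x + y) <= enorm x + enorm y.
Proof.
rewrite -(@ler_pXn2r _ 2)// ?nnegrE ?addr_ge0 ?enorm_ge0//.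
rewrite enorm_sqr edotDl !edotDr (edotC y x) -!enorm_sqr.
by have := edot_le x y; nra.
Qed.

Lemma enormB x y : enorm (x - y) <= enorm x + enorm y.
Proof. by rewrite -(enormN y) enormD. Qed.

Lemma enorm_dist_tri z x y : enorm (x - y) <= enorm (x - z) + enorm (z - y).
Proof. by rewrite -[x - y](subrKA z) enormD. Qed.

Lemma enorm_le_sum x : enorm x <= \sum_(i < n) `|x 0 i|.
Proof.
rewrite -(@ler_pXn2r _ 2)// ?nnegrE ?enorm_ge0// ?sumr_ge0//.
rewrite enorm_sqr /edot expr2 mulr_suml ler_sum// => i _.
rewrite -expr2 -real_normK ?num_real// expr2 ler_wpM2l//.
by rewrite (bigD1 i)//= lerDl sumr_ge0.
Qed.

Lemma enorm_le_coord x a : (forall i, `|x 0 i| <= a) -> enorm x <= n%:R * a.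
Proof.
move=> xa; rewrite (le_trans (enorm_le_sum x))//.
by rewrite (le_trans (ler_sum _ (fun i _ => xa i)))// sumr_const card_ord mulr_natl.
Qed.

Lemma jap_sqr x : jap x ^+ 2 = 1 + enorm x ^+ 2.
Proof. by rewrite sqr_sqrtr// addr_ge0// sqr_ge0. Qed.

Lemma jap_ge1 x : 1 <= jap x.
Proof. by rewrite -[leLHS]sqrtr1 ler_sqrt ?lerDl ?sqr_ge0// addr_ge0 ?sqr_ge0. Qed.

Lemma jap_gt0 x : 0 < jap x.
Proof. exact: lt_le_trans (jap_ge1 x). Qed.

Lemma jap_ge0 x : 0 <= jap x.
Proof. exact/ltW/jap_gt0. Qed.

Lemma enorm_le_jap x : enorm x <= jap x.
Proof.
rewrite -(@ler_pXn2r _ 2)// ?nnegrE ?enorm_ge0 ?jap_ge0//.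
by rewrite jap_sqr lerDr.
Qed.

Lemma jap_le x : jap x <= 1 + enorm x.
Proof.
rewrite -(@ler_pXn2r _ 2)// ?nnegrE ?addr_ge0 ?enorm_ge0 ?jap_ge0//.
rewrite jap_sqr; have := enorm_ge0 x; nra.
Qed.

Lemma jap_lip x y : jap x <= jap y + enorm (x - y).
Proof.
rewrite -(@ler_pXn2r _ 2)// ?nnegrE ?addr_ge0 ?enorm_ge0 ?jap_ge0//.
rewrite jap_sqr sqrrD jap_sqr.
have h : enorm x <= enorm y + enorm (x - y).
  by rewrite -[x in leLHS](subrKC y) enormD.
have := enorm_le_jap y; have := enorm_ge0 x; have := enorm_ge0 y.
have := enorm_ge0 (x - y).
move: (enorm x) (enorm y) (enorm (x - y)) (jap y) h => u v w j *.
nra.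
Qed.

Lemma japmax_le x y Z : jap x <= Z -> jap y <= Z -> japmax x y <= Z.
Proof. by move=> xZ yZ; rewrite ge_max xZ yZ. Qed.

Lemma japmax_ge1 x y : 1 <= japmax x y.
Proof. by rewrite le_max jap_ge1. Qed.

End EuclideanTheory.

(** * The smoothed norm and its gradient *)

Section SmoothedNorm.
Context {R : realType} {n : nat}.
Implicit Types (w v : 'rV[R]_n) (l : R).

(** The parameter [l] makes the gradient Lipschitz with constant of order [1 / l]. Its price is the
    penalty [K * l] at a common starting point, which the choice of [l] later sets to [eps / 2]. *)
Definition snorm l w : R := Num.sqrt (l ^+ 2 + enorm w ^+ 2).

Lemma snorm_sqr l w : snorm l w ^+ 2 = l ^+ 2 + enorm w ^+ 2.
Proof. by rewrite sqr_sqrtr// addr_ge0// sqr_ge0. Qed.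

Lemma snorm_ge0 l w : 0 <= snorm l w.
Proof. exact: sqrtr_ge0. Qed.

Lemma snorm_gel l w : 0 < l -> l <= snorm l w.
Proof.
move=> l0; rewrite -(@ler_pXn2r _ 2)// ?nnegrE ?snorm_ge0 ?(ltW l0)//.
by rewrite snorm_sqr lerDl sqr_ge0.
Qed.

Lemma snorm_gt0 l w : 0 < l -> 0 < snorm l w.
Proof. by move=> l0; apply: lt_le_trans (snorm_gel w l0). Qed.

Lemma snorm_geE l w : enorm w <= snorm l w.
Proof.
rewrite -(@ler_pXn2r _ 2)// ?nnegrE ?snorm_ge0 ?enorm_ge0//.
by rewrite snorm_sqr lerDr sqr_ge0.
Qed.

Lemma snorm0 l : 0 < l -> snorm l (0 : 'rV[R]_n) = l.
Proof. by move=> l0; rewrite /snorm enorm0 expr0n addr0 sqrtr_sqr gtr0_norm. Qed.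

Lemma snorm_lip l w v : 0 < l -> snorm l v <= snorm l w + enorm (v - w).
Proof.
move=> l0; rewrite -(@ler_pXn2r _ 2)// ?nnegrE ?addr_ge0 ?enorm_ge0 ?snorm_ge0//.
rewrite snorm_sqr sqrrD snorm_sqr.
have h : enorm v <= enorm w + enorm (v - w).
  by rewrite -[v in leLHS](subrKC w) enormD.
have := snorm_geE l w; have := enorm_ge0 w; have := enorm_ge0 v.
have := enorm_ge0 (v - w).
move: (enorm v) (enorm w) (enorm (v - w)) (snorm l w) h => a b c s *.
nra.
Qed.

(* [sqrt b <= (a + b) / (2 sqrt a)] with [a], [b] the squares of the two
   smoothed norms: no second derivative is needed. *)
Lemma snorm_descent l w v : 0 < l ->
  snorm l v <= snorm l w + edot w (v - w) / snorm l w
               + enorm (v - w) ^+ 2 / (2 * l).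
Proof.
move=> l0; have sp := snorm_gt0 w l0.
have sl := snorm_gel w l0.
have hv : enorm v ^+ 2 = enorm w ^+ 2 + 2 * edot w (v - w) + enorm (v - w) ^+ 2.
  have {1}-> : v = w + (v - w) by rewrite subrKC.
  move: (v - w) => d; rewrite !enorm_sqr edotDl !edotDr (edotC d w); ring.
have hle : enorm (v - w) ^+ 2 / (2 * snorm l w) <= enorm (v - w) ^+ 2 / (2 * l).
  rewrite ler_wpM2l ?sqr_ge0// lef_pV2 ?posrE ?mulr_gt0//; lra.
apply: le_trans (lerD (lexx _) hle).
have -> : snorm l w + edot w (v - w) / snorm l w +
    enorm (v - w) ^+ 2 / (2 * snorm l w)
   = (snorm l w ^+ 2 + snorm l v ^+ 2) / (2 * snorm l w).
  rewrite (snorm_sqr l v) hv.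
  rewrite (_ : l ^+ 2 = snorm l w ^+ 2 - enorm w ^+ 2); last first.
    by rewrite snorm_sqr; ring.
  by field; rewrite gt_eqF.
rewrite ler_pdivlMr ?mulr_gt0//.
by have := sqr_ge0 (snorm l w - snorm l v); nra.
Qed.

Lemma snorm_grad_lip l w v : 0 < l ->
  enorm ((snorm l w)^-1 *: w - (snorm l v)^-1 *: v) <= 2 * enorm (w - v) / l.
Proof.
move=> l0.
have wp := snorm_gt0 w l0; have vp := snorm_gt0 v l0.
have -> : (snorm l w)^-1 *: w - (snorm l v)^-1 *: v =
    (snorm l w)^-1 *: (w - v) + ((snorm l w)^-1 - (snorm l v)^-1) *: v.
  by rewrite scalerBr scalerBl addrA subrK.
apply: (le_trans (enormD _ _)); rewrite !enormZ.
have -> : 2 * enorm (w - v) / l = enorm (w - v) / l + enorm (w - v) / l.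
  by ring.
have h1 : (snorm l w)^-1 <= l^-1.
  by rewrite lef_pV2 ?posrE// snorm_gel.
apply: lerD.
  by rewrite gtr0_norm ?invr_gt0// mulrC ler_wpM2l ?enorm_ge0.
have -> : (snorm l w)^-1 - (snorm l v)^-1 =
   (snorm l w)^-1 * (snorm l v)^-1 * (snorm l v - snorm l w).
  by field; rewrite !gt_eqF.
rewrite normrM ger0_norm ?mulr_ge0 ?invr_ge0 ?snorm_ge0//.
have hd : `|snorm l v - snorm l w| <= enorm (w - v).
  rewrite ler_norml; have := snorm_lip w v l0; have := snorm_lip v w l0.
  by rewrite (enormBC v w); move=> ? ?; apply/andP; split; lra.
have h2 : (snorm l v)^-1 * enorm v <= 1.
  by rewrite mulrC ler_pdivrMr// mul1r snorm_geE.
rewrite [leLHS](_ : _ = ((snorm l w)^-1 * `|snorm l v - snorm l w|) *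
   ((snorm l v)^-1 * enorm v)); last by ring.
rewrite -[leRHS]mulr1 ler_pM ?mulr_ge0 ?invr_ge0 ?enorm_ge0 ?snorm_ge0//.
by rewrite mulrC ler_pM ?invr_ge0 ?snorm_ge0.
Qed.

End SmoothedNorm.

(** * Scales of energy, position and gradient *)

Section Scales.
Context {R : realType}.

(* Splitting on [v ^ s <= Y]: above this level [v >= 1], and the surplus of
   exponents [s * nu <= r] is worth [Y ^ (nu - 1)]. *)
Lemma powR_subcritical (nu s r Y v : R) : 1 <= nu -> 0 <= s -> s * nu <= r ->
  1 <= Y -> 0 <= v -> v `^ s <= Y + Y `^ (1 - nu) * v `^ r.
Proof.
move=> nu1 s0 sr Y1 v0.
have Y0 : 0 < Y by exact: lt_le_trans Y1.
have [vY|Yv] := leP (v `^ s) Y.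
  by rewrite (le_trans vY)// lerDl mulr_ge0// powR_ge0.
have v1 : 1 <= v.
  rewrite leNgt; apply/negP => v1.
  have : v `^ s <= 1.
    have -> : 1 = 1 `^ s by rewrite powR1.
    by apply: ge0_ler_powR; rewrite // ?nnegrE// ltW.
  by move=> h; have := lt_le_trans Yv (le_trans h Y1); rewrite ltxx.
have h : v `^ s * Y `^ (nu - 1) <= v `^ r.
  apply: (@le_trans _ _ (v `^ (s * nu))); last exact: ler_powR.
  rewrite powRrM [X in _ <= _ `^ X](_ : nu = 1 + (nu - 1)); last by ring.
  rewrite [leRHS]powRD; last first.
    by apply/implyP => _; rewrite gt_eqF// (lt_trans Y0).
  rewrite powRr1 ?powR_ge0// ler_wpM2l ?powR_ge0//.
  by apply: ge0_ler_powR; rewrite ?nnegrE ?subr_ge0 ?powR_ge0// ltW.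
have -> : v `^ s = Y `^ (1 - nu) * (v `^ s * Y `^ (nu - 1)).
  rewrite mulrCA -powRD; last by apply/implyP => _; rewrite gt_eqF.
  by rewrite (_ : 1 - nu + (nu - 1) = 0) ?powRr0 ?mulr1//; ring.
apply: (@le_trans _ _ (Y `^ (1 - nu) * v `^ r)).
  by rewrite ler_wpM2l// powR_ge0.
by rewrite lerDr ltW.
Qed.

(* [Z = eta * E ^ (1 / mu)] and [K = E / Z], with [eta] small and then [E] large:
   [E] is a level of energy, [Z] of position and [K] of gradients. *)
Lemma scales (mu nu dl A : R) : 1 <= mu -> mu < nu -> 0 < dl -> dl <= 1 -> 1 <= A ->
  exists2 G : R, 1 <= G & forall X E : R, 1 <= X -> G * X `^ mu <= E ->
  exists K Z : R, [/\ 0 < K, 0 < Z, K * Z = E, Z `^ mu <= dl * E & Z `^ (mu - 1) <= dl * K]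
   /\ [/\ X <= dl * Z, (A * E) `^ ((mu - 1) / mu) <= dl * K &
     forall v s r : R, 0 <= v -> 0 <= s -> s * nu <= r ->
       K * v `^ s <= dl * (v `^ r + E)].
Proof.
move=> mu1 munu dl0 dl1 A1.
have mu0 : 0 < mu by lra.
have A0 : 0 < A by lra.
have [mu0' A0' dl0'] : [/\ 0 <= mu, 0 <= A & 0 <= dl] by split; exact: ltW.
(* With [e = E ^ (1 / mu)] this gives [dl * K = dl * E / (eta * e) = A * E ^ ((mu - 1) / mu)], which
   dominates [(A * E) ^ ((mu - 1) / mu)] because [A >= 1] and the exponent is at most 1. *)
pose eta := dl / A.
have eta0 : 0 < eta by rewrite divr_gt0.
have eta0' := ltW eta0.
have etadl : eta <= dl by rewrite ler_pdivrMr// ler_peMr// ltW.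
pose k := (dl * eta)^-1.
have k0 : 0 < k by rewrite invr_gt0 mulr_gt0.
have k0' := ltW k0.
have k1 : 1 <= k.
  by rewrite /k invf_ge1 ?(mulr_gt0 dl0 eta0)// -[leRHS]mulr1 ler_pM// (le_trans etadl).
have nm0 : 0 < nu - mu by rewrite subr_gt0.
(* Here [Y = dl * Z] will be [e / k]. The last claim applies [powR_subcritical] at level [Y]: the
   first term is [K * Y = dl * E], and the second needs [K * Y ^ (1 - nu) <= dl], that is
   [k ^ nu <= E ^ ((nu - mu) / mu)], which fixes this power. Then
   [G ^ (1 / mu) = k ^ (nu / (nu - mu)) >= k] also gives [X <= dl * Z]. *)
exists (k `^ (nu * mu / (nu - mu))).
  by rewrite -[leLHS](powRr0 k) ler_powR// divr_ge0 ?mulr_ge0//; lra.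
set G := k `^ _ => X E X1 GE.
have X0 : 0 < X by lra.
have G0 : 0 < G by rewrite powR_gt0.
have Xmu1 : 1 <= X `^ mu.
  by rewrite -[leLHS](powRr0 X) ler_powR// ltW.
have E0 : 0 < E by apply: lt_le_trans GE; rewrite mulr_gt0 ?powR_gt0.
have E0' := ltW E0.
have GE' : G <= E by apply: le_trans GE; rewrite ler_peMr// ltW.
pose e := E `^ mu^-1.
have e0 : 0 < e by rewrite powR_gt0.
have e0' := ltW e0.
have emu : e `^ mu = E by rewrite -powRrM mulVf ?gt_eqF// powRr1// ltW.
pose Z := eta * e.
have Z0 : 0 < Z by rewrite mulr_gt0.
have Zmu : Z `^ mu <= dl * E.
  rewrite powRM // emu ler_wpM2r//.
  apply: (le_trans _ etadl); apply: ge1r_powR => //.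
  by rewrite eta0/= (le_trans etadl).
have XZ : X <= dl * Z.
  have : G `^ mu^-1 * X <= e.
    have -> : G `^ mu^-1 * X = (G * X `^ mu) `^ mu^-1.
      by rewrite powRM ?powR_ge0// -powRrM divff ?gt_eqF// powRr1// ltW.
    apply: ge0_ler_powR; rewrite ?invr_ge0 ?nnegrE ?mulr_ge0 ?powR_ge0//; exact: ltW.
  have kG : k <= G `^ mu^-1.
    rewrite /G -powRrM -[leLHS]powRr1; last exact: ltW.
    rewrite ler_powR// mulrAC mulfK ?gt_eqF// ler_pdivlMr//; lra.
  move=> h; have : k * X <= e by apply: le_trans h; rewrite ler_wpM2r// ltW.
  rewrite /k mulrC ler_pdivrMr ?(mulr_gt0 dl0 eta0)// => h'.
  by rewrite (le_trans h')// /Z mulrC mulrA.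
exists (E / Z), Z; split; split => //.
- by rewrite divr_gt0.
- by rewrite divfK// gt_eqF.
- rewrite mulrA ler_pdivlMr//; apply: le_trans Zmu.
  rewrite -{2}(powRr1 (ltW Z0)) -powRD ?subrK//.
  by apply/implyP => _; rewrite gt_eqF.
- have -> : dl * (E / Z) = A * E `^ ((mu - 1) / mu).
    have -> : E `^ ((mu - 1) / mu) = E / e.
      rewrite /e -powRN -{2}(powRr1 (ltW E0)) -powRD; last first.
        by apply/implyP => _; rewrite gt_eqF.
      by congr (_ `^ _); field; rewrite gt_eqF.
    rewrite /Z /eta; field; rewrite !gt_eqF//.
  rewrite powRM // ler_wpM2r ?powR_ge0// -[leRHS]powRr1//.
  by rewrite ler_powR// ler_pdivrMr//; lra.
- move=> v s r v0 s0 sr; set Y := dl * Z.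
  have Y1 : 1 <= Y by rewrite (le_trans X1).
  have Y0 : 0 < Y by lra.
  have nu1 : 1 <= nu by lra.
  have h := powR_subcritical nu1 s0 sr Y1 v0.
  have KY : E / Z * Y = dl * E by rewrite /Y mulrCA divfK// gt_eqF.
  have KY' : E / Z * Y `^ (1 - nu) <= dl.
    have -> : E / Z * Y `^ (1 - nu) = dl * (E / Y `^ nu).
      rewrite powRB; last by apply/implyP => _; rewrite gt_eqF.
      rewrite powRr1; last exact: ltW.
      by rewrite /Y; field; rewrite !gt_eqF// powR_gt0.
    rewrite -[leRHS]mulr1 ler_wpM2l//.
    rewrite ler_pdivrMr ?powR_gt0// mul1r.
    have -> : Y = k^-1 * e by rewrite /Y /Z /k invrK mulrA.
    rewrite powRM ?invr_ge0//; last exact: mulr_ge0.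
    rewrite -powR_inv1//.
    rewrite -powRrM mulN1r.
    rewrite -[leLHS]mul1r.
    have -> : e `^ nu = E `^ ((nu - mu) / mu) * E.
      rewrite /e -powRrM -{3}(powRr1 (ltW E0)) -powRD.
        by congr (_ `^ _); field; rewrite gt_eqF.
      by apply/implyP => _; rewrite gt_eqF.
    rewrite mulrA ler_wpM2r//.
    rewrite powRN mulrC ler_pdivlMr ?powR_gt0// mul1r.
    have -> : k `^ nu = G `^ ((nu - mu) / mu).
      by rewrite /G -powRrM; congr (_ `^ _); field; rewrite !gt_eqF.
    by apply: ge0_ler_powR; rewrite ?nnegrE ?divr_ge0// ltW.
  apply: (@le_trans _ _ (E / Z * (Y + Y `^ (1 - nu) * v `^ r))).
    by rewrite ler_wpM2l// divr_ge0// ltW.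
  by rewrite !mulrDr KY addrC lerD2r mulrA ler_wpM2r// powR_ge0.
Qed.

End Scales.

(** * Integrals of bounded measurable functions; local criteria for increments *)

Section BoundedMeasurable.
Context {R : realType}.
Notation mu := (@lebesgue_measure R).
Implicit Types (A B a b e M : R) (p q Q : R -> R).

(** The bound holds at every point, so that integrability is automatic in all integral identities
    below. Essentially bounded controls are first replaced by representatives bounded in this
    sense. *)
Definition bmeas A B p : Prop :=
  measurable_fun `[A, B] p /\ exists M, forall s, s \in `[A, B] -> `|p s| <= M.

Definition Int a b p : R := \int[mu]_(s in `[a, b]) p s.

Lemma itv_lebesgue_lty a b : (mu `[a, b]%classic < +oo)%E.
Proof. by rewrite lebesgue_measure_itv/=; case: ifP => // _; rewrite -EFinB ltry. Qed.

Lemma bmeas_integrable A B p : bmeas A B p -> mu.-integrable `[A, B] (EFin \o p).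
Proof.
move=> [mp [M pM]]; apply: measurable_bounded_integrable => //.
  exact: itv_lebesgue_lty.
exists M; split; first exact: num_real.
by move=> r Mr s /= sAB; rewrite (le_trans (pM _ sAB))// ltW.
Qed.

Lemma subset_itv_cc A B a b : A <= a -> b <= B -> `[a, b]%classic `<=` `[A, B]%classic.
Proof. by move=> Aa bB; apply: subset_itvScc; rewrite bnd_simp. Qed.

Lemma bmeas_sub A B a b p : A <= a -> b <= B -> bmeas A B p -> bmeas a b p.
Proof.
move=> Aa bB [mp [M pM]]; split.
  by apply: measurable_funS mp => //; exact: subset_itv_cc.
by exists M => s sab; apply: pM; exact: (subset_itv_cc Aa bB).
Qed.

Lemma bmeas_eq A B p q : {in `[A, B], p =1 q} -> bmeas A B p -> bmeas A B q.
Proof.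
move=> pq [mp [M pM]]; split.
  by apply: eq_measurable_fun mp => s; rewrite inE => sAB; exact: pq.
by exists M => s sAB; rewrite -pq// pM.
Qed.

Lemma bmeas_cst A B a : bmeas A B (fun=> a).
Proof. by split; [exact: measurable_cst|exists `|a|]. Qed.

Lemma bmeasD A B p q : bmeas A B p -> bmeas A B q -> bmeas A B (fun s => p s + q s).
Proof.
move=> [mp [M pM]] [mq [N qN]]; split; first exact: measurable_funD.
exists (M + N) => s sAB; rewrite (le_trans (ler_normD _ _))//.
by rewrite lerD ?pM ?qN.
Qed.

Lemma bmeasM A B p q : bmeas A B p -> bmeas A B q -> bmeas A B (fun s => p s * q s).
Proof.
move=> [mp [M pM]] [mq [N qN]]; split; first exact: measurable_funM.
by exists (M * N) => s sAB; rewrite normrM ler_pM ?pM ?qN.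
Qed.

Lemma bmeasZ A B a p : bmeas A B p -> bmeas A B (fun s => a * p s).
Proof. by move=> bp; apply: bmeasM => //; exact: bmeas_cst. Qed.

Lemma bmeasN A B p : bmeas A B p -> bmeas A B (fun s => - p s).
Proof. by move=> /(bmeasZ (-1)); apply: bmeas_eq => s _; rewrite mulN1r. Qed.

Lemma bmeasB A B p q : bmeas A B p -> bmeas A B q -> bmeas A B (fun s => p s - q s).
Proof. by move=> bp /bmeasN; exact: bmeasD. Qed.

Lemma bmeas_sum A B (I : Type) (r : seq I) (p : I -> R -> R) :
  (forall i, bmeas A B (p i)) -> bmeas A B (fun s => \sum_(i <- r) p i s).
Proof.
move=> bp; elim: r => [|i r IH].
  by apply: bmeas_eq (bmeas_cst A B 0) => s _; rewrite big_nil.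
by apply: bmeas_eq (bmeasD (bp i) IH) => s _; rewrite big_cons.
Qed.

Lemma bmeas_lip A B M p :
  (forall a b, A <= a -> a <= b -> b <= B -> `|p b - p a| <= M * (b - a)) ->
  bmeas A B p.
Proof.
move=> lip.
have lip' a b : a \in `[A, B] -> b \in `[A, B] -> `|p b - p a| <= M * `|b - a|.
  rewrite !in_itv/= => /andP[Aa aB] /andP[Ab bB].
  have [ab|ba] := leP a b; first by rewrite (@ger0_norm _ (b - a)) ?subr_ge0// lip.
  have {}ba := ltW ba.
  by rewrite distrC (distrC b) (@ger0_norm _ (a - b)) ?subr_ge0 ?lip.
have [AB|BA] := leP A B; last first.
  rewrite /bmeas; have -> : `[A, B]%classic = set0.
    by rewrite set_itv_ge// bnd_simp -ltNge.
  split; first exact: measurable_fun_set0.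
  exists 0 => s; rewrite in_itv/= => /andP[As sB].
  by have := lt_le_trans BA (le_trans As sB); rewrite ltxx.
have AAB : A \in `[A, B] by rewrite in_itv/= lexx.
split; last first.
  exists (`|p A| + `|M| * (B - A)) => s sAB.
  rewrite -[p s](subrKC (p A)) (le_trans (ler_normD _ _))// lerD2l.
  rewrite (le_trans (lip' _ _ AAB sAB))//.
  move: sAB; rewrite in_itv/= => /andP[As sB].
  rewrite ger0_norm ?subr_ge0//.
  apply: (@le_trans _ _ (`|M| * (s - A))).
    by rewrite ler_wpM2r ?subr_ge0// ler_norm.
  by rewrite ler_wpM2l// lerD2r.
apply: subspace_continuous_measurable_fun => //.
apply/subspace_continuousP => s sAB.
apply/cvgrPdist_lt => eps eps0.
have M0 : 0 < `|M| + 1 by rewrite ltr_wpDl.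
rewrite near_withinE; near=> r => rAB /=.
apply: (le_lt_trans (lip' _ _ rAB sAB)).
apply: (@le_lt_trans _ _ ((`|M| + 1) * `|s - r|)).
  by rewrite ler_wpM2r// (le_trans (ler_norm _))// lerDl.
rewrite mulrC -ltr_pdivlMr//; near: r.
by apply: (@cvgr_dist_lt _ _ _ _ _ id); rewrite ?divr_gt0.
Unshelve. all: by end_near. Qed.

Lemma Int_le A B p q : bmeas A B p -> bmeas A B q ->
  (forall s, s \in `[A, B] -> p s <= q s) -> Int A B p <= Int A B q.
Proof.
by move=> bp bq pq; apply: le_Rintegral => //; exact: bmeas_integrable.
Qed.

Lemma eq_Int A B p q : {in `[A, B], p =1 q} -> Int A B p = Int A B q.
Proof. by move=> pq; apply: eq_Rintegral => s; rewrite inE; exact: pq. Qed.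

Lemma IntD A B p q : bmeas A B p -> bmeas A B q ->
  Int A B (fun s => p s + q s) = Int A B p + Int A B q.
Proof. by move=> bp bq; apply: RintegralD => //; exact: bmeas_integrable. Qed.

Lemma IntB A B p q : bmeas A B p -> bmeas A B q ->
  Int A B (fun s => p s - q s) = Int A B p - Int A B q.
Proof. by move=> bp bq; apply: RintegralB => //; exact: bmeas_integrable. Qed.

Lemma IntZ A B a p : bmeas A B p -> Int A B (fun s => a * p s) = a * Int A B p.
Proof. by move=> bp; apply: RintegralZl => //; exact: bmeas_integrable. Qed.

Lemma IntN A B p : bmeas A B p -> Int A B (fun s => - p s) = - Int A B p.
Proof.
move=> bp; rewrite -[RHS]mulN1r -IntZ//.
by apply: eq_Int => s _; rewrite mulN1r.
Qed.

Lemma Int_cst A B a : A <= B -> Int A B (fun=> a) = a * (B - A).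
Proof.
move=> AB; rewrite /Int Rintegral_cst//= lebesgue_measure_itv/= lte_fin.
by move: AB; rewrite le_eqVlt => /predU1P[->|->//]; rewrite ltxx subrr.
Qed.

Lemma Int_ge0 A B p : (forall s, s \in `[A, B] -> 0 <= p s) -> 0 <= Int A B p.
Proof. by move=> p0; exact: Rintegral_ge0. Qed.

Lemma Int_sum A B (I : Type) (r : seq I) (p : I -> R -> R) :
  (forall i, bmeas A B (p i)) ->
  Int A B (fun s => \sum_(i <- r) p i s) = \sum_(i <- r) Int A B (p i).
Proof.
move=> bp; elim: r => [|i r IH].
  rewrite big_nil -[RHS](mul0r (B - A)); have [AB|BA] := leP A B.
    by rewrite -Int_cst//; apply: eq_Int => s _; rewrite big_nil.
  rewrite mul0r /Int set_itv_ge ?Rintegral_set0//.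
  by rewrite bnd_simp -ltNge.
rewrite big_cons -IH -IntD//; last exact: bmeas_sum.
by apply: eq_Int => s _; rewrite big_cons.
Qed.

Lemma Int_split_integrable A B m p : A <= m -> m <= B ->
  mu.-integrable `[A, B] (EFin \o p) -> Int A B p = Int A m p + Int m B p.
Proof.
move=> Am mB ip; have := @Rintegral_itvB _ p (BLeft A) (BRight B) m ip.
rewrite !bnd_simp => /(_ Am mB) h.
rewrite /Int -(Rintegral_itv_obnd_cbnd (r := m)); last first.
  apply: integrableS ip => //; apply: subset_itv; rewrite bnd_simp //.
by rewrite -h subrKC.
Qed.

Lemma Int_split A B m p : A <= m -> m <= B -> bmeas A B p ->
  Int A B p = Int A m p + Int m B p.
Proof. by move=> Am mB /bmeas_integrable; exact: Int_split_integrable. Qed.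

Lemma Int_abs_le A B p : bmeas A B p -> `|Int A B p| <= Int A B (fun s => `|p s|).
Proof. by move=> bp; apply: le_normr_Rintegral => //; exact: bmeas_integrable. Qed.

Lemma bmeas_norm A B p : bmeas A B p -> bmeas A B (fun s => `|p s|).
Proof.
move=> [mp [M pM]]; split; last by exists M => s /pM; rewrite normr_id.
exact: measurableT_comp.
Qed.

Lemma Int_point A p : Int A A p = 0.
Proof. by rewrite /Int set_itv1 Rintegral_set1. Qed.

Lemma EFin_Int A B p : bmeas A B p ->
  (\int[mu]_(s in `[A, B]) (p s)%:E = (Int A B p)%:E)%E.
Proof.
move=> /bmeas_integrable ip; rewrite /Int /Rintegral fineK//.
exact: integrable_fin_num.
Qed.

(* A subdivision into [n] equal pieces makes the quadratic defect [O(1 / n)]. *)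
Lemma increment_ge_of_local A B e M Q : A <= B ->
  (forall a b, A <= a -> a <= b -> b <= B ->
     - e * (b - a) - M * (b - a) ^+ 2 <= Q b - Q a) ->
  - e * (B - A) <= Q B - Q A.
Proof.
move=> AB loc; rewrite leNgt; apply/negP => lt.
pose gap := - e * (B - A) - (Q B - Q A).
have gap0 : 0 < gap by rewrite subr_gt0.
pose C := `|M| * (B - A) ^+ 2.
have C0 : 0 <= C by rewrite mulr_ge0// sqr_ge0.
pose N := (Num.bound (C / gap)).+1.
have N0 : 0 < N%:R :> R by rewrite ltr0n.
have CN : C < gap * N%:R.
  have Cg : 0 <= C / gap by rewrite divr_ge0// ltW.
  rewrite mulrC -ltr_pdivrMr//; apply: (lt_le_trans (archi_boundP Cg)).
  by rewrite ler_nat leqnSn.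
pose d := (B - A) / N%:R.
have d0 : 0 <= d by rewrite divr_ge0 ?subr_ge0// ltW.
have dN : d * N%:R = B - A by rewrite divfK// gt_eqF.
have step k : (k <= N)%N ->
    k%:R * (- e * d - M * d ^+ 2) <= Q (A + k%:R * d) - Q A.
  elim: k => [|k IH] kN; first by rewrite !mul0r addr0 subrr.
  have h1 : A <= A + k%:R * d by rewrite lerDl mulr_ge0.
  have h2 : A + k%:R * d <= A + k.+1%:R * d.
    by rewrite lerD2l ler_wpM2r// ler_nat.
  have h3 : A + k.+1%:R * d <= B.
    by rewrite -lerBrDl -dN mulrC ler_wpM2l// ler_nat.
  have := loc _ _ h1 h2 h3.
  have -> : A + k.+1%:R * d - (A + k%:R * d) = d by rewrite -natr1; ring.
  have := IH (ltnW kN); rewrite -natr1; lra.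
have := step N (leqnn _).
have -> : A + N%:R * d = B by rewrite mulrC dN subrKC.
rewrite [X in X <= _]mulrC => h.
have : N%:R * (gap * N%:R) <= N%:R * C.
  have -> : N%:R * (gap * N%:R) = N%:R * N%:R * gap by ring.
  have h'' : gap <= M * d ^+ 2 * N%:R by rewrite /gap -dN; lra.
  apply: (@le_trans _ _ (N%:R * N%:R * (M * d ^+ 2 * N%:R))).
    by rewrite ler_wpM2l// mulr_ge0.
  have -> : N%:R * N%:R * (M * d ^+ 2 * N%:R) = N%:R * (M * (d * N%:R) ^+ 2) by ring.
  by rewrite dN ler_wpM2l// ler_wpM2r ?sqr_ge0// ler_norm.
by rewrite ler_pM2l// leNgt CN.
Qed.

(** The function [k s - exp (- L (s - A)) * j s] has nonnegative increments up to a quadratic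
    defect, so [increment_ge_of_local] with rate 0 applies. The constant [M] leaves no trace in the
    conclusion, so crude local bounds may be put into it. *)
Lemma gronwall_local A B L M (k j : R -> R) : A <= B -> 0 <= L ->
  (forall s, 0 <= j s) ->
  (forall a b, A <= a -> a <= b -> b <= B -> k a <= k b) ->
  (forall a b, A <= a -> a <= b -> b <= B ->
    j b <= j a + L * (b - a) * j a + (k b - k a) + M * (b - a) ^+ 2) ->
  j B <= expR (L * (B - A)) * (j A + (k B - k A)).
Proof.
move=> AB L0 j0 kmono loc.
pose E s := expR (- (L * (s - A))).
pose Q s := k s - E s * j s.
have E1 s : A <= s -> E s <= 1.
  by move=> As; rewrite -expR0 ler_expR oppr_le0 mulr_ge0// subr_ge0.
have : 0 <= Q B - Q A.
  rewrite -(mul0r (B - A)) -(oppr0 R); apply: (@increment_ge_of_local A B 0 `|M|) => // a b Aa ab bB.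
  rewrite oppr0 mul0r sub0r /Q.
  have E0 s : 0 <= E s by exact: expR_ge0.
  have Eab : E b * (1 + L * (b - a)) <= E a.
    have -> : E a = E b * expR (L * (b - a)).
      by rewrite -expRD; congr expR; ring.
    by rewrite ler_wpM2l// expR_ge1Dx.
  have := loc _ _ Aa ab bB => h.
  have Ab := le_trans Aa ab.
  have h1 : E b * j b <= E b * (j a + L * (b - a) * j a + (k b - k a) + M * (b - a) ^+ 2).
    by rewrite ler_wpM2l.
  have h2 : E b * (1 + L * (b - a)) * j a <= E a * j a by rewrite ler_wpM2r.
  have h3 : E b * (k b - k a) <= k b - k a.
    by rewrite ler_piMl ?E1// subr_ge0 kmono.
  have h4 : E b * (M * (b - a) ^+ 2) <= `|M| * (b - a) ^+ 2.
    rewrite mulrCA mulrA; apply: ler_wpM2r; first exact: sqr_ge0.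
    rewrite (le_trans (ler_norm _))// normrM (ger0_norm (E0 _)).
    by rewrite ler_piMr ?E1.
  lra.
rewrite /Q {2}/E subrr mulr0 oppr0 expR0 mul1r => h.
have -> : j B = expR (L * (B - A)) * (E B * j B).
  by rewrite mulrA -expRD addrN expR0 mul1r.
rewrite ler_wpM2l ?expR_ge0//; lra.
Qed.

End BoundedMeasurable.

(** * Grid cells and measurability with respect to discrete data *)

Section Cells.
Context {R : realType}.

Definition cell {m : nat} (eta : R) (u : 'rV[R]_m) : 'rV[int]_m :=
  map_mx (fun r => Num.floor (r / eta)) u.

Lemma floor_close (eta r s : R) : 0 < eta ->
  Num.floor (r / eta) = Num.floor (s / eta) -> `|r - s| <= eta.
Proof.
move=> eta0 e; have /andP[] := floor_itv (r / eta); have /andP[] := floor_itv (s / eta).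
rewrite e intrD ler_pdivlMr// ltr_pdivrMr// ler_pdivlMr// ltr_pdivrMr// mulrDl mul1r.
by move=> *; rewrite ler_norml; apply/andP; split; lra.
Qed.

Lemma cell_close {m : nat} (eta : R) (u v : 'rV[R]_m) : 0 < eta ->
  cell eta u = cell eta v -> enorm (u - v) <= m%:R * eta.
Proof.
move=> eta0 /rowP e; apply: enorm_le_coord => i; rewrite !mxE.
by apply: floor_close => //; have := e i; rewrite !mxE.
Qed.

Definition mvec (D : set R) {m : nat} (u : R -> 'rV[R]_m) : Prop :=
  forall i, measurable_fun D (fun s => u s 0 i).

(** Measurability for the discrete sigma-algebra on the target. Every function of such a [c], even
    one made by arbitrary choices, is then measurable. *)
Definition cmeas (D : set R) {C : Type} (c : R -> C) : Prop :=
  forall P : set C, measurable (D `&` c @^-1` P).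

Lemma cmeas_levels (D : set R) {C : countType} (c : R -> C) :
  (forall j, measurable (D `&` [set s | c s = j])) -> cmeas D c.
Proof.
move=> mc P.
rewrite (_ : _ `&` _ = \bigcup_(j in P) (D `&` [set s | c s = j])); last first.
  apply/seteqP; split => [s [Ds Pcs]|s [j Pj [Ds /= csj]]].
    by exists (c s).
  by split => //; rewrite /preimage/= csj.
rewrite bigcup_mkcond; apply: countable_bigcupT_measurable.
  exact: countableP.
by move=> j; case: ifP.
Qed.

Lemma cmeas_comp (D : set R) {C C' : Type} (c : R -> C) (psi : C -> C') :
  cmeas D c -> cmeas D (psi \o c).
Proof. by move=> mc P; exact: (mc (psi @^-1` P)). Qed.

Lemma cmeas_measurable (D : set R) {C : Type} (c : R -> C) (psi : C -> R) :
  cmeas D c -> measurable_fun D (psi \o c).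
Proof. by move=> mc _ Y _; exact: cmeas_comp. Qed.

Lemma cmeas_pair (D : set R) {C C' : countType} (c : R -> C) (c' : R -> C') :
  cmeas D c -> cmeas D c' -> cmeas D (fun s => (c s, c' s)).
Proof.
move=> mc mc'; apply: cmeas_levels => -[j j'].
rewrite (_ : _ `&` _ = (D `&` c @^-1` [set j]) `&` (D `&` c' @^-1` [set j'])).
  exact: measurableI.
by apply/seteqP; split=> [s [Ds [/= -> ->]]|s [[Ds /= <-] [_ /= <-]]].
Qed.

Lemma cmeas_bool (D : set R) (b : R -> bool) :
  measurable D -> measurable_fun D b -> cmeas D b.
Proof. by move=> mD mb P; exact: mb. Qed.

Lemma cmeas_floor (D : set R) (eta : R) (p : R -> R) : measurable D -> 0 < eta ->
  measurable_fun D p -> cmeas D (fun s => Num.floor (p s / eta)).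
Proof.
move=> mD eta0 mp; apply: cmeas_levels => j.
rewrite (_ : _ `&` _ = D `&` p @^-1` `[j%:~R * eta, (j + 1)%:~R * eta[%classic).
  exact: mp.
apply/seteqP; split => s [Ds] /=.
  move=> <-; split => //=; rewrite in_itv/=.
  by rewrite -ler_pdivlMr// -ltr_pdivrMr// floor_itv.
rewrite in_itv/= -ler_pdivlMr// -ltr_pdivrMr// => h; split => //.
exact: floor_def.
Qed.

Lemma cmeas_cell (D : set R) {m : nat} (eta : R) (u : R -> 'rV[R]_m) :
  measurable D -> 0 < eta -> mvec D u -> cmeas D (fun s => cell eta (u s)).
Proof.
move=> mD eta0 mu; apply: cmeas_levels => j.
rewrite (_ : _ `&` _ = D `&` \bigcap_(i in [set: 'I_m])
    (D `&` (fun s => Num.floor (u s 0 i / eta)) @^-1` [set j 0 i])).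
  apply: measurableI => //; apply: fin_bigcap_measurable.
    exact: finite_finset.
  by move=> i _; exact: cmeas_floor.
apply/seteqP; split => [s [Ds /= <-]|s [Ds h]].
  by split => // i _; split => //=; rewrite mxE.
by split => //=; apply/rowP => i; rewrite mxE; have [_ ->] := h i I.
Qed.

Lemma measurable_enorm (D : set R) {m : nat} (u : R -> 'rV[R]_m) :
  mvec D u -> measurable_fun D (fun s => enorm (u s)).
Proof.
move=> mu; have -> : (fun s => enorm (u s)) =
    (@powR R ^~ 2^-1) \o (fun s => edot (u s) (u s)).
  by apply/funext => s /=; rewrite powR12_sqrt// edot_ge0.
apply: measurableT_comp; first exact: measurable_powR.
by apply: measurable_sum => i; exact: measurable_funM.
Qed.

Lemma measurable_enorm_powR (D : set R) {m : nat} (u : R -> 'rV[R]_m) (r : R) :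
  mvec D u -> measurable_fun D (fun s => enorm (u s) `^ r).
Proof.
move=> mu; apply: (measurableT_comp (measurable_powR r)); exact: measurable_enorm.
Qed.

End Cells.

(** * Measurability of continuous data along measurable paths *)

Section MeasurableSuperposition.
Context {R : realType} {n m1 m2 : nat}.
Variables (T : R) (U1 : set 'rV[R]_m1) (U2 : set 'rV[R]_m2).

Definition cont_on_game (F : R -> 'rV[R]_n -> 'rV[R]_m1 -> 'rV[R]_m2 -> R) :=
  forall s x u1 u2, s \in `[0, T] -> U1 u1 -> U2 u2 -> forall e, 0 < e ->
  exists2 d, 0 < d & forall s' x' u1' u2', s' \in `[0, T] -> U1 u1' -> U2 u2' ->
    `|s - s'| <= d -> enorm (x - x') <= d -> enorm (u1 - u1') <= d ->
    enorm (u2 - u2') <= d -> `|F s x u1 u2 - F s' x' u1' u2'| < e.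

(* Replacing the arguments by representatives of their cell in the game domain
   gives a countably valued, hence measurable, approximation. *)
Lemma measurable_superposition (D : set R) F (y : R -> 'rV[R]_n)
    (u1 : R -> 'rV[R]_m1) (u2 : R -> 'rV[R]_m2) : measurable D ->
  cont_on_game F -> mvec D y -> mvec D u1 -> mvec D u2 ->
  (forall s, D s -> [/\ s \in `[0, T], U1 (u1 s) & U2 (u2 s)]) ->
  measurable_fun D (fun s => F s (y s) (u1 s) (u2 s)).
Proof.
move=> mD cF my mu1 mu2 dom.
pose X : Type := (R * 'rV[R]_n * 'rV[R]_m1 * 'rV[R]_m2)%type.
pose C : countType := (int * 'rV[int]_n * 'rV[int]_m1 * 'rV[int]_m2)%type.
pose P : set X := [set p | [/\ p.1.1.1 \in `[0, T], U1 p.1.2 & U2 p.2]].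
pose eta (k : nat) : R := k.+1%:R^-1.
have eta0 k : 0 < eta k by rewrite invr_gt0.
pose c k (p : X) : C := (Num.floor (p.1.1.1 / eta k), cell (eta k) p.1.1.2,
   cell (eta k) p.1.2, cell (eta k) p.2).
(* [F] is continuous only within the game domain, hence representatives taken there. The default
   serves cells missing the domain; it is never taken along the path, since [z s] itself is a
   witness for its own cell. *)
pose rep k (j : C) : X := xget (0, 0, 0, 0) [set p | P p /\ c k p = j].
pose z s : X := (s, y s, u1 s, u2 s).
pose Fp (p : X) := F p.1.1.1 p.1.1.2 p.1.2 p.2.
apply: (@measurable_fun_cvg _ _ _ _ (fun k => (Fp \o rep k) \o (fun s => c k (z s)))).
  move=> k; apply: cmeas_measurable.
  do 3 (apply: cmeas_pair; last exact: cmeas_cell).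
  by apply: cmeas_floor => //; exact: measurable_id.
move=> s Ds; have [sT U1s U2s] := dom _ Ds.
apply/cvgrPdist_lt => e e0.
have [d d0 hd] := cF s (y s) (u1 s) (u2 s) sT U1s U2s e e0.
pose N : R := 1 + n%:R + m1%:R + m2%:R.
have N0 : 0 < N by rewrite /N !ltr_wpDr.
have dN : 0 < d / N by rewrite divr_gt0.
near=> k.
have hk : (d / N)^-1 <= k%:R by near: k; exact: nbhs_infty_ger.
rewrite /=.
have Nk : N * eta k <= d.
  rewrite mulrC -ler_pdivlMr// /eta.
  rewrite -[leRHS]invrK lef_pV2 ?posrE ?invr_gt0//.
  by rewrite (le_trans hk)// ler_nat.
have [[rP1 rP2 rP3] rc] : P (rep k (c k (z s))) /\ c k (rep k (c k (z s))) = c k (z s).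
  have := @xgetPex _ (0, 0, 0, 0) [set p | P p /\ c k p = c k (z s)].
  by apply; exists (z s).
have bnd (a : R) : 0 <= a -> a <= N -> a * eta k <= d.
  move=> _ aN; apply: le_trans Nk; rewrite ler_wpM2r//; exact: ltW.
have N1 : 1 <= N by rewrite /N -!addrA lerDl !addr_ge0.
have Nn : n%:R <= N by rewrite /N addrAC -!addrA addrCA lerDl !addr_ge0.
have Nm1 : m1%:R <= N by rewrite /N addrAC lerDr !addr_ge0.
have Nm2 : m2%:R <= N by rewrite /N lerDr !addr_ge0.
case: rc => rc1 rc2 rc3 rc4; apply: hd => //.
- by rewrite distrC (le_trans (floor_close (eta0 k) rc1))// -[leLHS]mul1r bnd.
- by rewrite enormBC (le_trans (cell_close (eta0 k) rc2))// bnd.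
- by rewrite enormBC (le_trans (cell_close (eta0 k) rc3))// bnd.
- by rewrite enormBC (le_trans (cell_close (eta0 k) rc4))// bnd.
Unshelve. all: by end_near. Qed.

End MeasurableSuperposition.

(** * Paths with bounded velocity *)

Section Primitives.
Context {R : realType} {n : nat}.
Implicit Types (t e a b B L : R) (x : 'rV[R]_n) (y v : R -> 'rV[R]_n).

Definition primitive t e x y v : Prop := forall i,
  bmeas t e (fun r => v r 0 i) /\
  forall s, s \in `[t, e] -> y s 0 i = x 0 i + Int t s (fun r => v r 0 i).

Definition vbmeas t e v : Prop := forall i, bmeas t e (fun r => v r 0 i).

Lemma vbmeas_sub t e a b v : t <= a -> b <= e -> vbmeas t e v -> vbmeas a b v.
Proof. by move=> ta be bv i; apply: bmeas_sub (bv i). Qed.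

Lemma vbmeas_bound t e v : vbmeas t e v ->
  exists2 B, 0 <= B & forall r, r \in `[t, e] -> enorm (v r) <= B.
Proof.
move=> bv.
have bs : bmeas t e (fun r => \sum_(i < n) `|v r 0 i|).
  by apply: bmeas_sum => i; exact: bmeas_norm.
have [_ [B hB]] := bs; exists `|B| => // r rte.
rewrite (le_trans (enorm_le_sum _))// (le_trans (ler_norm _))//.
by rewrite (le_trans (hB _ rte))// ler_norm.
Qed.

Lemma vbmeas_enorm t e v : vbmeas t e v -> bmeas t e (fun r => enorm (v r)).
Proof.
move=> bv; split; first by apply: measurable_enorm => i; have [] := bv i.
by have [B _ hB] := vbmeas_bound bv; exists B => s /hB; rewrite ger0_norm// enorm_ge0.
Qed.

Lemma vbmeas_edot t e v w : vbmeas t e v -> vbmeas t e w ->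
  bmeas t e (fun r => edot (v r) (w r)).
Proof. by move=> bv bw; apply: bmeas_sum => i; exact: bmeasM. Qed.

Lemma vbmeas_cst t e x : vbmeas t e (fun=> x).
Proof. by move=> i; exact: bmeas_cst. Qed.

Lemma vbmeasB t e v w : vbmeas t e v -> vbmeas t e w -> vbmeas t e (fun r => v r - w r).
Proof.
by move=> bv bw i; apply: bmeas_eq (bmeasB (bv i) (bw i)) => s _; rewrite !mxE.
Qed.

Lemma primitive_vbmeas t e x y v : primitive t e x y v -> vbmeas t e v.
Proof. by move=> p i; have [] := p i. Qed.

Lemma primitive_incr t e x y v a b i : primitive t e x y v ->
  t <= a -> a <= b -> b <= e -> y b 0 i - y a 0 i = Int a b (fun r => v r 0 i).
Proof.
move=> p ta ab be; have [bv h] := p i.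
rewrite !h ?in_itv/= ?ta ?be ?(le_trans ab)// ?(le_trans ta)//.
rewrite (@Int_split _ t b a)//; first by ring.
exact: bmeas_sub bv.
Qed.

Lemma edot_primitive t e x y v a b (q : 'rV[R]_n) : primitive t e x y v ->
  t <= a -> a <= b -> b <= e ->
  edot q (y b - y a) = Int a b (fun r => edot q (v r)).
Proof.
move=> p ta ab be; rewrite /edot Int_sum.
  apply: eq_bigr => i _; rewrite !mxE (primitive_incr _ p)// IntZ//.
  by have [bv _] := p i; apply: bmeas_sub bv.
by move=> i; apply: bmeasZ; have [bv _] := p i; apply: bmeas_sub bv.
Qed.

(** Pairing the increment with itself turns the vector integral into a scalar one, to which the
    Cauchy-Schwarz inequality applies pointwise. *)
Lemma primitive_dist t e x y v a b : primitive t e x y v ->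
  t <= a -> a <= b -> b <= e -> enorm (y b - y a) <= Int a b (fun r => enorm (v r)).
Proof.
move=> p ta ab be; set q := y b - y a.
have bv := vbmeas_sub ta be (primitive_vbmeas p).
have [q0|q0] := eqVneq (enorm q) 0.
  by rewrite q0 Int_ge0// => s _; exact: enorm_ge0.
have qp : 0 < enorm q by rewrite lt_neqAle eq_sym q0 enorm_ge0.
rewrite -(ler_pM2l qp) -expr2 enorm_sqr (edot_primitive q p)// -IntZ; last first.
  exact: vbmeas_enorm.
apply: Int_le => [||s _]; last exact: edot_le.
  by apply: vbmeas_edot => //; exact: vbmeas_cst.
by apply: bmeasZ; exact: vbmeas_enorm.
Qed.

Lemma primitive_lip t e x y v a b B : primitive t e x y v ->
  (forall r, r \in `[t, e] -> enorm (v r) <= B) ->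
  t <= a -> a <= b -> b <= e -> enorm (y b - y a) <= B * (b - a).
Proof.
move=> p hB ta ab be; apply: (le_trans (primitive_dist p ta ab be)).
rewrite -Int_cst//; apply: Int_le => [||s sab]; last by apply/hB/(subset_itv_cc ta be).
  exact/vbmeas_enorm/(vbmeas_sub ta be (primitive_vbmeas p)).
exact: bmeas_cst.
Qed.

Lemma primitive_start t e x y v : primitive t e x y v -> t <= e -> y t = x.
Proof.
move=> p te; apply/rowP => i; have [_ ->] := p i; first by rewrite Int_point addr0.
by rewrite in_itv/= lexx.
Qed.

Lemma primitive_path t e x y v : primitive t e x y v -> vbmeas t e y.
Proof.
move=> p i; have [B _ hB] := vbmeas_bound (primitive_vbmeas p).
apply: (@bmeas_lip _ _ _ B) => a b ta ab be.
apply: le_trans (primitive_lip p hB ta ab be).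
by have := coord_le_enorm (y b - y a) i; rewrite !mxE.
Qed.

Lemma primitive_sub t e x y v a b : primitive t e x y v ->
  t <= a -> b <= e -> primitive a b (y a) y v.
Proof.
move=> p ta be i; have [bv h] := p i; split; first exact: bmeas_sub bv.
move=> s; rewrite in_itv/= => /andP[as_ sb].
by rewrite -(primitive_incr _ p) ?(le_trans sb)// subrKC.
Qed.

Lemma primitiveB t e x x' y y' v v' : primitive t e x y v -> primitive t e x' y' v' ->
  primitive t e (x - x') (fun s => y s - y' s) (fun s => v s - v' s).
Proof.
move=> p p' i; have [bv h] := p i; have [bv' h'] := p' i; split.
  exact: (vbmeasB (primitive_vbmeas p) (primitive_vbmeas p')).
move=> s ste; rewrite !mxE h// h'//.
have /andP[ts se] : t <= s <= e by move: ste; rewrite in_itv.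
have -> : Int t s (fun r => (v r - v' r) 0 i) = Int t s (fun r => v r 0 i - v' r 0 i).
  by apply: eq_Int => r _; rewrite !mxE.
rewrite IntB; first ring.
  exact: bmeas_sub bv.
exact: bmeas_sub bv'.
Qed.

(** Gronwall for the bracket, which is 1-Lipschitz along the path. The bound [B] on the velocity
    enters only the quadratic defect, so the final estimate sees the controls through the integral
    of [k] alone. *)
Lemma jap_growth t e x y v L (k : R -> R) : primitive t e x y v -> 0 <= L ->
  bmeas t e k -> (forall r, r \in `[t, e] -> 0 <= k r) ->
  (forall r, r \in `[t, e] -> enorm (v r) <= L * (jap (y r) + k r)) ->
  forall s, s \in `[t, e] ->
    jap (y s) <= expR (L * (s - t)) * (jap x + L * Int t s k).
Proof.
move=> p L0 bk k0 hv s; rewrite in_itv/= => /andP[ts se].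
have te := le_trans ts se.
have [B B0 hB] := vbmeas_bound (primitive_vbmeas p).
have := @gronwall_local _ t s L (L * B) (fun r => L * Int t r k) (fun r => jap (y r)) ts L0.
rewrite (primitive_start p te) Int_point mulr0 subr0; apply => [r|a b ta ab bs|a b ta ab bs].
- exact: jap_ge0.
- rewrite ler_wpM2l// (@Int_split _ t b a)//; last first.
    by apply: bmeas_sub bk => //; exact: le_trans se.
  rewrite lerDl Int_ge0// => r; rewrite in_itv/= => /andP[ar rb]; apply: k0.
  by rewrite in_itv/= (le_trans ta)//= (le_trans rb)// (le_trans bs).
have be := le_trans bs se.
have bkab : bmeas a b k by exact: bmeas_sub bk.
have tb := le_trans ta ab.
rewrite -mulrBr (@Int_split _ t b a)//; last exact: bmeas_sub bk.
rewrite [X in _ + L * X + _](_ : _ = Int a b k); last by ring.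
have jr r : r \in `[a, b] -> jap (y r) <= jap (y a) + B * (b - a).
  rewrite in_itv/= => /andP[ar rb].
  rewrite (le_trans (jap_lip _ (y a)))// lerD2l.
  rewrite (le_trans (primitive_lip p hB ta ar _))//; first exact: le_trans be.
  by rewrite ler_wpM2l// lerD2r.
have h : enorm (y b - y a) <= Int a b (fun r => L * (jap (y a) + B * (b - a)) + L * k r).
  apply: (le_trans (primitive_dist p ta ab be)); apply: Int_le => [||r rab].
  - exact/vbmeas_enorm/(vbmeas_sub ta be (primitive_vbmeas p)).
  - by apply: bmeasD; [exact: bmeas_cst|exact: bmeasZ].
  rewrite -mulrDr; apply: (le_trans (hv _ (subset_itv_cc ta be rab))).
  by rewrite ler_wpM2l// lerD2r jr.
have -> : jap (y a) + L * (b - a) * jap (y a) + L * Int a b k + L * B * (b - a) ^+ 2 =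
  jap (y a) + (L * (jap (y a) + B * (b - a)) * (b - a) + L * Int a b k) by ring.
apply: (le_trans (jap_lip _ (y a))); rewrite lerD2l; apply: (le_trans h).
by rewrite IntD ?Int_cst ?(IntZ _ bkab)//; first [exact: bmeas_cst|exact: bmeasZ].
Qed.

End Primitives.

(** * Picard iteration for bounded, globally Lipschitz fields *)

Section Picard.
Context {R : realType} {n : nat}.
Implicit Types (t e B C L : R).

Lemma ler_geometric (a b C : R) : (forall k : nat, a <= b + C / 2 ^+ k) -> a <= b.
Proof.
move=> h; rewrite leNgt; apply/negP => ba.
have g0 : 0 < a - b by rewrite subr_gt0.
have := @upper_nthrootP R (`|C| / (a - b)) (Num.bound (`|C| / (a - b))) (leqnn _).
set k := Num.bound _; rewrite ltr_pdivrMr// => hk.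
have p0 : 0 < 2 ^+ k :> R by rewrite exprn_gt0.
have : a - b <= C / 2 ^+ k by have := h k; lra.
rewrite ler_pdivlMr// => hC.
have := le_lt_trans (le_trans hC (ler_norm C)) hk.
by rewrite mulrC ltxx.
Qed.

(** The intervals [[u k - d k, u k + d k]] with [d k = 2 * C / 2 ^ k] are nested, so the supremum of
    their left ends lies in all of them. *)
Lemma geometric_limit (u : nat -> R) C :
  (forall k, `|u k.+1 - u k| <= C / 2 ^+ k) ->
  exists l, forall k, `|u k - l| <= 2 * C / 2 ^+ k.
Proof.
move=> h.
have C0 : 0 <= C.
  by have := le_trans (normr_ge0 _) (h 0); rewrite expr0 divr1.
pose d k : R := 2 * C / 2 ^+ k.
have d0 k : 0 <= d k by rewrite divr_ge0 ?mulr_ge0// exprn_ge0.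
have dS k : d k = d k.+1 + C / 2 ^+ k.
  by rewrite /d exprS; field; rewrite expf_neq0.
have d2 k : d k.+1 = C / 2 ^+ k by rewrite /d exprS; field; rewrite expf_neq0.
have lo j k : (j <= k)%N -> u j - d j <= u k - d k.
  move=> /subnK <-; elim: (k - j)%N => [|i IH] //.
  apply: (le_trans IH); rewrite addSn.
  have := h (i + j)%N; rewrite ler_norml -d2 => /andP[+ _].
  by rewrite (dS (i + j)%N) -d2; lra.
have hi j k : (j <= k)%N -> u k + d k <= u j + d j.
  move=> /subnK <-; elim: (k - j)%N => [|i IH] //.
  apply: (le_trans _ IH); rewrite addSn.
  have := h (i + j)%N; rewrite ler_norml -d2 => /andP[_ +].
  by rewrite (dS (i + j)%N) -d2; lra.
have lohi j k : u j - d j <= u k + d k.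
  have := lo _ _ (leq_maxl j k); have := hi _ _ (leq_maxr j k).
  by have := d0 (maxn j k); lra.
exists (sup (range (fun j => u j - d j))) => k; rewrite -/(d k) ler_norml.
have ne : range (fun j => u j - d j) !=set0 by exists (u 0 - d 0); exists 0.
have hs : has_sup (range (fun j => u j - d j)).
  by split => //; exists (u 0 + d 0) => _ [j _ <-].
have : sup (range (fun j => u j - d j)) <= u k + d k.
  by apply: ge_sup => // _ [j _ <-].
have : u k - d k <= sup (range (fun j => u j - d j)).
  by apply: ub_le_sup; [case: hs|exists k].
by move=> *; apply/andP; split; lra.
Qed.

(** One inequality of the fundamental theorem of calculus is enough for the contraction. It follows
    from [exp a >= 1 + a] on short intervals, with a quadratic defect. *)
Lemma Int_expR_le t e L : 0 <= L -> t <= e ->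
  bmeas t e (fun r => expR (L * (r - t))) /\
  L * Int t e (fun r => expR (L * (r - t))) <= expR (L * (e - t)).
Proof.
move=> L0 te; pose E r := expR (L * (r - t)).
have Emono a b : a <= b -> E a <= E b.
  by move=> ab; rewrite ler_expR ler_wpM2l// lerD2r.
have Elip a b : t <= a -> a <= b -> b <= e -> `|E b - E a| <= L * E e * (b - a).
  move=> ta ab be; rewrite ger0_norm ?subr_ge0 ?Emono//.
  have -> : E a = E b * expR (- (L * (b - a))).
    by rewrite -expRD; congr expR; ring.
  have h := expR_ge1Dx (- (L * (b - a))).
  have h2 : E b * (1 + - (L * (b - a))) <= E b * expR (- (L * (b - a))).
    by rewrite ler_wpM2l// expR_ge0.
  have h3 : E b * (L * (b - a)) <= E e * (L * (b - a)).
    by rewrite ler_wpM2r ?mulr_ge0 ?subr_ge0// Emono.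
  lra.
have bE : bmeas t e E by exact: bmeas_lip Elip.
split => //; rewrite -/(E e).
suff : - 0 * (e - t) <= (E e - L * Int t e E) - (E t - L * Int t t E).
  rewrite Int_point oppr0 mul0r mulr0 subr0 => h.
  by have := expR_ge0 (L * (t - t)); rewrite -/(E t); lra.
apply: (@increment_ge_of_local _ t e 0 (L * L * E e) (fun s => E s - L * Int t s E)) => // a b ta ab be.
rewrite (@Int_split _ t b a)//; last first.
  by apply: bmeas_sub bE.
have h1 : Int a b E <= E b * (b - a).
  rewrite -Int_cst//; apply: Int_le => [||r]; last first.
    by rewrite in_itv/= => /andP[_ rb]; exact: Emono.
    exact: bmeas_cst.
  exact: bmeas_sub bE.
have h2 : E a * (1 + L * (b - a)) <= E b.
  have -> : E b = E a * expR (L * (b - a)).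
    by rewrite -expRD; congr expR; ring.
  by rewrite ler_wpM2l ?expR_ge0// expR_ge1Dx.
have h3 := ler_wpM2l L0 h1.
have := Elip _ _ ta ab be; rewrite ler_norml => /andP[_ h4].
have h5 : L * (b - a) * (E b - E a) <= L * (b - a) * (L * E e * (b - a)).
  by rewrite ler_wpM2l// mulr_ge0// subr_ge0.
rewrite oppr0 mul0r sub0r; lra.
Qed.

(* Picard iteration contracts by [1/2] in the norm weighted by
   [exp (- 2 L (s - t))]. *)
Lemma picard t e (x : 'rV[R]_n) (G : R -> 'rV[R]_n -> 'rV[R]_n) B L :
  t <= e -> 0 <= L ->
  (forall y, mvec `[t, e]%classic y -> mvec `[t, e]%classic (fun r => G r (y r))) ->
  (forall r z, r \in `[t, e] -> enorm (G r z) <= B) ->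
  (forall r z z', r \in `[t, e] -> enorm (G r z - G r z') <= L * enorm (z - z')) ->
  exists y, primitive t e x y (fun r => G r (y r)).
Proof.
move=> te L0 mG GB GL.
have tte : t \in `[t, e] by rewrite in_itv/= lexx.
have B0 : 0 <= B by exact: le_trans (enorm_ge0 _) (GB t 0 tte).
have bG y : mvec `[t, e]%classic y -> vbmeas t e (fun r => G r (y r)).
  move=> my i; split; first exact: mG.
  by exists B => r rte; rewrite (le_trans (coord_le_enorm _ _))// GB.
pose step (y : R -> 'rV[R]_n) s : 'rV[R]_n :=
  \row_i (x 0 i + Int t s (fun r => G r (y r) 0 i)).
have pstep y : mvec `[t, e]%classic y -> primitive t e x (step y) (fun r => G r (y r)).
  by move=> my i; split; [exact: bG|move=> s _; rewrite mxE].
have mpath y v : primitive t e x y v -> mvec `[t, e]%classic y.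
  by move=> /primitive_path p i; have [] := p i.
pose Y k := iter k step (fun=> x).
have mY k : mvec `[t, e]%classic (Y k).
  elim: k => [|k IH]; first by move=> i; exact: measurable_cst.
  exact: mpath (pstep _ IH).
pose D := 2 * L.
pose E r := expR (D * (r - t)).
have D0 : 0 <= D by rewrite mulr_ge0.
have E1 r : t <= r -> 1 <= E r.
  by move=> tr; rewrite -expR0 ler_expR mulr_ge0// subr_ge0.
pose C := B * (e - t).
have C0 : 0 <= C by rewrite mulr_ge0// subr_ge0.
have dY k s : s \in `[t, e] -> enorm (Y k.+1 s - Y k s) <= C / 2 ^+ k * E s.
  elim: k s => [|k IH] s ste; have /andP[ts se] : t <= s <= e by move: ste; rewrite in_itv.
    rewrite expr0 divr1.
    have p := pstep _ (mY 0).
    rewrite -[Y 0 s](primitive_start p te).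
    apply: (@le_trans _ _ (B * (s - t))).
      by apply: primitive_lip p _ _ _ _ => // r rte; exact: GB.
    apply: (@le_trans _ _ (C * 1)); first by rewrite mulr1 ler_wpM2l// lerD2r.
    by rewrite ler_wpM2l// E1.
  have p := primitiveB (pstep _ (mY k.+1)) (pstep _ (mY k)).
  have := primitive_dist p (lexx _) ts se.
  rewrite (primitive_start p te) subrr subr0 => h; apply: (le_trans h).
  have [bE hE] := Int_expR_le D0 ts.
  apply: (@le_trans _ _ (Int t s (fun r => C / 2 ^+ k.+1 * (D * E r)))).
    apply: Int_le => [||r rts].
    - exact/vbmeas_enorm/(vbmeas_sub (lexx _) se (primitive_vbmeas p)).
    - by do 2 apply: bmeasZ.
    have rte : r \in `[t, e] by exact: (subset_itv_cc (lexx _) se rts).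
    apply: (le_trans (GL _ _ _ rte)).
    apply: (@le_trans _ _ (L * (C / 2 ^+ k * E r))).
      by rewrite ler_wpM2l// IH.
    by rewrite /D exprS le_eqVlt; apply/orP; left; apply/eqP; field; rewrite expf_neq0.
  rewrite IntZ; last exact: bmeasZ.
  by rewrite IntZ// ler_wpM2l// divr_ge0// exprn_ge0.
pose C' := C * E e.
have C'0 : 0 <= C' by rewrite mulr_ge0// expR_ge0.
have ex s i : exists l, s \in `[t, e] -> forall k, `|Y k s 0 i - l| <= 2 * C' / 2 ^+ k.
  have [ste|] := boolP (s \in `[t, e]); last by exists 0.
  have [k|l hl] := @geometric_limit (fun k => Y k s 0 i) C'.
    have := coord_le_enorm (Y k.+1 s - Y k s) i; rewrite !mxE => h.
    apply: (le_trans h); apply: (le_trans (dY k s ste)).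
    rewrite /C' mulrAC ler_wpM2r ?invr_ge0 ?exprn_ge0// ler_wpM2l//.
    rewrite ler_expR ler_wpM2l// lerD2r.
    by move: ste; rewrite in_itv/= => /andP[].
  by exists l.
have /choice[l hl] : forall p : R * 'I_n, exists l, p.1 \in `[t, e] ->
    forall k, `|Y k p.1 0 p.2 - l| <= 2 * C' / 2 ^+ k by move=> [s i]; exact: ex.
pose y s : 'rV[R]_n := \row_i l (s, i).
have hy k s : s \in `[t, e] -> enorm (Y k s - y s) <= n%:R * (2 * C' / 2 ^+ k).
  by move=> ste; apply: enorm_le_coord => i; rewrite !mxE; exact: (hl (s, i)).
(* Every iterate after the first is [B]-Lipschitz; so is the limit, which is therefore
   measurable. *)
have my : mvec `[t, e]%classic y.
  move=> i; suff : bmeas t e (fun r => y r 0 i) by case.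
  apply: (@bmeas_lip _ _ _ B) => a b ta ab be.
  have ate : a \in `[t, e] by rewrite in_itv/= ta (le_trans ab).
  have bte : b \in `[t, e] by rewrite in_itv/= be (le_trans ta).
  apply: (@ler_geometric _ _ (4 * C')) => k.
  have := hl (a, i) ate k.+1; have := hl (b, i) bte k.+1 => /=.
  have : `|Y k.+1 b 0 i - Y k.+1 a 0 i| <= B * (b - a).
    have := coord_le_enorm (Y k.+1 b - Y k.+1 a) i; rewrite !mxE => h.
    apply: (le_trans h); apply: primitive_lip (pstep _ (mY k)) _ ta ab be => r rte.
    exact: GB.
  have -> : 2 * C' / 2 ^+ k.+1 = C' / 2 ^+ k by rewrite exprS; field; rewrite expf_neq0.
  have -> : 4 * C' / 2 ^+ k = 4 * (C' / 2 ^+ k) by ring.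
  have c0 : 0 <= C' / 2 ^+ k by rewrite divr_ge0// exprn_ge0.
  rewrite !mxE !ler_norml => /andP[? ?] /andP[? ?] /andP[? ?].
  by apply/andP; split; lra.
exists y => i; split; first exact: bG.
move=> s ste; have /andP[ts se] : t <= s <= e by move: ste; rewrite in_itv.
apply/eqP; rewrite -subr_eq0 -normr_le0.
pose K := 2 * C' + L * (n%:R * (2 * C')) * (s - t).
apply: (@ler_geometric _ _ K) => k; rewrite add0r.
have h1 := hl (s, i) ste k.+1.
have h2 : `|Int t s (fun r => G r (Y k r) 0 i) - Int t s (fun r => G r (y r) 0 i)| <=
    L * (n%:R * (2 * C' / 2 ^+ k)) * (s - t).
  have b1 := vbmeas_sub (lexx _) se (bG _ (mY k)).
  have b2 := vbmeas_sub (lexx _) se (bG _ my).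
  rewrite -IntB; [|exact: b1|exact: b2].
  have b12 := bmeasB (b1 i) (b2 i).
  apply: (le_trans (Int_abs_le b12)); rewrite -Int_cst//; apply: Int_le => [||r rts].
  - exact: bmeas_norm.
  - exact: bmeas_cst.
  have rte : r \in `[t, e] by exact: (subset_itv_cc (lexx _) se rts).
  have := coord_le_enorm (G r (Y k r) - G r (y r)) i; rewrite !mxE => h.
  apply: (le_trans h); apply: (le_trans (GL _ _ _ rte)).
  by rewrite ler_wpM2l// hy.
have e1 : Y k.+1 s 0 i = x 0 i + Int t s (fun r => G r (Y k r) 0 i) by rewrite mxE.
have -> : K / 2 ^+ k = 2 * (2 * C' / 2 ^+ k.+1) + L * (n%:R * (2 * C' / 2 ^+ k)) * (s - t).
  by rewrite /K exprS; field; rewrite expf_neq0.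
have c0 : 0 <= 2 * C' / 2 ^+ k.+1 by rewrite divr_ge0 ?exprn_ge0// mulr_ge0.
move: h1 h2; rewrite [y s 0 i]mxE/= e1 !ler_norml => /andP[? ?] /andP[? ?].
by apply/andP; split; lra.
Qed.

End Picard.

(** * Continuity on the game domain in Euclidean distance *)

Section Continuity.
Context {R : realType} {n m1 m2 : nat}.
Variables (T : R) (U1 : set 'rV[R]_m1) (U2 : set 'rV[R]_m2).

Lemma mx_ball_enorm {m : nat} (u v : 'rV[R]_m) (d : R) : 0 < d ->
  enorm (u - v) < d -> ball u d v.
Proof.
move=> d0 uv; split => // i j; rewrite /ball/= ord1.
by have := coord_le_enorm (u - v) j; rewrite !mxE => h; exact: le_lt_trans uv.
Qed.

Lemma cont_on_gameP (F : R -> 'rV[R]_n -> 'rV[R]_m1 -> 'rV[R]_m2 -> R) :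
  {within @game_domain R n m1 m2 T U1 U2,
     continuous (fun p => F p.1.1.1 p.1.1.2 p.1.2 p.2)} ->
  cont_on_game T U1 U2 F.
Proof.
move=> /subspace_continuousP cF s x u1 u2 sT U1u U2u e e0.
have /cvgrPdist_lt/(_ e e0) := cF (s, x, u1, u2) (And3 sT U1u U2u).
rewrite near_withinE => /nbhs_ballP[d /= d0 hd].
have d20 : 0 < d / 2 by rewrite divr_gt0.
have dd : d / 2 < d by rewrite ltr_pdivrMr// ltr_pMr// ltr1n.
exists (d / 2) => // s' x' u1' u2' s'T U1u' U2u' hs hx h1 h2.
apply: (hd (s', x', u1', u2')) => //.
by split; [split; [split|]|] => /=; first [exact: le_lt_trans hs dd |
   apply: mx_ball_enorm => //; first [exact: le_lt_trans hx dd |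
   exact: le_lt_trans h1 dd | exact: le_lt_trans h2 dd]].
Qed.

Lemma coord_cont_within (f : R -> 'rV[R]_n -> 'rV[R]_m1 -> 'rV[R]_m2 -> 'rV[R]_n) i :
  {within @game_domain R n m1 m2 T U1 U2,
     continuous (fun p => f p.1.1.1 p.1.1.2 p.1.2 p.2)} ->
  cont_on_game T U1 U2 (fun s x u1 u2 => f s x u1 u2 0 i).
Proof.
move=> /subspace_continuousP cf; apply: cont_on_gameP.
apply/subspace_continuousP => p Dp.
have h := cf p Dp.
exact: (@cvg_comp _ _ _ _ (fun z : 'rV[R]_n => z 0 i) _ _ _ h
  (@coord_continuous R 1 n 0 i (f p.1.1.1 p.1.1.2 p.1.2 p.2))).
Qed.

End Continuity.

(** * Invariance of trajectories under null modifications of controls *)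

Section AlmostEverywhere.
Context {R : realType}.
Notation mu := (@lebesgue_measure R).

Lemma ae_mono (P Q : set R) : P `<=` Q ->
  (\forall s \ae mu, P s) -> \forall s \ae mu, Q s.
Proof. by move=> PQ; apply: (@filterS _ _ (ae_filter_ringOfSetsType mu)). Qed.

Lemma ae_mono2 (P Q S : set R) : (forall s, P s -> Q s -> S s) ->
  (\forall s \ae mu, P s) -> (\forall s \ae mu, Q s) -> \forall s \ae mu, S s.
Proof. by move=> PQS; apply: (@filterS2 _ _ (ae_filter_ringOfSetsType mu)). Qed.

End AlmostEverywhere.

Section Trajectories.
Context {R : realType} {n m1 m2 : nat}.
Notation mu := (@lebesgue_measure R).
Variables (T : R) (U1 : set 'rV[R]_m1) (U2 : set 'rV[R]_m2).
Variable f : R -> 'rV[R]_n -> 'rV[R]_m1 -> 'rV[R]_m2 -> 'rV[R]_n.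
Hypothesis cf : forall i, cont_on_game T U1 U2 (fun s x u1 u2 => f s x u1 u2 0 i).

Lemma is_trajectory_mvec t e x u1 u2 y : t <= e ->
  is_trajectory e f t x u1 u2 y -> mvec `[t, e]%classic y.
Proof.
move=> te h i; have [ip hy] := h i.
pose P := parameterized_integral mu t.
have mP : measurable_fun `[t, e]%classic
    (fun s => x 0 i + Int t s (fun r => f r (y r) (u1 r) (u2 r) 0 i)).
  apply: measurable_funD => //.
  apply: subspace_continuous_measurable_fun => //.
  exact: parameterized_integral_continuous.
by apply: eq_measurable_fun mP => s; rewrite inE => ste; rewrite -hy.
Qed.

Lemma is_trajectory_ae t e x u1 u2 u1' u2' y : 0 <= t -> t <= e -> e <= T ->
  control_on e U1 t u1 -> control_on e U1 t u1' ->
  control_on e U2 t u2 -> control_on e U2 t u2' ->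
  u1 = u1' %[ae mu in `[t, e]%classic] -> u2 = u2' %[ae mu in `[t, e]%classic] ->
  is_trajectory e f t x u1 u2 y -> is_trajectory e f t x u1' u2' y.
Proof.
move=> t0 te eT [mu1 hu1] [mu1' hu1'] [mu2 hu2] [mu2' hu2'] e1 e2 tr i.
have my := is_trajectory_mvec te tr.
have dom a s : a \in `[t, e] -> s \in `[t, a] -> s \in `[0, T] /\ s \in `[t, e].
  rewrite !in_itv/= => /andP[ta ae] /andP[ts sa].
  by rewrite ts (le_trans t0 ts) (le_trans sa ae) (le_trans sa (le_trans ae eT)).
have ete : e \in `[t, e] by rewrite in_itv/= te lexx.
have mfu v1 v2 : mvec `[t, e]%classic v1 -> mvec `[t, e]%classic v2 ->
    (forall s, s \in `[t, e] -> U1 (v1 s)) -> (forall s, s \in `[t, e] -> U2 (v2 s)) ->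
    measurable_fun `[t, e]%classic (fun s => f s (y s) (v1 s) (v2 s) 0 i).
  move=> mv1 mv2 hv1 hv2.
  apply: (measurable_superposition _ (cf i)) => // s ste.
  by split; [case: (dom _ _ ete ste)|exact: hv1|exact: hv2].
pose p s := f s (y s) (u1 s) (u2 s) 0 i.
pose q s := f s (y s) (u1' s) (u2' s) 0 i.
have mp : measurable_fun `[t, e]%classic p by exact: mfu.
have mq : measurable_fun `[t, e]%classic q by exact: mfu.
have pq : ae_eq mu `[t, e]%classic p q.
  apply: ae_mono2 e1 e2 => s h1 h2 ste.
  by rewrite /p /q h1 ?h2.
have [ip hy] := tr i; split.
  apply/integrableP; split; first exact/measurable_EFinP.
  have /integrableP[_] := ip; rewrite (@ae_eq_integral _ _ _ mu _ (fun s => `|(q s)%:E|)%E)//.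
  - by apply: measurableT_comp => //; exact/measurable_EFinP.
  - by apply: measurableT_comp => //; exact/measurable_EFinP.
  - by apply: ae_mono pq => s h /h pqs; congr (`|_%:E|%E).
move=> s ste; rewrite hy//; congr (_ + fine _).
have sub : `[t, s]%classic `<=` `[t, e]%classic.
  by move=> r /= rts; case: (dom s r ste rts).
apply: ae_eq_integral => //.
- by apply/measurable_EFinP; apply: measurable_funS mp.
- by apply/measurable_EFinP; apply: measurable_funS mq.
by apply: ae_mono pq => r h /sub/h pqr; congr (_%:E).
Qed.

(** The two sets of solutions coincide, so [xget] picks the same path in both; this gives equality
    of functions without appeal to uniqueness. *)
Lemma trajectory_ae t e x u1 u2 u1' u2' : 0 <= t -> t <= e -> e <= T ->
  control_on e U1 t u1 -> control_on e U1 t u1' ->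
  control_on e U2 t u2 -> control_on e U2 t u2' ->
  u1 = u1' %[ae mu in `[t, e]%classic] -> u2 = u2' %[ae mu in `[t, e]%classic] ->
  trajectory e f t x u1 u2 = trajectory e f t x u1' u2'.
Proof.
move=> t0 te eT c1 c1' c2 c2' e1 e2; congr xget; apply/seteqP; split => y.
  exact: is_trajectory_ae.
by apply: is_trajectory_ae => //; exact: ae_eq_sym.
Qed.

End Trajectories.

(** * Truncation to a cube *)

Section Clamp.
Context {R : realType} {n : nat}.

Lemma enorm_mono (x y : 'rV[R]_n) : (forall i, `|x 0 i| <= `|y 0 i|) -> enorm x <= enorm y.
Proof.
move=> xy; rewrite ler_sqrt ?edot_ge0//; apply: ler_sum => i _.
by rewrite -!expr2 -(real_normK (num_real (x 0 i))) -(real_normK (num_real (y 0 i))) lerXn2r ?nnegrE.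
Qed.

Lemma enorm_sqrD (x d : 'rV[R]_n) :
  enorm (x + d) ^+ 2 = enorm x ^+ 2 + 2 * edot x d + enorm d ^+ 2.
Proof. by rewrite !enorm_sqr edotDl !edotDr (edotC d x); ring. Qed.

(** Projection onto a cube rather than a ball: measurability, the Lipschitz constant 1 and the
    decrease of the Euclidean norm are all checked coordinate by coordinate. *)
Definition clamp (B : R) (x : 'rV[R]_n) : 'rV[R]_n :=
  \row_i Num.max (- B) (Num.min B (x 0 i)).

Lemma clamp_le (B : R) x : 0 <= B -> enorm (clamp B x) <= enorm x.
Proof.
move=> B0; apply: enorm_mono => i; rewrite mxE; move: (x 0 i) => a.
have h1 := ler_norm a; have := ler_norm (- a); rewrite normrN => h2.
by rewrite /Num.max /Num.min; case: (ltP B a) => ?; [case: (ltP (- B) B) => ?|case: (ltP (- B) a) => ?];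
  rewrite ler_norml; apply/andP; split; lra.
Qed.

Lemma clamp_lip (B : R) x y : enorm (clamp B x - clamp B y) <= enorm (x - y).
Proof.
apply: enorm_mono => i; rewrite !mxE; move: (x 0 i) (y 0 i) => a b.
have h1 := ler_norm (a - b); have := ler_norm (- (a - b)); rewrite normrN => h2.
by rewrite /Num.max /Num.min; case: (ltP B a) => ?; [case: (ltP (- B) B) => ?|case: (ltP (- B) a) => ?];
  (case: (ltP B b) => ?; [try case: (ltP (- B) B) => ?|case: (ltP (- B) b) => ?]);
  rewrite ler_norml; apply/andP; split; lra.
Qed.

Lemma clamp_bound (B : R) x : 0 <= B -> enorm (clamp B x) <= n%:R * B.
Proof.
move=> B0; apply: enorm_le_coord => i; rewrite mxE /Num.max /Num.min; move: (x 0 i) => a.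
by case: (ltP B a) => ?; [case: (ltP (- B) B) => ?|case: (ltP (- B) a) => ?];
  rewrite ler_norml; apply/andP; split; lra.
Qed.

Lemma clamp_id (B : R) x : enorm x <= B -> clamp B x = x.
Proof.
move=> xB; apply/rowP => i; rewrite mxE.
have := le_trans (coord_le_enorm x i) xB; rewrite ler_norml => /andP[h1 h2].
by rewrite (elimT min_idPr h2) (elimT max_idPr h1).
Qed.

Lemma mvec_clamp (D : set R) (B : R) (y : R -> 'rV[R]_n) :
  mvec D y -> mvec D (fun s => clamp B (y s)).
Proof.
move=> my i.
have : measurable_fun D (fun s => Num.max (- B) (Num.min B (y s 0 i))).
  by apply: measurable_maxr => //; exact: measurable_minr.
by apply: eq_measurable_fun => s _; rewrite mxE.
Qed.

End Clamp.

(** * Existence and uniqueness of trajectories for bounded controls *)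

Section BoundedControls.
Context {R : realType} {n m1 m2 : nat}.
Notation mul := (@lebesgue_measure R).

(** Pointwise counterpart of [control]: the bound holds everywhere on the interval. [control_rep]
    provides such a representative of every control. *)
Definition bctrl {m : nat} (U : set 'rV[R]_m) (t e M : R) (u : R -> 'rV[R]_m) : Prop :=
  mvec `[t, e]%classic u /\ forall r, r \in `[t, e] -> U (u r) /\ enorm (u r) <= M.

Lemma bctrl_sub {m : nat} (U : set 'rV[R]_m) (t e a b M : R) u : t <= a -> b <= e ->
  bctrl U t e M u -> bctrl U a b M u.
Proof.
move=> ta be [mu hu]; split; last by move=> r /(subset_itv_cc ta be)/hu.
by move=> i; apply: measurable_funS (mu i) => //; exact: subset_itv_cc.
Qed.

Lemma bctrl_control_on {m : nat} (U : set 'rV[R]_m) (t e M : R) u :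
  bctrl U t e M u -> control_on e U t u.
Proof. by move=> [mu hu]; split => // s /hu[]. Qed.

Lemma bctrl_powR {m : nat} (U : set 'rV[R]_m) (t e M r : R) u : 0 <= r ->
  bctrl U t e M u -> bmeas t e (fun s => enorm (u s) `^ r).
Proof.
move=> r0 [mu hu]; split; first exact: measurable_enorm_powR.
exists (M `^ r) => s /hu[_ uM]; rewrite ger0_norm ?powR_ge0//.
apply: ge0_ler_powR => //; rewrite nnegrE ?enorm_ge0//.
exact: le_trans (enorm_ge0 _) uM.
Qed.

Variables (T : R) (U1 : set 'rV[R]_m1) (U2 : set 'rV[R]_m2).
Variables (f : R -> 'rV[R]_n -> 'rV[R]_m1 -> 'rV[R]_m2 -> 'rV[R]_n)
  (g : R -> 'rV[R]_n -> 'rV[R]_m1 -> 'rV[R]_m2 -> R) (h : 'rV[R]_n -> R).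
Variables (L c rho1 rho2 sigma1 sigma2 mu mu0 mu1 mu2 : R).
Hypothesis hyp : standing_hyp T f g h U1 U2 L c rho1 rho2 sigma1 sigma2 mu mu0 mu1 mu2.

Let cf i := coord_cont_within i (f_continuous hyp).
Let cg := cont_on_gameP (g_continuous hyp).
Let L0 : 0 <= L := ltW (hyp_L hyp).

Definition field u1 u2 (y : R -> 'rV[R]_n) r := f r (y r) (u1 r) (u2 r).

Lemma field_bound t e M1 M2 u1 u2 r x : 0 <= t -> e <= T ->
  bctrl U1 t e M1 u1 -> bctrl U2 t e M2 u2 -> r \in `[t, e] ->
  enorm (f r x (u1 r) (u2 r)) <= L * (jap x + (M1 `^ sigma1 + M2 `^ sigma2)).
Proof.
move=> t0 eT [_ hu1] [_ hu2] rte.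
have [U1u u1M] := hu1 _ rte; have [U2u u2M] := hu2 _ rte.
have rT : r \in `[0, T] by apply: (subset_itv_cc t0 eT).
apply: (le_trans (f_growth hyp x rT U1u U2u)); rewrite ler_wpM2l// -addrA lerD2l.
apply: lerD; apply: ge0_ler_powR; rewrite ?nnegrE ?enorm_ge0//.
- exact: hyp_sigma1 hyp.
- exact: le_trans (enorm_ge0 _) u1M.
- exact: hyp_sigma2 hyp.
- exact: le_trans (enorm_ge0 _) u2M.
Qed.

Lemma mvec_field t e M1 M2 u1 u2 y : 0 <= t -> e <= T ->
  bctrl U1 t e M1 u1 -> bctrl U2 t e M2 u2 -> mvec `[t, e]%classic y ->
  mvec `[t, e]%classic (field u1 u2 y).
Proof.
move=> t0 eT [mu1' hu1] [mu2' hu2] my i.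
apply: (measurable_superposition _ (cf i)) => // r rte.
by split; [exact: (subset_itv_cc t0 eT)|case: (hu1 _ rte)|case: (hu2 _ rte)].
Qed.

Lemma vbmeas_field t e M1 M2 u1 u2 y : 0 <= t -> e <= T ->
  bctrl U1 t e M1 u1 -> bctrl U2 t e M2 u2 -> vbmeas t e y ->
  vbmeas t e (field u1 u2 y).
Proof.
move=> t0 eT b1 b2 by_ i; split.
  by apply: (mvec_field t0 eT b1 b2) => j; have [] := by_ j.
have [B B0 hB] := vbmeas_bound by_.
exists (L * (1 + B + (M1 `^ sigma1 + M2 `^ sigma2))) => r rte.
apply: (le_trans (coord_le_enorm _ _)); apply: (le_trans (field_bound _ t0 eT b1 b2 rte)).
rewrite ler_wpM2l// lerD2r (le_trans (jap_le _))// lerD2l; exact: hB.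
Qed.

Lemma is_trajectory_primitive t e x M1 M2 u1 u2 y : 0 <= t -> t <= e -> e <= T ->
  bctrl U1 t e M1 u1 -> bctrl U2 t e M2 u2 ->
  is_trajectory e f t x u1 u2 y <-> primitive t e x y (field u1 u2 y).
Proof.
move=> t0 te eT b1 b2; split => [tr|p i]; last first.
  by have [bv hy] := p i; split => //; exact: bmeas_integrable bv.
have by_ : vbmeas t e y.
  move=> i; split; first exact: (is_trajectory_mvec te tr).
  have [ip hy] := tr i.
  pose q r := f r (y r) (u1 r) (u2 r) 0 i.
  have iq : mul.-integrable `[t, e]%classic (EFin \o (fun r => `|q r|)).
    have -> : EFin \o (fun r => `|q r|) = (abse \o (fun r => (q r)%:E)).
      by [].
    exact: integrable_abse.
  exists (`|x 0 i| + Int t e (fun r => `|q r|)) => s ste.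
  have /andP[ts se] : t <= s <= e by move: ste; rewrite in_itv.
  rewrite hy// (le_trans (ler_normD _ _))// lerD2l.
  have iqs : mul.-integrable `[t, s]%classic (EFin \o q).
    by apply: integrableS ip => //; exact: subset_itv_cc.
  apply: (le_trans (le_normr_Rintegral _ iqs)) => //.
  rewrite (Int_split_integrable ts se iq) lerDl Int_ge0//.
by move=> i; split; [exact: (vbmeas_field t0 eT b1 b2)|case: (tr i)].
Qed.

(** The Lipschitz constant of [f] grows with the position like arbitrary powers of the bracket.
    Truncating the position at the a priori bound [B] makes the field bounded and globally
    Lipschitz; truncation does not increase the growth bound, so the solution found stays below [B]
    and never feels it. *)
Lemma primitive_exists t e x M1 M2 u1 u2 : 0 <= t -> t <= e -> e <= T ->
  bctrl U1 t e M1 u1 -> bctrl U2 t e M2 u2 ->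
  exists y, primitive t e x y (field u1 u2 y).
Proof.
move=> t0 te eT b1 b2; pose S := M1 `^ sigma1 + M2 `^ sigma2.
have S0 : 0 <= S by rewrite addr_ge0 ?powR_ge0.
pose B := expR (L * (e - t)) * (jap x + L * (S * (e - t))).
have B0 : 0 <= B.
  by rewrite mulr_ge0 ?expR_ge0// addr_ge0 ?jap_ge0// !mulr_ge0// subr_ge0.
pose J := 1 + n%:R * B.
have J1 : 1 <= J by rewrite lerDl mulr_ge0.
have clJ (z : 'rV[R]_n) : jap (clamp B z) <= J.
  by rewrite (le_trans (jap_le _))// lerD2l clamp_bound.
pose G r z := f r (clamp B z) (u1 r) (u2 r).
pose K := J `^ `|mu0| + J `^ `|mu1| * M1 `^ sigma1 + J `^ `|mu2| * M2 `^ sigma2.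
(* The exponents [mu0], [mu1], [mu2] may be negative, hence the absolute value, harmless because
   brackets are at least 1. *)
have jexp (z z' : 'rV[R]_n) m : japmax (clamp B z) (clamp B z') `^ m <= J `^ `|m|.
  apply: (@le_trans _ _ (japmax (clamp B z) (clamp B z') `^ `|m|)).
    by rewrite ler_powR ?ler_norm// japmax_ge1.
  apply: ge0_ler_powR; rewrite ?nnegrE ?normr_ge0//.
  - exact: le_trans (japmax_ge1 _ _).
  - exact: le_trans J1.
  - exact: japmax_le.
have [||r z rte|r z z' rte|y py] := @picard _ _ t e x G (L * (J + S)) K te.
- by rewrite !addr_ge0 ?mulr_ge0 ?powR_ge0.
- by move=> y my; exact: (mvec_field t0 eT b1 b2 (mvec_clamp B my)).
- apply: (le_trans (field_bound _ t0 eT b1 b2 rte)).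
  by rewrite ler_wpM2l// lerD2r.
- have [U1u u1M] := b1.2 _ rte; have [U2u u2M] := b2.2 _ rte.
  have rT : r \in `[0, T] by exact: (subset_itv_cc t0 eT).
  apply: (le_trans (f_lipschitz hyp _ _ rT U1u U2u)).
  apply: ler_pM; rewrite ?enorm_ge0 ?clamp_lip//.
    by rewrite !addr_ge0 ?mulr_ge0 ?powR_ge0.
  have p1 : enorm (u1 r) `^ sigma1 <= M1 `^ sigma1.
    apply: ge0_ler_powR; rewrite ?nnegrE ?enorm_ge0//; first exact: hyp_sigma1 hyp.
    exact: le_trans (enorm_ge0 _) u1M.
  have p2 : enorm (u2 r) `^ sigma2 <= M2 `^ sigma2.
    apply: ge0_ler_powR; rewrite ?nnegrE ?enorm_ge0//; first exact: hyp_sigma2 hyp.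
    exact: le_trans (enorm_ge0 _) u2M.
  by rewrite !lerD// ler_pM ?powR_ge0.
exists y => i; have [bv hy] := py i.
have yB r : r \in `[t, e] -> clamp B (y r) = y r.
  move=> rte; apply: clamp_id; apply: (le_trans (enorm_le_jap _)).
  have /andP[tr re] : t <= r <= e by move: rte; rewrite in_itv.
  have := jap_growth py L0 (bmeas_cst t e S) (fun _ _ => S0) _ rte.
  move=> /(_ _)/le_trans; apply.
    move=> s ste; apply: (le_trans (field_bound _ t0 eT b1 b2 ste)).
    rewrite ler_wpM2l// lerD2r ler_sqrt ?addr_ge0 ?sqr_ge0// lerD2l.
    by rewrite lerXn2r ?nnegrE ?enorm_ge0// clamp_le.
  rewrite Int_cst//; apply: ler_pM; rewrite ?expR_ge0//.
  - by rewrite addr_ge0 ?jap_ge0// !mulr_ge0// subr_ge0.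
  - by rewrite ler_expR ler_wpM2l// lerD2r.
  - by rewrite lerD2l ler_wpM2l// ler_wpM2l// lerD2r.
split; first by apply: bmeas_eq bv => r rte; rewrite /G yB.
move=> s ste; rewrite hy//; congr (_ + _); apply: eq_Int => r rts.
have /andP[ts se] : t <= s <= e by move: ste; rewrite in_itv.
by rewrite /G yB//; exact: (subset_itv_cc (lexx _) se).
Qed.

(** Gronwall for the squared distance, through the one-sided Lipschitz condition. That condition
    pairs the difference of fields with [w r], while the increment pairs it with [w a]; the exchange
    costs [O(b - a)] per unit of time and goes into the quadratic defect [N]. *)
Lemma primitive_unique t e x M1 M2 u1 u2 y y' : 0 <= t -> e <= T ->
  bctrl U1 t e M1 u1 -> bctrl U2 t e M2 u2 ->
  primitive t e x y (field u1 u2 y) -> primitive t e x y' (field u1 u2 y') ->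
  {in `[t, e], y =1 y'}.
Proof.
move=> t0 eT b1 b2 py py' s ste.
have /andP[ts se] : t <= s <= e by move: ste; rewrite in_itv.
have te := le_trans ts se.
have p := primitiveB py py'; set w := (fun s => y s - y' s) in p.
set v := (fun s => field u1 u2 y s - field u1 u2 y' s) in p.
have [B B0 hB] := vbmeas_bound (primitive_vbmeas p).
have [W W0 hW] := vbmeas_bound (primitive_path p).
pose N := 2 * (B * B + L * (2 * W * B + B * B * (e - t))) + B * B.
have := @gronwall_local _ t s (2 * L) N (fun=> 0) (fun r => enorm (w r) ^+ 2) ts.
rewrite mulr_ge0// subrr addr0 => /(_ isT (fun r => sqr_ge0 _) (fun _ _ _ _ _ => lexx _)).
rewrite (primitive_start p te) subrr enorm0 expr0n mulr0 => gr.
suff : enorm (w s) ^+ 2 <= 0.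
  move=> w0; apply/eqP; rewrite -subr_eq0; apply/eqP/enorm_eq0/eqP.
  by rewrite -sqrf_eq0 eq_le w0 sqr_ge0.
apply: gr => a b ta ab bs; have be := le_trans bs se.
rewrite addr0.
have ba0 : 0 <= b - a by rewrite subr_ge0.
have ate : a \in `[t, e] by rewrite in_itv/= ta (le_trans ab be).
have -> : enorm (w b) ^+ 2 = enorm (w a) ^+ 2 + 2 * edot (w a) (w b - w a)
    + enorm (w b - w a) ^+ 2.
  by rewrite -enorm_sqrD subrKC.
have hd : enorm (w b - w a) <= B * (b - a) by exact: primitive_lip p hB ta ab be.
have hd2 : enorm (w b - w a) ^+ 2 <= B * B * (b - a) ^+ 2.
  rewrite -expr2 -exprMn lerXn2r ?nnegrE ?enorm_ge0 ?mulr_ge0//.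
pose E := L * enorm (w a) ^+ 2 + (B * B + L * (2 * W * B + B * B * (e - t))) * (b - a).
have hI : edot (w a) (w b - w a) <= E * (b - a).
  rewrite (edot_primitive _ p ta ab be) -Int_cst//; apply: Int_le => [||r rab].
  - apply: vbmeas_edot; first exact: vbmeas_cst.
    exact: vbmeas_sub ta be (primitive_vbmeas p).
  - exact: bmeas_cst.
  have rte := subset_itv_cc ta be rab.
  have /andP[ar rb] : a <= r <= b by move: rab; rewrite in_itv.
  have [U1u u1M] := b1.2 _ rte; have [U2u u2M] := b2.2 _ rte.
  have rT : r \in `[0, T] by exact: (subset_itv_cc t0 eT).
  have mono := f_monotone hyp (y r) (y' r) rT U1u U2u.
  rewrite -/(field u1 u2 y r) -/(field u1 u2 y' r) -/(v r) -/(w r) edotC in mono.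
  have hra : enorm (w r - w a) <= B * (b - a).
    apply: (le_trans (primitive_lip p hB ta ar _)); first exact: le_trans be.
    by rewrite ler_wpM2l// lerD2r.
  have h1 : edot (w a) (v r) <= edot (w r) (v r) + B * (b - a) * B.
    have -> : edot (w a) (v r) = edot (w r) (v r) - edot (w r - w a) (v r).
      by rewrite edotBl; ring.
    rewrite lerD2l; have := edot_le_abs (w r - w a) (v r).
    rewrite ler_norml => /andP[hh _]; rewrite lerNl (le_trans _ hh)// lerN2.
    by rewrite ler_pM ?enorm_ge0// hB.
  have hw : enorm (w r) <= enorm (w a) + B * (b - a).
    rewrite -[w r](subrKC (w a)) (le_trans (enormD _ _))// lerD2l//.
  have hw2 : enorm (w r) ^+ 2 <= (enorm (w a) + B * (b - a)) ^+ 2.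
    by rewrite lerXn2r ?nnegrE ?addr_ge0 ?enorm_ge0// mulr_ge0.
  have hx : (enorm (w a) + B * (b - a)) ^+ 2 <=
      enorm (w a) ^+ 2 + (2 * W * B + B * B * (e - t)) * (b - a).
    have h3 : enorm (w a) * (B * (b - a)) <= W * (B * (b - a)).
      by rewrite ler_wpM2r ?mulr_ge0// hW.
    have h4 : (B * B) * (b - a) * (b - a) <= (B * B) * (b - a) * (e - t).
      by rewrite ler_wpM2l ?mulr_ge0//; lra.
    lra.
  have h5 := ler_wpM2l L0 (le_trans hw2 hx).
  rewrite /E; lra.
rewrite /N; rewrite /E in hI; lra.
Qed.

End BoundedControls.

(** * Coercivity estimates for trajectories and payoffs *)

Lemma small_factor (R : realType) (Q W e : R) : 0 <= Q -> 0 <= W -> 0 < e ->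
  exists dl, [/\ 0 < dl, dl <= 1, dl * Q <= 1 & dl * W <= e].
Proof.
move=> Q0 W0 e0; pose D := 1 + Q + W / e.
have We0 : 0 <= W / e by rewrite divr_ge0// ltW.
have D0 : 0 < D by rewrite /D; lra.
exists D^-1; rewrite invr_gt0; split => //.
- by rewrite invf_le1// /D; lra.
- by rewrite mulrC ler_pdivrMr// mul1r /D; lra.
- rewrite mulrC ler_pdivrMr// mulrC -ler_pdivrMr// /D; lra.
Qed.

(** [a] and [b] bound what the positions contribute to the running and the terminal payoff. Half of
    the coercive term absorbs the share of [E1 + E2] in them, which leaves the coefficient
    [c / 2]. *)
Lemma payoff_arith (R : realType) (c L G W Xm E1 E2 I H a b : R) :
  c * E1 - (a + L * E2) <= I -> I <= a + L * E1 - c * E2 -> - b <= H -> H <= b ->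
  a + b <= c / 2 * (E1 + E2 + G * Xm) ->
  0 <= L * Xm -> 0 <= c / 2 * Xm -> 0 <= c / 2 * (G * Xm) ->
  0 <= c / 2 * (G * E1) -> 0 <= c / 2 * (G * E2) -> 0 <= E1 -> 0 <= E2 -> 0 <= Xm ->
  c / 2 * E1 - (1 + L + c / 2 * (G + 1)) * (Xm + E2) <= I + H /\
  I + H <= (1 + L + c / 2 * (G + 1)) * (Xm + E1) - c / 2 * E2.
Proof. by move=> *; split; lra. Qed.

Section EnergyEstimates.
Context {R : realType} {n m1 m2 : nat}.
Variables (T : R) (U1 : set 'rV[R]_m1) (U2 : set 'rV[R]_m2).
Variables (f : R -> 'rV[R]_n -> 'rV[R]_m1 -> 'rV[R]_m2 -> 'rV[R]_n)
  (g : R -> 'rV[R]_n -> 'rV[R]_m1 -> 'rV[R]_m2 -> R) (h : 'rV[R]_n -> R).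
Variables (L c rho1 rho2 sigma1 sigma2 mu mu0 mu1 mu2 : R).
Hypothesis T0 : 0 <= T.
Hypothesis hyp : standing_hyp T f g h U1 U2 L c rho1 rho2 sigma1 sigma2 mu mu0 mu1 mu2.

Let L0 : 0 <= L := ltW (hyp_L hyp).
Let c0 : 0 <= c := ltW (hyp_c hyp).
Let r10 : 0 <= rho1 := ltW (hyp_rho1 hyp).
Let r20 : 0 <= rho2 := ltW (hyp_rho2 hyp).
Let s10 := hyp_sigma1 hyp.
Let s20 := hyp_sigma2 hyp.

(** The strict inequalities leave room above [mu]; [scales] divides by [nu - mu]. *)
Lemma exponent_gap : exists nu, [/\ mu < nu, sigma1 * nu <= rho1 & sigma2 * nu <= rho2].
Proof.
have gap (s r : R) : 0 <= s -> s * mu < r ->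
    exists2 e, 0 < e & forall d, d <= e -> s * (mu + d) <= r.
  move=> s0 sr; have s1 : 0 < s + 1 by lra.
  exists ((r - s * mu) / (s + 1)); first by rewrite divr_gt0// subr_gt0.
  move=> d; rewrite ler_pdivlMr// => hd.
  have [d0|d0] := leP d 0; last lra.
  have : s * d <= 0 by rewrite mulr_ge0_le0.
  lra.
have [e1 e10 h1] := gap _ _ s10 (sigma1_rho1 hyp).
have [e2 e20 h2] := gap _ _ s20 (sigma2_rho2 hyp).
exists (mu + Num.min e1 e2); split.
- by rewrite ltrDl lt_min e10.
- by apply: h1; rewrite ge_min lexx.
- by apply: h2; rewrite ge_min lexx orbT.
Qed.

Lemma h_bound x : `|h x| <= 2 * L * jap x `^ mu.
Proof.
have j1 := jap_ge1 x; have mu1' := hyp_mu hyp.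
have e : jap x `^ mu = jap x `^ (mu - 1) * jap x.
  rewrite mulrC mulr_powRB1 ?jap_ge0//; lra.
have jm1 : 1 <= jap x `^ (mu - 1).
  by rewrite -[leLHS](powRr0 (jap x)) ler_powR// subr_ge0.
have jm : 1 <= jap x `^ mu by rewrite e -[leLHS]mulr1 ler_pM.
have h1 : `|h x - h 0| <= L * jap x `^ mu.
  apply: (le_trans (h_lipschitz hyp x 0)); rewrite subr0 e -mulrA ler_wpM2l//.
  rewrite ler_pM ?powR_ge0 ?enorm_ge0 ?enorm_le_jap//.
  have -> // : japmax x 0 = jap x.
  apply: elimT max_idPl _; rewrite (le_trans _ j1)// /jap enorm0 expr0n addr0.
  by rewrite sqrtr1.
have h2 : L <= L * jap x `^ mu by rewrite -[leLHS]mulr1 ler_wpM2l.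
have := ler_normD (h x - h 0) (h 0); rewrite subrK.
have := h_zero hyp; lra.
Qed.

Lemma bmeas_running t e M1 M2 u1 u2 y : 0 <= t -> e <= T ->
  bctrl U1 t e M1 u1 -> bctrl U2 t e M2 u2 -> vbmeas t e y ->
  bmeas t e (fun s => g s (y s) (u1 s) (u2 s)).
Proof.
move=> t0 eT b1 b2 vy; split.
  apply: (measurable_superposition _ (cont_on_gameP (g_continuous hyp))) => //.
  - by move=> i; have [] := vy i.
  - by case: b1.
  - by case: b2.
  move=> r rte; split; first exact: (subset_itv_cc t0 eT).
    by case: (b1.2 _ rte).
  by case: (b2.2 _ rte).
have [B B0 hB] := vbmeas_bound vy.
have [_ [N1 hN1]] := bctrl_powR r10 b1; have [_ [N2 hN2]] := bctrl_powR r20 b2.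
exists (L * ((1 + B) `^ mu + N1 + N2)) => r rte.
have rT : r \in `[0, T] by exact: (subset_itv_cc t0 eT).
have [U1u _] := b1.2 _ rte; have [U2u _] := b2.2 _ rte.
have gl := g_lower hyp (y r) rT U1u U2u; have gu := g_upper hyp (y r) rT U1u U2u.
have := hN1 _ rte; have := hN2 _ rte.
have jB : jap (y r) `^ mu <= (1 + B) `^ mu.
  apply: ge0_ler_powR; rewrite ?nnegrE ?jap_ge0 ?addr_ge0//.
    exact: le_trans (hyp_mu hyp).
  by rewrite (le_trans (jap_le _))// lerD2l hB.
move: gl gu jB; move: (g _ _ _ _) (powR_ge0 (jap (y r)) mu).
move: (powR_ge0 (enorm (u1 r)) rho1) (powR_ge0 (enorm (u2 r)) rho2).
move: (enorm (u1 r) `^ rho1) (enorm (u2 r) `^ rho2) (jap (y r) `^ mu) ((1 + B) `^ mu).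
move=> p1 p2 j J p10 p20 gg j0 gl gu jJ.
rewrite (ger0_norm p10) (ger0_norm p20) => h2 h1.
have [cp1 cp2] : 0 <= c * p1 /\ 0 <= c * p2 by rewrite !mulr_ge0.
have k1 : L * (j + p2) <= L * (J + N1 + N2).
  by rewrite ler_wpM2l// -addrA lerD// (le_trans h2)// lerDr (le_trans p10).
have k2 : L * (j + p1) <= L * (J + N1 + N2).
  by rewrite ler_wpM2l// -addrA lerD// (le_trans h1)// lerDl (le_trans p20).
rewrite ler_norml; by apply/andP; split; lra.
Qed.

Section Scale.
Variables (nu X E K Z dl : R).
Hypotheses (dl0 : 0 <= dl) (K0 : 0 < K) (Z0 : 0 < Z) (KZ : K * Z = E) (XZ : X <= dl * Z).
Hypotheses (sn1 : sigma1 * nu <= rho1) (sn2 : sigma2 * nu <= rho2).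
Hypothesis sub : forall v s r : R, 0 <= v -> 0 <= s -> s * nu <= r ->
  K * v `^ s <= dl * (v `^ r + E).

(** Multiplied by [K], the integrals of [|u_i| ^ sigma_i] become by [sub] at most [dl] times an
    energy of order [E = K * Z]; dividing by [K] leaves a multiple of [dl * Z]. The choice of [dl]
    later makes the factor of [Z] at most 1. *)
Lemma traj_bound A t e x M1 M2 u1 u2 y : 0 <= t -> t <= e -> e <= T -> jap x <= X ->
  bctrl U1 t e M1 u1 -> bctrl U2 t e M2 u2 ->
  primitive t e x y (field f u1 u2 y) ->
  Int t e (fun s => enorm (u1 s) `^ rho1) + Int t e (fun s => enorm (u2 s) `^ rho2)
    <= A * E ->
  forall s, s \in `[t, e] ->
    jap (y s) <= expR (L * T) * (dl + L * dl * (A + 2 * T)) * Z.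
Proof.
move=> t0 te eT xX b1 b2 py hE s ste.
have [bs1 bs2] := (bctrl_powR s10 b1, bctrl_powR s20 b2).
have [br1 br2] := (bctrl_powR r10 b1, bctrl_powR r20 b2).
have E0 : 0 <= E by rewrite -KZ mulr_ge0// ltW.
pose k r := enorm (u1 r) `^ sigma1 + enorm (u2 r) `^ sigma2.
have bk : bmeas t e k by exact: bmeasD.
have k0 r : 0 <= k r by rewrite addr_ge0 ?powR_ge0.
have /andP[ts se] : t <= s <= e by move: ste; rewrite in_itv.
have hk : K * Int t e k <= K * (dl * (A + 2 * T) * Z).
  rewrite -IntZ//.
  apply: (@le_trans _ _ (Int t e (fun r => dl * (enorm (u1 r) `^ rho1 + enorm (u2 r) `^ rho2 + 2 * E)))).
    apply: Int_le => [||r _]; first exact: bmeasZ.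
      by apply: bmeasZ; apply: bmeasD; [exact: bmeasD|exact: bmeas_cst].
    have -> : dl * (enorm (u1 r) `^ rho1 + enorm (u2 r) `^ rho2 + 2 * E) =
      dl * (enorm (u1 r) `^ rho1 + E) + dl * (enorm (u2 r) `^ rho2 + E) by ring.
    by rewrite mulrDr lerD// sub// enorm_ge0.
  rewrite IntZ; last by apply: bmeasD; [exact: bmeasD|exact: bmeas_cst].
  rewrite IntD; [|exact: bmeasD|exact: bmeas_cst].
  rewrite IntD// Int_cst//.
  have -> : K * (dl * (A + 2 * T) * Z) = dl * (A * E + 2 * E * T) by rewrite -KZ; ring.
  have eTT : e - t <= T by rewrite (le_trans _ eT)// gerBl.
  by rewrite ler_wpM2l// lerD// ler_wpM2l// mulr_ge0.
rewrite ler_pM2l// in hk.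
have := jap_growth py L0 bk (fun r _ => k0 r) _ ste.
move=> /(_ _)/le_trans; apply.
  move=> r rte; rewrite /field /k addrA.
  have [U1u _] := b1.2 _ rte; have [U2u _] := b2.2 _ rte.
  by apply: (f_growth hyp) => //; exact: (subset_itv_cc t0 eT).
have hks : Int t s k <= Int t e k.
  by rewrite (Int_split ts se bk) lerDl Int_ge0.
have -> : expR (L * T) * (dl + L * dl * (A + 2 * T)) * Z =
  expR (L * T) * (dl * Z + L * (dl * (A + 2 * T) * Z)) by ring.
apply: ler_pM; first exact: expR_ge0.
- by rewrite addr_ge0 ?jap_ge0// mulr_ge0// Int_ge0.
- by rewrite ler_expR ler_wpM2l// (le_trans _ eT)// (le_trans _ se)// gerBl.
- by rewrite lerD ?(le_trans xX)// ler_wpM2l// (le_trans hks).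
Qed.

End Scale.

Lemma payoff_bounds : exists2 C, 1 <= C &
  forall t x M1 M2 u1 u2 y P E1 E2, t \in `[0, T] ->
  bctrl U1 t T M1 u1 -> bctrl U2 t T M2 u2 ->
  primitive t T x y (field f u1 u2 y) ->
  P = Int t T (fun s => g s (y s) (u1 s) (u2 s)) + h (y T) ->
  E1 = Int t T (fun s => enorm (u1 s) `^ rho1) ->
  E2 = Int t T (fun s => enorm (u2 s) `^ rho2) ->
  c / 2 * E1 - C * (jap x `^ mu + E2) <= P /\ P <= C * (jap x `^ mu + E1) - c / 2 * E2.
Proof.
have mu1' := hyp_mu hyp.
pose Q := expR (L * T) * (1 + L * (1 + 2 * T)).
pose W := L * T + 2 * L.
have LT0 : 0 <= L * T by exact: mulr_ge0.
have Q0 : 0 <= Q.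
  by rewrite mulr_ge0 ?expR_ge0// addr_ge0// mulr_ge0// addr_ge0// mulr_ge0.
have W0 : 0 <= W by rewrite addr_ge0// mulr_ge0.
have c20 : 0 < c / 2 by rewrite divr_gt0// (hyp_c hyp).
(* [dl * Q <= 1] keeps the path within [Z]; [dl * W <= c / 2] keeps the payoff due to positions
   under half of the coercive term. *)
have [dl [dl0 dl1 dlQ dlW]] := small_factor Q0 W0 c20.
have [nu [munu sn1 sn2]] := exponent_gap.
have [G G1 hG] := scales mu1' munu dl0 dl1 (lexx 1).
have G0 : 0 <= G by exact: le_trans G1.
have dlQ' : expR (L * T) * (dl + L * dl * (1 + 2 * T)) <= 1 by move: dlQ; rewrite /Q; lra.
exists (1 + L + c / 2 * (G + 1)).
  by have := mulr_ge0 (ltW c20) G0; have := L0; lra.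
move=> t x M1 M2 u1 u2 y P E1 E2 t0T b1 b2 py hP hE1 hE2.
have /andP[t0 tT] : 0 <= t <= T := t0T.
have [br1 br2] := (bctrl_powR r10 b1, bctrl_powR r20 b2).
have E10 : 0 <= E1 by rewrite hE1; apply: Int_ge0 => s _; exact: powR_ge0.
have E20 : 0 <= E2 by rewrite hE2; apply: Int_ge0 => s _; exact: powR_ge0.
pose Xm := jap x `^ mu.
have Xm0 : 0 <= Xm by exact: powR_ge0.
(* The scale is taken after the controls, from their own energies, so the estimate holds for
   controls of any energy. *)
pose E := E1 + E2 + G * Xm.
have GE : G * jap x `^ mu <= E by rewrite /E lerDr addr_ge0.
have [K [Z [[K0 Z0 KZ Zmu _] [XZ _ hsub]]]] := hG (jap x) E (jap_ge1 x) GE.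
have E0 : 0 <= E by rewrite !addr_ge0// mulr_ge0.
have jm s : s \in `[t, T] -> jap (y s) `^ mu <= dl * E.
  move=> stT; apply: le_trans Zmu.
  apply: ge0_ler_powR; rewrite ?nnegrE ?jap_ge0//; [exact: le_trans mu1'|exact: ltW|].
  have hE : E1 + E2 <= 1 * E by rewrite mul1r /E lerDl mulr_ge0.
  rewrite hE1 hE2 in hE.
  have := traj_bound (ltW dl0) K0 Z0 KZ XZ sn1 sn2 hsub t0 tT (lexx T) (lexx _) b1 b2 py hE stT.
  move=> /le_trans; apply.
  by rewrite -[leRHS]mul1r ler_wpM2r ?(ltW Z0).
have bg := bmeas_running t0 (lexx T) b1 b2 (primitive_path py).
have tTT : t \in `[t, T] by rewrite in_itv/= lexx.
have TtT : T \in `[t, T] by rewrite in_itv/= lexx tT.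
have hh : `|h (y T)| <= 2 * L * (dl * E).
  by apply: (le_trans (h_bound _)); rewrite ler_wpM2l ?mulr_ge0// jm.
have TtT' : L * (dl * E) * (T - t) <= L * (dl * E) * T.
  by rewrite ler_wpM2l ?gerBl// !mulr_ge0// ltW.
have hW : dl * W * E <= c / 2 * E by rewrite ler_wpM2r.
move: hh; rewrite ler_norml => /andP[hh1 hh2].
have lo : c * E1 - (L * (dl * E) * (T - t) + L * E2) <=
    Int t T (fun s => g s (y s) (u1 s) (u2 s)).
  rewrite hE1 hE2 -IntZ// -Int_cst// -IntZ// -IntD; [|exact: bmeas_cst|exact: bmeasZ].
  rewrite -IntB; [|exact: bmeasZ|by apply: bmeasD; [exact: bmeas_cst|exact: bmeasZ]].
  apply: Int_le => [||s stT]; [|exact: bg|].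
    by apply: bmeasB; [exact: bmeasZ|apply: bmeasD; [exact: bmeas_cst|exact: bmeasZ]].
  have [U1u _] := b1.2 _ stT; have [U2u _] := b2.2 _ stT.
  have sT : s \in `[0, T] by exact: (subset_itv_cc t0 (lexx T)).
  apply: le_trans (g_lower hyp (y s) sT U1u U2u).
  by rewrite lerD2l lerN2 mulrDr lerD2r ler_wpM2l// jm.
have hi : Int t T (fun s => g s (y s) (u1 s) (u2 s)) <=
    (L * (dl * E) * (T - t) + L * E1) - c * E2.
  rewrite hE1 hE2 -[X in _ - X]IntZ// -Int_cst// -IntZ// -IntD; [|exact: bmeas_cst|exact: bmeasZ].
  rewrite -IntB; [|by apply: bmeasD; [exact: bmeas_cst|exact: bmeasZ]|exact: bmeasZ].
  apply: Int_le => [||s stT]; [exact: bg| |].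
    by apply: bmeasB; [apply: bmeasD; [exact: bmeas_cst|exact: bmeasZ]|exact: bmeasZ].
  have [U1u _] := b1.2 _ stT; have [U2u _] := b2.2 _ stT.
  have sT : s \in `[0, T] by exact: (subset_itv_cc t0 (lexx T)).
  apply: (le_trans (g_upper hyp (y s) sT U1u U2u)).
  by rewrite lerD2r mulrDr lerD2r ler_wpM2l// jm.
have hWE : L * (dl * E) * (T - t) + 2 * L * (dl * E) <= c / 2 * (E1 + E2 + G * Xm).
  apply: le_trans hW; apply: (le_trans (lerD TtT' (lexx _))).
  by rewrite /W le_eqVlt; apply/orP; left; apply/eqP; ring.
have LX : 0 <= L * Xm by exact: mulr_ge0.
have cX : 0 <= c / 2 * Xm by rewrite mulr_ge0// ltW.
have GX : 0 <= c / 2 * (G * Xm) by rewrite !mulr_ge0// ltW.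
have GE1 : 0 <= c / 2 * (G * E1) by rewrite !mulr_ge0// ltW.
have GE2 : 0 <= c / 2 * (G * E2) by rewrite !mulr_ge0// ltW.
rewrite hP; exact: payoff_arith lo hi hh1 hh2 hWE LX cX GX GE1 GE2 E10 E20 Xm0.
Qed.

End EnergyEstimates.

(** * Uniform continuity near bounded sets *)

Section UniformContinuity.
Context {R : realType} {n m1 m2 : nat}.
Variables (T : R) (U1 : set 'rV[R]_m1) (U2 : set 'rV[R]_m2).
Hypotheses (cU1 : closed U1) (cU2 : closed U2).

Lemma enorm_nbhs {m : nat} (x : 'rV[R]_m) (d : R) : 0 < d ->
  \forall y \near x, enorm (x - y) <= d.
Proof.
move=> d0; have N0 : 0 < m%:R + 1 :> R by rewrite ltr_wpDl.
have e0 : 0 < d / (m%:R + 1) by rewrite divr_gt0.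
apply: filterS (nbhsx_ballx x _ e0) => y [_ xy].
apply: (@le_trans _ _ (m%:R * (d / (m%:R + 1)))).
  by apply: enorm_le_coord => i; rewrite !mxE; exact/ltW/(xy 0 i).
rewrite mulrCA ler_piMr//; first exact: ltW.
by rewrite ler_pdivrMr// mul1r lerDl.
Qed.

Lemma box_compact {m : nat} (B : R) : compact [set v : 'rV[R]_m | forall i, `|v 0 i| <= B].
Proof.
have := @rV_compact R m (fun=> `[- B, B]%classic) (fun=> segment_compact (a := - B) (b := B)).
congr compact; apply/seteqP; split => v /= vB i.
  by have := vB i; rewrite in_itv/= ler_norml.
by rewrite in_itv/= -ler_norml vB.
Qed.

(** Only the first point is confined to a box, compact because [U1] and [U2] are closed; the second
    one is near it. Near-covering compactness is applied with the radius itself as the parameter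
    tending to 0. *)
Lemma uniformly_cont (F : R -> 'rV[R]_n -> 'rV[R]_m1 -> 'rV[R]_m2 -> R) (B e : R) :
  cont_on_game T U1 U2 F -> 0 < e ->
  exists2 d, 0 < d & forall s x u1 u2 s' x' u1' u2',
    s \in `[0, T] -> U1 u1 -> U2 u2 -> enorm x <= B -> enorm u1 <= B -> enorm u2 <= B ->
    s' \in `[0, T] -> U1 u1' -> U2 u2' ->
    `|s - s'| <= d -> enorm (x - x') <= d -> enorm (u1 - u1') <= d ->
    enorm (u2 - u2') <= d -> `|F s x u1 u2 - F s' x' u1' u2'| < e.
Proof.
move=> cF e0.
pose C : set (R * 'rV[R]_n * 'rV[R]_m1 * 'rV[R]_m2)%type :=
  `[0, T]%classic `*` [set v : 'rV[R]_n | forall i, `|v 0 i| <= B]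
   `*` ([set v : 'rV[R]_m1 | forall i, `|v 0 i| <= B] `&` U1)
   `*` ([set v : 'rV[R]_m2 | forall i, `|v 0 i| <= B] `&` U2).
have cC : compact C.
  apply: compact_setX; last by apply: compact_closedI => //; exact: box_compact.
  apply: compact_setX; last by apply: compact_closedI => //; exact: box_compact.
  by apply: compact_setX; [exact: segment_compact|exact: box_compact].
pose P (d : R) (p : R * 'rV[R]_n * 'rV[R]_m1 * 'rV[R]_m2) := forall s' x' u1' u2',
  s' \in `[0, T] -> U1 u1' -> U2 u2' ->
  `|p.1.1.1 - s'| <= d -> enorm (p.1.1.2 - x') <= d -> enorm (p.1.2 - u1') <= d ->
  enorm (p.2 - u2') <= d -> `|F p.1.1.1 p.1.1.2 p.1.2 p.2 - F s' x' u1' u2'| < e.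
have /near_covering_withinP/(_ R (0^'+) P _) := (compact_near_coveringP C).1 cC.
have e20 : 0 < e / 2 by rewrite divr_gt0.
case.
  move=> [[[s x] u1] u2] [[[/= sT _] [_ U1u]] [_ U2u]].
  have [d d0 hd] := cF s x u1 u2 sT U1u U2u (e / 2) e20.
  have d20 : 0 < d / 2 by rewrite divr_gt0.
  have dd : d / 2 <= d by lra.
  exists ([set p | `|s - p.1.1.1| <= d / 2 /\ enorm (x - p.1.1.2) <= d / 2 /\
     enorm (u1 - p.1.2) <= d / 2 /\ enorm (u2 - p.2) <= d / 2],
     [set d' | d' <= d / 2]).
    split => /=; last exact: nbhs_right_le.
    exists ([set p | `|s - p.1.1| <= d / 2 /\ enorm (x - p.1.2) <= d / 2 /\
       enorm (u1 - p.2) <= d / 2], [set v | enorm (u2 - v) <= d / 2]).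
      split => /=; last exact: enorm_nbhs.
      exists ([set p | `|s - p.1| <= d / 2 /\ enorm (x - p.2) <= d / 2],
         [set v | enorm (u1 - v) <= d / 2]).
        split => /=; last exact: enorm_nbhs.
        exists ([set v | `|s - v| <= d / 2], [set v | enorm (x - v) <= d / 2]).
          split => /=; last exact: enorm_nbhs.
          apply: filterS (nbhsx_ballx s _ d20) => v; exact: ltW.
        by move=> [a b] [].
      by move=> [[a b] a'] [[]].
    by move=> [[[a b] a'] b'] [[? []]].
  move=> [[[[s1 x1] v1] v2] d'] [/= [hs [hx [h1 h2]]] dd'] [[[/= s1T _] [_ U1v]] [_ U2v]].
  move=> s' x' u1' u2' s'T U1u' U2u' /= hs' hx' h1' h2'.
  have tri : `|s - s'| <= d.
    have := ler_normD (s - s1) (s1 - s'); rewrite subrKA; lra.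
  have trix : enorm (x - x') <= d by have := enorm_dist_tri x1 x x'; lra.
  have tri1 : enorm (u1 - u1') <= d by have := enorm_dist_tri v1 u1 u1'; lra.
  have tri2 : enorm (u2 - u2') <= d by have := enorm_dist_tri v2 u2 u2'; lra.
  have a1 := hd s' x' u1' u2' s'T U1u' U2u' tri trix tri1 tri2.
  have a2 : `|F s x u1 u2 - F s1 x1 v1 v2| < e / 2 by apply: hd => //; exact: le_trans dd.
  have := ler_normD (F s1 x1 v1 v2 - F s x u1 u2) (F s x u1 u2 - F s' x' u1' u2').
  rewrite subrKA (distrC (F s1 x1 v1 v2) (F s x u1 u2)); lra.
move=> d /= d0 hd; exists (d / 2); first by rewrite divr_gt0.
have d20 : 0 < d / 2 by rewrite divr_gt0.
move=> s x u1 u2 s' x' u1' u2' sT U1u U2u xB u1B u2B; apply: (hd (d / 2) _ _ (s, x, u1, u2)) => //.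
  rewrite /ball/= sub0r normrN gtr0_norm//; lra.
by split; [split; [split|]|] => //=; (try split) => // i; exact: le_trans (coord_le_enorm _ _) _.
Qed.

End UniformContinuity.

(** * The Hamiltonian and its near-saddles *)

Lemma ham_arith_le (R : realFieldType) (G q j p1 p2 L c dl E : R) :
  G <= L * (j + p1) - c * p2 -> - (L * E + L * dl * (p1 + E) + L * dl * (p2 + E)) <= q ->
  L * j <= L * (dl * E) -> L * dl * p2 <= c / 2 * p2 -> L * dl * p1 <= L * p1 ->
  L * dl * E <= L * E ->
  G - q <= 4 * L * E + 2 * L * p1 - c / 2 * p2.
Proof. lra. Qed.

Lemma ham_arith_ge (R : realFieldType) (G q j p1 p2 L c dl E : R) :
  c * p1 - L * (j + p2) <= G -> q <= L * E + L * dl * (p1 + E) + L * dl * (p2 + E) ->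
  L * j <= L * (dl * E) -> L * dl * p1 <= c / 2 * p1 -> L * dl * p2 <= L * p2 ->
  L * dl * E <= L * E ->
  c / 2 * p1 - 4 * L * E - 2 * L * p2 <= G - q.
Proof. lra. Qed.

Section Hamiltonian.
Context {R : realType} {n m1 m2 : nat}.
Variables (T : R) (U1 : set 'rV[R]_m1) (U2 : set 'rV[R]_m2).
Variables (f : R -> 'rV[R]_n -> 'rV[R]_m1 -> 'rV[R]_m2 -> 'rV[R]_n)
  (g : R -> 'rV[R]_n -> 'rV[R]_m1 -> 'rV[R]_m2 -> R) (h : 'rV[R]_n -> R).
Variables (L c rho1 rho2 sigma1 sigma2 mu mu0 mu1 mu2 : R).
Hypothesis hyp : standing_hyp T f g h U1 U2 L c rho1 rho2 sigma1 sigma2 mu mu0 mu1 mu2.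

Definition ham s z q u1 u2 : R := g s z u1 u2 - edot q (f s z u1 u2).

Variables (nu E K Z dl : R).
Hypotheses (dl1 : dl <= 1) (Ldl : L * dl <= c / 2).
Hypotheses (K0 : 0 < K) (Z0 : 0 < Z) (KZ : K * Z = E) (Zmu : Z `^ mu <= dl * E).
Hypotheses (sn1 : sigma1 * nu <= rho1) (sn2 : sigma2 * nu <= rho2).
Hypothesis sub : forall v s r : R, 0 <= v -> 0 <= s -> s * nu <= r ->
  K * v `^ s <= dl * (v `^ r + E).

Lemma E_gt0 : 0 < E.
Proof. by rewrite -KZ mulr_gt0. Qed.

Lemma jap_powR_le (z : 'rV[R]_n) : jap z <= Z -> jap z `^ mu <= dl * E.
Proof.
move=> zZ; apply: le_trans Zmu; apply: ge0_ler_powR; rewrite ?nnegrE ?jap_ge0//.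
  exact: le_trans (hyp_mu hyp).
exact: ltW.
Qed.

(** [K * Z = E] accounts for the position and [sub] for each control: against gradients up to [K]
    the drift weighs no more than a small part of the energies plus a multiple of [E]. *)
Lemma grad_field_le s z q u1 u2 : s \in `[0, T] -> U1 u1 -> U2 u2 ->
  jap z <= Z -> enorm q <= K ->
  `|edot q (f s z u1 u2)| <=
    L * E + L * dl * (enorm u1 `^ rho1 + E) + L * dl * (enorm u2 `^ rho2 + E).
Proof.
move=> sT U1u U2u zZ qK; have L0 := ltW (hyp_L hyp).
apply: (le_trans (edot_le_abs _ _)).
apply: (@le_trans _ _ (K * (L * (Z + enorm u1 `^ sigma1 + enorm u2 `^ sigma2)))).
  rewrite ler_pM ?enorm_ge0//; apply: (le_trans (f_growth hyp z sT U1u U2u)).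
  by rewrite ler_wpM2l// !lerD.
have -> : K * (L * (Z + enorm u1 `^ sigma1 + enorm u2 `^ sigma2)) =
  L * E + L * (K * enorm u1 `^ sigma1) + L * (K * enorm u2 `^ sigma2).
  by rewrite -KZ; ring.
rewrite -!mulrA !lerD// ler_wpM2l//; apply: sub => //; rewrite ?enorm_ge0//.
  exact: hyp_sigma1 hyp.
exact: hyp_sigma2 hyp.
Qed.

Lemma ham_le s z q u1 u2 : s \in `[0, T] -> U1 u1 -> U2 u2 ->
  jap z <= Z -> enorm q <= K ->
  ham s z q u1 u2 <= 4 * L * E + 2 * L * enorm u1 `^ rho1 - c / 2 * enorm u2 `^ rho2.
Proof.
move=> sT U1u U2u zZ qK; have L0 := ltW (hyp_L hyp).
have := grad_field_le sT U1u U2u zZ qK; rewrite ler_norml => /andP[h1 _].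
have h2 := g_upper hyp z sT U1u U2u.
have h3 := ler_wpM2l L0 (jap_powR_le zZ).
have p1 := powR_ge0 (enorm u1) rho1; have p2 := powR_ge0 (enorm u2) rho2.
have e0 := ltW E_gt0.
have k1 : L * dl * enorm u2 `^ rho2 <= c / 2 * enorm u2 `^ rho2 by rewrite ler_wpM2r.
have k2 : L * dl * enorm u1 `^ rho1 <= L * enorm u1 `^ rho1.
  by rewrite ler_wpM2r// ler_piMr.
have k3 : L * dl * E <= L * E by rewrite ler_wpM2r// ler_piMr.
exact: ham_arith_le h2 h1 h3 k1 k2 k3.
Qed.

Lemma ham_ge s z q u1 u2 : s \in `[0, T] -> U1 u1 -> U2 u2 ->
  jap z <= Z -> enorm q <= K ->
  c / 2 * enorm u1 `^ rho1 - 4 * L * E - 2 * L * enorm u2 `^ rho2 <= ham s z q u1 u2.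
Proof.
move=> sT U1u U2u zZ qK; have L0 := ltW (hyp_L hyp).
have := grad_field_le sT U1u U2u zZ qK; rewrite ler_norml => /andP[_ h1].
have h2 := g_lower hyp z sT U1u U2u.
have h3 := ler_wpM2l L0 (jap_powR_le zZ).
have p1 := powR_ge0 (enorm u1) rho1; have p2 := powR_ge0 (enorm u2) rho2.
have e0 := ltW E_gt0.
have k1 : L * dl * enorm u1 `^ rho1 <= c / 2 * enorm u1 `^ rho1 by rewrite ler_wpM2r.
have k2 : L * dl * enorm u2 `^ rho2 <= L * enorm u2 `^ rho2.
  by rewrite ler_wpM2r// ler_piMr.
have k3 : L * dl * E <= L * E by rewrite ler_wpM2r// ler_piMr.
exact: ham_arith_ge h2 h1 h3 k1 k2 k3.
Qed.

(** Level above which a control of Player 1 may be answered by 0: by [beta1E], [ham_ge] then gives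
    at least [8 L E - 4 L E = 4 L E], the upper bound of the saddle value. *)
Definition beta1 : R := 16 * L / c * E.
(** Level above which Player 2 gains nothing against [|u1| ^ rho1 <= beta1]: by [beta2E], [ham_le]
    then gives at most [- 5 L E], which is below the saddle value, at least [- 4 L E], less the
    tolerance [e <= L * E]. *)
Definition beta2 : R := 2 / c * (9 * L * E + 2 * L * beta1).

Lemma beta1_ge0 : 0 <= beta1.
Proof.
have := hyp_L hyp; have := hyp_c hyp; have := E_gt0 => e0 c0 L0.
by rewrite /beta1 !mulr_ge0 ?invr_ge0// ltW.
Qed.

Lemma beta2_ge0 : 0 <= beta2.
Proof.
have [[e0 c0] L0] := (ltW E_gt0, ltW (hyp_c hyp), ltW (hyp_L hyp)).
rewrite /beta2; apply: mulr_ge0; first by rewrite divr_ge0.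
by rewrite addr_ge0// mulr_ge0// ?beta1_ge0// mulr_ge0.
Qed.

Lemma beta1E : c / 2 * beta1 = 8 * L * E.
Proof. by rewrite /beta1; field; rewrite gt_eqF// (hyp_c hyp). Qed.

Lemma beta2E : c / 2 * beta2 = 9 * L * E + 2 * L * beta1.
Proof. by rewrite /beta2; field; rewrite gt_eqF// (hyp_c hyp). Qed.

(* A near-saddle of the Hamiltonian: [ub] for the minimizer, [phi] for the
   maximizer who sees [u1].  [phi] depends only on the cell of [u1] and on
   whether [u1] is large, which makes it measurable. *)
Lemma near_saddle s z q e eta : 0 < e -> e <= L * E -> 0 < eta ->
  exists r : 'rV[R]_m1 * ('rV[R]_m1 -> 'rV[R]_m2) * R,
  let ub := r.1.1 in let phi := r.1.2 in let H := r.2 in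
  [/\ U1 ub, enorm ub `^ rho1 <= beta1,
      forall u, U2 (phi u) /\ enorm (phi u) `^ rho2 <= beta2 &
      forall D u, measurable D -> mvec D u -> mvec D (phi \o u)] /\
  (s \in `[0, T] -> jap z <= Z -> enorm q <= K ->
    [/\ forall w, U2 w -> ham s z q ub w <= H + e,
      forall u, U1 u -> enorm u `^ rho1 <= beta1 -> exists v,
        [/\ U1 v, enorm v `^ rho1 <= beta1, enorm (u - v) <= m1%:R * eta
          & H - e <= ham s z q v (phi u)],
      forall u, ~~ (enorm u `^ rho1 <= beta1) -> phi u = 0 &
      - (4 * L * E) <= H <= 4 * L * E]).
Proof.
move=> e0 eLE eta0.
have U10 := U1_zero hyp; have U20 := U2_zero hyp.
have z1 : enorm (0 : 'rV[R]_m1) `^ rho1 = 0.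
  by rewrite enorm0 powR0// gt_eqF// (hyp_rho1 hyp).
have z2 : enorm (0 : 'rV[R]_m2) `^ rho2 = 0.
  by rewrite enorm0 powR0// gt_eqF// (hyp_rho2 hyp).
have b10 := beta1_ge0; have b20 := beta2_ge0.
(* Outside the relevant region the choice is zero: the selection must exist, bounded and measurable
   in [u], for every [(s, z, q)], because it is later turned into functions by choice. *)
have [cond|ncond] := boolP ((s \in `[0, T]) && (jap z <= Z) && (enorm q <= K)); last first.
  exists (0, fun=> 0, 0); split => /=; last first.
    by move=> sT zZ qK; move: ncond; rewrite sT zZ qK.
  split => //; first by rewrite z1.
    by rewrite z2.
  by move=> D u mD mu_ i; exact: measurable_cst.
have /andP[/andP[sT zZ] qK] := cond.
pose psi := ham s z q.
have psi_le u w : U1 u -> U2 w -> psi u w <= 4 * L * E + 2 * L * enorm u `^ rho1 - c / 2 * enorm w `^ rho2.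
  by move=> U1u U2w; exact: ham_le.
have psi_ge u w : U1 u -> U2 w -> c / 2 * enorm u `^ rho1 - 4 * L * E - 2 * L * enorm w `^ rho2 <= psi u w.
  by move=> U1u U2w; exact: ham_ge.
have c20 : 0 <= c / 2 by rewrite divr_ge0// (ltW (hyp_c hyp)).
have L0 := ltW (hyp_L hyp).
pose S u := [set psi u w | w in U2].
have Sne u : S u !=set0 by exists (psi u 0), 0.
have Sub u : U1 u -> ubound (S u) (4 * L * E + 2 * L * enorm u `^ rho1).
  move=> U1u _ [w U2w <-]; apply: (le_trans (psi_le _ _ U1u U2w)).
  by rewrite gerBl mulr_ge0// powR_ge0.
have Ssup u : U1 u -> has_sup (S u).
  by move=> U1u; split => //; eexists; exact: Sub.
pose m u := sup (S u).
pose I := [set m u | u in [set u | U1 u /\ enorm u `^ rho1 <= beta1]].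
have mlo u : U1 u -> - (4 * L * E) <= m u.
  move=> U1u; apply: (@le_trans _ _ (psi u 0)).
    have := psi_ge u 0 U1u U20; rewrite z2 mulr0 subr0.
    by have : 0 <= c / 2 * enorm u `^ rho1 by [rewrite mulr_ge0// powR_ge0]; lra.
  by apply: ub_le_sup; [case: (Ssup _ U1u)|exists 0].
have I0 : I (m 0) by exists 0 => //; split => //; rewrite z1.
have Iinf : has_inf I.
  split; first by exists (m 0).
  by exists (- (4 * L * E)) => _ [u [U1u _] <-]; exact: mlo.
(* The upper value, infimum over [u1] of suprema over [u2], matches the information available: [ub]
   is chosen blindly, whereas [phi] sees [u1] and can reach [H - e] against each admissible [u1]
   separately. *)
pose H := inf I.
have Hlo : - (4 * L * E) <= H.
  by apply: lb_le_inf; [case: Iinf|move=> _ [u [U1u _] <-]; exact: mlo].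
have Hhi : H <= 4 * L * E.
  apply: (@le_trans _ _ (m 0)); first by apply: ge_inf => //; case: Iinf.
  by apply: ge_sup => // r /(Sub _ U10); rewrite z1 mulr0 addr0.
have [_ [ub [U1ub ubb] <-] mub] := inf_adherent e0 Iinf.
(* The answer is computed against a representative of the cell of [u], again admissible and of
   energy at most [beta1]. This is why the conclusion speaks of some [v] near [u]. *)
pose rep (j : 'rV[int]_m1) : 'rV[R]_m1 :=
  xget 0 [set v | [/\ U1 v, enorm v `^ rho1 <= beta1 & cell eta v = j]].
pose ans (v : 'rV[R]_m1) : 'rV[R]_m2 :=
  xget 0 [set w | [/\ U2 w, H - e <= psi v w & enorm w `^ rho2 <= beta2]].
pose Psi (p : 'rV[int]_m1 * bool) := if p.2 then ans (rep p.1) else 0.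
pose phi u := Psi (cell eta u, enorm u `^ rho1 <= beta1).
exists (ub, phi, H); split => /=; split => //.
- move=> u; rewrite /phi /Psi /=; case: ifP => _; last by rewrite z2.
  rewrite /ans; case: xgetP => [w _ []//|_]; by rewrite z2.
- move=> D u mD mu_ i.
  apply: (@cmeas_measurable _ _ _ (fun s => (cell eta (u s), enorm (u s) `^ rho1 <= beta1))
    (fun p => Psi p 0 i)).
  apply: cmeas_pair; first exact: cmeas_cell.
  apply: cmeas_bool => //; apply: measurable_fun_ler; last exact: measurable_cst.
  exact: measurable_enorm_powR.
- move=> w U2w; apply: (@le_trans _ _ (m ub)); last exact: ltW.
  by apply: ub_le_sup; [case: (Ssup _ U1ub)|exists w].
- move=> u U1u ub1.
  have [U1r rb rc] : [set v | [/\ U1 v, enorm v `^ rho1 <= beta1 & cell eta v = cell eta u]] (rep (cell eta u)).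
    by apply: xgetPex; exists u.
  exists (rep (cell eta u)); split => //.
    by rewrite enormBC; exact: cell_close.
  rewrite /phi /Psi /= ub1.
  suff [_ ] : [set w | [/\ U2 w, H - e <= psi (rep (cell eta u)) w & enorm w `^ rho2 <= beta2]] (ans (rep (cell eta u))) by [].
  apply: xgetPex.
  have Hm : H <= m (rep (cell eta u)) by apply: ge_inf; [case: Iinf|exists (rep (cell eta u))].
  have [_ [w U2w <-] hw] := sup_adherent e0 (Ssup _ U1r).
  have hw' : H - e <= psi (rep (cell eta u)) w.
    by apply: ltW; apply: le_lt_trans hw; rewrite lerD2r.
  exists w; split => //.
  have hp := psi_le _ _ U1r U2w.
  have hr : 2 * L * enorm (rep (cell eta u)) `^ rho1 <= 2 * L * beta1 by rewrite ler_wpM2l// mulr_ge0.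
  have c20' : 0 < c / 2 by rewrite divr_gt0// (hyp_c hyp).
  rewrite -(ler_pM2l c20') beta2E; lra.
- by move=> u nb; rewrite /phi /Psi /= (negbTE nb).
by rewrite Hlo Hhi.
Qed.

End Hamiltonian.

(** * Piecewise definitions and bounded representatives of controls *)

Section Representatives.
Context {R : realType}.
Notation mul := (@lebesgue_measure R).

Lemma measurable_ite (D : set R) (b : R -> bool) (p q : R -> R) :
  cmeas D b -> measurable_fun D p -> measurable_fun D q ->
  measurable_fun D (fun s => if b s then p s else q s).
Proof.
move=> mb mp mq.
have m1 : measurable_fun D (fun s => (b s)%:R * p s + (~~ b s)%:R * q s).
  by apply: measurable_funD; apply: measurable_funM => //;
    [exact: (cmeas_measurable (fun c : bool => c%:R) mb)|
     exact: (cmeas_measurable (fun c : bool => (~~ c)%:R) mb)].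
apply: eq_measurable_fun m1 => s _.
by case: (b s); rewrite /= ?mul1r ?mul0r ?addr0 ?add0r.
Qed.

Lemma mvec_ite (D : set R) {m : nat} (b : R -> bool) (u v : R -> 'rV[R]_m) :
  cmeas D b -> mvec D u -> mvec D v -> mvec D (fun s => if b s then u s else v s).
Proof.
move=> mb mu mv i.
apply: eq_measurable_fun (measurable_ite mb (mu i) (mv i)) => s _.
by case: (b s).
Qed.

Lemma cmeas_ge (D : set R) (a : R) : measurable D -> cmeas D (fun s => a <= s).
Proof.
by move=> mD; apply: cmeas_bool => //; apply: measurable_fun_ler;
  [exact: measurable_cst|exact: measurable_id].
Qed.

Lemma ae_eq_before {V : Type} (t e : R) (u v : R -> V) :
  (forall s, t <= s -> s < e -> u s = v s) -> u = v %[ae mul in `[t, e]%classic].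
Proof.
move=> uv; exists [set e]; split => //; first exact: lebesgue_measure_set1.
move=> s /= h; apply: contrapT => se; apply: h; rewrite in_itv/= => /andP[ts].
by rewrite le_eqVlt => /predU1P[|/(uv _ ts)//]; move/se.
Qed.

Lemma control_rep {m : nat} (T t : R) (U : set 'rV[R]_m) (u : R -> 'rV[R]_m) : U 0 ->
  control T U t u -> exists v M, bctrl U t T M v /\ u = v %[ae mul in `[t, T]%classic].
Proof.
move=> U0 [[mu hu] [M hM]].
pose b s := enorm (u s) <= `|M|.
have mb : cmeas `[t, T]%classic b.
  apply: cmeas_bool => //; apply: measurable_fun_ler; last exact: measurable_cst.
  exact: measurable_enorm.
exists (fun s => if b s then u s else 0), `|M|; split; last first.
  apply: ae_mono hM => s hs sT; rewrite /b ifT//.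
  by rewrite (le_trans (hs sT))// ler_norm.
split; first by apply: mvec_ite => // i; exact: measurable_cst.
move=> s sT; case: ifP => [bs|_]; last by rewrite enorm0.
by split => //; exact: hu.
Qed.

Lemma bctrl_control {m : nat} (T t M : R) (U : set 'rV[R]_m) (u : R -> 'rV[R]_m) :
  bctrl U t T M u -> control T U t u.
Proof.
move=> bu; split; first exact: bctrl_control_on bu.
by exists M; apply: aeW => s sT; have [_ /(_ _ sT)[]] := bu.
Qed.

Lemma bctrl_control1 {m : nat} (T t M : R) (U : set 'rV[R]_m) (u : R -> 'rV[R]_m) :
  bctrl U t T M u -> control1 T U t u.
Proof.
move=> bu; split; first exact: bctrl_control_on bu.
have b1 : bmeas t T (fun s => enorm (u s)).
  split; first by case: bu => mu _; exact: measurable_enorm.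
  by exists M => s /bu.2[_]; rewrite ger0_norm ?enorm_ge0.
by have := EFin_Int b1 => ->; rewrite ltry.
Qed.

Lemma control_control1 {m : nat} (T t : R) (U : set 'rV[R]_m) (u : R -> 'rV[R]_m) :
  U 0 -> control T U t u -> control1 T U t u.
Proof.
move=> U0 cu; have [v [M [bv uv]]] := control_rep U0 cu.
split; first by case: cu.
have e : (\int[mul]_(s in `[t, T]) (enorm (u s))%:E = \int[mul]_(s in `[t, T]) (enorm (v s))%:E)%E.
  apply: ge0_ae_eq_integral => //.
  - apply/measurable_EFinP; apply: measurable_enorm; by case: cu => -[].
  - by apply/measurable_EFinP; apply: measurable_enorm; case: bv.
  - by move=> s _; rewrite lee_fin enorm_ge0.
  - by move=> s _; rewrite lee_fin enorm_ge0.
  - by apply: ae_mono uv => s h sT; rewrite h.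
by rewrite /= e; have [_] := bctrl_control1 bv.
Qed.

Lemma powR_bound (v r b : R) : 0 <= v -> 0 < r -> v `^ r <= b -> v <= b `^ r^-1.
Proof.
move=> v0 r0 vb; have -> : v = (v `^ r) `^ r^-1.
  by rewrite -powRrM divff ?gt_eqF// powRr1.
apply: ge0_ler_powR; rewrite ?nnegrE ?powR_ge0 ?invr_ge0//; first exact: ltW.
exact: le_trans (powR_ge0 _ _) vb.
Qed.

End Representatives.

(** * Costs of bounded controls *)

Section Costs.
Context {R : realType} {n m1 m2 : nat}.
Notation mul := (@lebesgue_measure R).
Variables (T : R) (U1 : set 'rV[R]_m1) (U2 : set 'rV[R]_m2).
Variables (f : R -> 'rV[R]_n -> 'rV[R]_m1 -> 'rV[R]_m2 -> 'rV[R]_n)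
  (g : R -> 'rV[R]_n -> 'rV[R]_m1 -> 'rV[R]_m2 -> R) (h : 'rV[R]_n -> R).
Variables (L c rho1 rho2 sigma1 sigma2 mu mu0 mu1 mu2 : R).
Hypothesis hyp : standing_hyp T f g h U1 U2 L c rho1 rho2 sigma1 sigma2 mu mu0 mu1 mu2.

Let cf i := coord_cont_within i (f_continuous hyp).

Lemma trajectory_primitive t e x M1 M2 u1 u2 : 0 <= t -> t <= e -> e <= T ->
  bctrl U1 t e M1 u1 -> bctrl U2 t e M2 u2 ->
  let y := trajectory e f t x u1 u2 in primitive t e x y (field f u1 u2 y).
Proof.
move=> t0 te eT b1 b2 /=.
apply/(is_trajectory_primitive hyp x _ t0 te eT b1 b2); apply: xgetPex.
have [y py] := primitive_exists hyp x t0 te eT b1 b2.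
by exists y; apply/(is_trajectory_primitive hyp x _ t0 te eT b1 b2).
Qed.

Lemma trajectory_restrict t e x M1 M2 u1 u2 : 0 <= t -> t <= e -> e <= T ->
  bctrl U1 t T M1 u1 -> bctrl U2 t T M2 u2 ->
  trajectory e f t x u1 u2 e = trajectory T f t x u1 u2 e.
Proof.
move=> t0 te eT b1 b2.
have [b1e b2e] := (bctrl_sub (lexx t) eT b1, bctrl_sub (lexx t) eT b2).
have p := trajectory_primitive x t0 (le_trans te eT) (lexx T) b1 b2.
have pe := trajectory_primitive x t0 te eT b1e b2e.
have p' := primitive_sub p (lexx t) eT; rewrite (primitive_start p (le_trans te eT)) in p'.
apply: (primitive_unique hyp t0 eT b1e b2e pe p').
by rewrite in_itv/= te lexx.
Qed.

Lemma cost_trajectory t x M1 M2 u1 u2 : t \in `[0, T] ->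
  bctrl U1 t T M1 u1 -> bctrl U2 t T M2 u2 ->
  let y := trajectory T f t x u1 u2 in
  cost T f g h t x u1 u2 = (Int t T (fun s => g s (y s) (u1 s) (u2 s)) + h (y T))%:E.
Proof.
rewrite in_itv/= => /andP[t0 tT] b1 b2 /=.
have p := trajectory_primitive x t0 tT (lexx T) b1 b2.
rewrite /cost/= EFinD -EFin_Int//.
exact: (bmeas_running hyp t0 (lexx T) b1 b2 (primitive_path p)).
Qed.

Lemma cost_ae t x u1 u2 u1' u2' : t \in `[0, T] ->
  control T U1 t u1 -> control T U1 t u1' -> control T U2 t u2 -> control T U2 t u2' ->
  u1 = u1' %[ae mul in `[t, T]%classic] -> u2 = u2' %[ae mul in `[t, T]%classic] ->
  cost T f g h t x u1 u2 = cost T f g h t x u1' u2'.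
Proof.
rewrite in_itv/= => /andP[t0 tT] [c1 c1b] [c1' _] [c2 c2b] [c2' _] e1 e2.
have e := trajectory_ae cf x t0 tT (lexx T) c1 c1' c2 c2' e1 e2.
rewrite /cost/= -e; congr (_ + _)%E.
have [v1 [M1 [b1 e1']]] := control_rep (U1_zero hyp) (conj c1 c1b).
have [v2 [M2 [b2 e2']]] := control_rep (U2_zero hyp) (conj c2 c2b).
have my : mvec `[t, T]%classic (trajectory T f t x u1 u2).
  rewrite (trajectory_ae cf x t0 tT (lexx T) c1 (bctrl_control_on b1) c2 (bctrl_control_on b2) e1' e2').
  by have := primitive_path (trajectory_primitive x t0 tT (lexx T) b1 b2) => /= p i; have [] := p i.
have mg v w : control_on T U1 t v -> control_on T U2 t w ->
    measurable_fun `[t, T]%classic (fun s => (g s (trajectory T f t x u1 u2 s) (v s) (w s))%:E).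
  move=> [mv hv] [mw hw]; apply/measurable_EFinP.
  apply: (measurable_superposition _ (cont_on_gameP (g_continuous hyp))) => // s sT.
  by split; [exact: (subset_itv_cc t0 (lexx T))|exact: hv|exact: hw].
apply: ae_eq_integral => //; [exact: mg|exact: mg|].
by apply: ae_mono2 e1 e2 => s h1 h2 sT; rewrite h1 ?h2.
Qed.

End Costs.

(** * The stepped feedback with a guide *)

Section SteppedStrategy.
Context {R : realType} {n m1 m2 : nat}.
Notation mul := (@lebesgue_measure R).
Variables (T : R) (U1 : set 'rV[R]_m1) (U2 : set 'rV[R]_m2).
Variables (f : R -> 'rV[R]_n -> 'rV[R]_m1 -> 'rV[R]_m2 -> 'rV[R]_n)
  (g : R -> 'rV[R]_n -> 'rV[R]_m1 -> 'rV[R]_m2 -> R) (h : 'rV[R]_n -> R).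
Variables (L c rho1 rho2 sigma1 sigma2 mu mu0 mu1 mu2 : R).
Hypothesis hyp : standing_hyp T f g h U1 U2 L c rho1 rho2 sigma1 sigma2 mu mu0 mu1 mu2.
Variables (t : R) (x : 'rV[R]_n) (num : nat) (alpha : (R -> 'rV[R]_m1) -> R -> 'rV[R]_m2).
Hypotheses (t0T : t \in `[0, T]) (num0 : (0 < num)%N).
Hypothesis salpha : strategy T U1 U2 t alpha.
Variables (grad : R -> 'rV[R]_n -> 'rV[R]_n) (ub : R -> 'rV[R]_n -> 'rV[R]_n -> 'rV[R]_m1)
  (phi : R -> 'rV[R]_n -> 'rV[R]_n -> 'rV[R]_m1 -> 'rV[R]_m2) (b1 b2 : R).
Hypothesis hub : forall s z q, U1 (ub s z q) /\ enorm (ub s z q) `^ rho1 <= b1.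
Hypothesis hphi : forall s z q u, U2 (phi s z q u) /\ enorm (phi s z q u) `^ rho2 <= b2.
Hypothesis mphi : forall s z q D u, measurable D -> mvec D u -> mvec D (phi s z q \o u).
Hypotheses (b10 : 0 <= b1) (b20 : 0 <= b2).

Definition node (k : nat) : R := t + k%:R * ((T - t) / num%:R).

(** The horizon is [node k] instead of [T], so that the position depends only on the controls before
    the node. [trajectory_restrict] identifies it with the position on the full horizon. *)
Definition guide_pos k (a : R -> 'rV[R]_m1) : 'rV[R]_n :=
  trajectory (node k) f t x a (alpha a) (node k).

Definition real_pos k u1 (b : R -> 'rV[R]_m2) : 'rV[R]_n :=
  trajectory (node k) f t x u1 b (node k).

(* First component: the control fed to [alpha] in the guide system.  Second
   component: the answer to [u1].  Both are constant feedbacks between nodes. *)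
Fixpoint stepped u1 (k : nat) : (R -> 'rV[R]_m1) * (R -> 'rV[R]_m2) :=
  if k is j.+1 then
    let ab := stepped u1 j in
    let z := guide_pos j ab.1 in
    let q := grad (node j) (real_pos j u1 ab.2 - z) in
    (fun s => if node j <= s then ub (node j) z q else ab.1 s,
     fun s => if node j <= s then phi (node j) z q (u1 s) else ab.2 s)
  else (fun=> 0, fun=> 0).

Definition stepped_strategy u1 := (stepped u1 num).2.
Definition stepped_guide u1 := (stepped u1 num).1.

Let step0 : 0 <= (T - t) / num%:R.
Proof.
have /andP[_ tT] : 0 <= t <= T := t0T.
by rewrite divr_ge0// subr_ge0.
Qed.

Lemma node0 : node 0 = t.
Proof. by rewrite /node mul0r addr0. Qed.

Lemma node_num : node num = T.
Proof. by rewrite /node mulrC divfK ?subrKC// pnatr_eq0 -lt0n. Qed.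

Lemma nodeS k : node k.+1 = node k + (T - t) / num%:R.
Proof. by rewrite /node -natr1 mulrDl mul1r addrA. Qed.

Lemma node_le j k : (j <= k)%N -> node j <= node k.
Proof. by move=> jk; rewrite lerD2l ler_wpM2r// ler_nat. Qed.

Lemma node_ge k : t <= node k.
Proof. by rewrite -{1}node0 node_le. Qed.

Lemma node_leT k : (k <= num)%N -> node k <= T.
Proof. by move=> kn; rewrite -node_num node_le. Qed.

Lemma stepped1_spec u1 k s : U1 ((stepped u1 k).1 s) /\ enorm ((stepped u1 k).1 s) `^ rho1 <= b1.
Proof.
elim: k => [|k IH] /=; last by case: ifP.
by split; [exact: U1_zero hyp|rewrite enorm0 powR0// gt_eqF// (hyp_rho1 hyp)].
Qed.

Lemma stepped2_spec u1 k s : U2 ((stepped u1 k).2 s) /\ enorm ((stepped u1 k).2 s) `^ rho2 <= b2.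
Proof.
elim: k => [|k IH] /=; last by case: ifP.
by split; [exact: U2_zero hyp|rewrite enorm0 powR0// gt_eqF// (hyp_rho2 hyp)].
Qed.

Lemma stepped1_mvec u1 k D : measurable D -> mvec D (stepped u1 k).1.
Proof.
move=> mD; elim: k => [|k IH] /=; first by move=> i; exact: measurable_cst.
by apply: mvec_ite; [exact: cmeas_ge|move=> i; exact: measurable_cst|exact: IH].
Qed.

Lemma stepped2_mvec u1 k D : measurable D -> mvec D u1 -> mvec D (stepped u1 k).2.
Proof.
move=> mD mu_; elim: k => [|k IH] /=; first by move=> i; exact: measurable_cst.
by apply: mvec_ite; [exact: cmeas_ge|exact: mphi|exact: IH].
Qed.

Lemma stepped1_bctrl u1 k : bctrl U1 t T (b1 `^ rho1^-1) (stepped u1 k).1.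
Proof.
split; first exact: stepped1_mvec.
move=> s _; have [hU hb] := stepped1_spec u1 k s; split => //.
by apply: powR_bound; rewrite ?enorm_ge0 ?(hyp_rho1 hyp).
Qed.

Lemma stepped2_bctrl u1 k : mvec `[t, T]%classic u1 ->
  bctrl U2 t T (b2 `^ rho2^-1) (stepped u1 k).2.
Proof.
move=> mu_; split; first exact: stepped2_mvec.
move=> s _; have [hU hb] := stepped2_spec u1 k s; split => //.
by apply: powR_bound; rewrite ?enorm_ge0 ?(hyp_rho2 hyp).
Qed.

Lemma stepped_before u1 j k s : (j <= k)%N -> s < node j ->
  (stepped u1 k).1 s = (stepped u1 j).1 s /\ (stepped u1 k).2 s = (stepped u1 j).2 s.
Proof.
move=> /subnK <- sj; elim: (k - j)%N => [|i IH] //=.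
have -> : node (i + j) <= s = false.
  by apply/negbTE; rewrite -ltNge (lt_le_trans sj)// node_le// leq_addl.
exact: IH.
Qed.

Lemma sub_control_on {m : nat} (U : set 'rV[R]_m) e u : e <= T ->
  control_on T U t u -> control_on e U t u.
Proof.
move=> eT [mu_ hu]; split; last by move=> s /(subset_itv_cc (lexx _) eT)/hu.
by move=> i; apply: measurable_funS (mu_ i) => //; exact: subset_itv_cc.
Qed.

Let cf i := coord_cont_within i (f_continuous hyp).

Lemma guide_pos_ae k a a' M M' : (k <= num)%N -> bctrl U1 t T M a -> bctrl U1 t T M' a' ->
  a = a' %[ae mul in `[t, node k]%classic] -> guide_pos k a = guide_pos k a'.
Proof.
move=> kn ba ba' e.
have /andP[t0 tT] : 0 <= t <= T := t0T.
have [c1 c1'] := (bctrl_control1 ba, bctrl_control1 ba').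
rewrite /guide_pos (@trajectory_ae _ _ _ _ T U1 U2 f cf t (node k) x a (alpha a) a' (alpha a'))//.
- exact: node_ge.
- exact: node_leT.
- exact/sub_control_on/(bctrl_control_on ba)/node_leT.
- exact/sub_control_on/(bctrl_control_on ba')/node_leT.
- by apply: sub_control_on (node_leT kn) _; have [] := salpha.1 _ c1.
- by apply: sub_control_on (node_leT kn) _; have [] := salpha.1 _ c1'.
- apply: salpha.2 => //; rewrite in_itv/= node_ge; exact: node_leT.
Qed.

(** Induction on nodes. A node beyond [s] changes nothing on [[t, s]]. At a node up to [s] the
    positions agree, since all controls agree almost everywhere before it and [alpha] is itself
    nonanticipating; hence the two feedbacks coincide. *)
Lemma stepped_nonanticipating u v s k : control1 T U1 t u -> control1 T U1 t v ->
  s \in `[t, T] -> u = v %[ae mul in `[t, s]%classic] -> (k <= num)%N ->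
  (stepped u k).1 = (stepped v k).1 %[ae mul in `[t, s]%classic] /\
  (stepped u k).2 = (stepped v k).2 %[ae mul in `[t, s]%classic].
Proof.
move=> cu cv sT uv; have /andP[t0 tT] : 0 <= t <= T := t0T.
elim: k => [|k IH] kn; first by split; apply: aeW.
have [IH1 IH2] := IH (ltnW kn).
have kT := node_leT (ltnW kn).
have [ks|sk] := leP (node k) s; last first.
  have low (r : R) : r \in `[t, s] -> node k <= r = false.
    rewrite in_itv/= => /andP[_ rs]; apply/negbTE; rewrite -ltNge.
    exact: le_lt_trans sk.
  split; [apply: ae_mono IH1|apply: ae_mono IH2] => r hr rs /=;
    rewrite low//; exact: hr.
have sub : `[t, node k]%classic `<=` `[t, s]%classic by exact: subset_itv_cc.
have IH1' : (stepped u k).1 = (stepped v k).1 %[ae mul in `[t, node k]%classic].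
  by apply: ae_mono IH1 => r hr /sub; exact: hr.
have IH2' : (stepped u k).2 = (stepped v k).2 %[ae mul in `[t, node k]%classic].
  by apply: ae_mono IH2 => r hr /sub; exact: hr.
have uv' : u = v %[ae mul in `[t, node k]%classic].
  by apply: ae_mono uv => r hr /sub; exact: hr.
have zE : guide_pos k (stepped u k).1 = guide_pos k (stepped v k).1.
  by apply: guide_pos_ae => //; [exact: ltnW|exact: stepped1_bctrl|exact: stepped1_bctrl].
have xE : real_pos k u (stepped u k).2 = real_pos k v (stepped v k).2.
  have [mu_ _] := cu.1; have [mv_ _] := cv.1.
  rewrite /real_pos (@trajectory_ae _ _ _ _ T U1 U2 f cf t (node k) x u (stepped u k).2 v (stepped v k).2)//.
  - exact: node_ge.
  - by apply: sub_control_on kT cu.1.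
  - by apply: sub_control_on kT cv.1.
  - exact/(sub_control_on kT)/(bctrl_control_on (stepped2_bctrl k mu_)).
  - exact/(sub_control_on kT)/(bctrl_control_on (stepped2_bctrl k mv_)).
split => /=.
  by apply: ae_mono IH1 => r hr rs /=; rewrite zE xE; case: ifP => // _; exact: hr.
by apply: ae_mono2 IH2 uv => r hr hr' rs /=; rewrite zE xE; case: ifP => _; rewrite ?hr' ?hr.
Qed.

Lemma stepped_strategyP : strategy T U1 U2 t stepped_strategy.
Proof.
split=> [v cv|v w s cv cw sT vw].
  by have [mv_ _] := cv.1; exact: bctrl_control (stepped2_bctrl num mv_).
by have [] := stepped_nonanticipating cv cw sT vw (leqnn num).
Qed.

Lemma stepped_strategy_le r : (T - t) * b2 <= r ->
  strategy_le T U1 U2 rho2 t r stepped_strategy.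
Proof.
move=> hr; have /andP[t0 tT] : 0 <= t <= T := t0T.
split; first exact: stepped_strategyP.
move=> v cv; have [mv_ _] := cv.1; have bb := stepped2_bctrl num mv_.
split; first exact: bctrl_control bb.
have bp := bctrl_powR (ltW (hyp_rho2 hyp)) bb.
have -> := EFin_Int bp; rewrite lee_fin (le_trans _ hr)// mulrC -Int_cst//.
apply: Int_le => [//||s _]; first exact: bmeas_cst.
by case: (stepped2_spec v num s).
Qed.

Lemma stepped_guide_le u1 r : (T - t) * b1 <= r ->
  control_le T U1 rho1 t r (stepped_guide u1).
Proof.
move=> hr; have /andP[t0 tT] : 0 <= t <= T := t0T.
have bb := stepped1_bctrl u1 num.
split; first exact: bctrl_control bb.
have bp := bctrl_powR (ltW (hyp_rho1 hyp)) bb.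
have -> := EFin_Int bp; rewrite lee_fin (le_trans _ hr)// mulrC -Int_cst//.
apply: Int_le => [//||s _]; first exact: bmeas_cst.
by case: (stepped1_spec u1 num s).
Qed.

(* The positions used by the feedback at a node are those of the final
   trajectories. *)
Lemma stepped_at u1 v M M' k s : bctrl U1 t T M u1 -> bctrl U2 t T M' v ->
  alpha (stepped_guide u1) = v %[ae mul in `[t, T]%classic] ->
  (k < num)%N -> node k <= s -> s < node k.+1 ->
  let y := trajectory T f t x u1 (stepped_strategy u1) (node k) in
  let z := trajectory T f t x (stepped_guide u1) v (node k) in
  stepped_guide u1 s = ub (node k) z (grad (node k) (y - z)) /\
  stepped_strategy u1 s = phi (node k) z (grad (node k) (y - z)) (u1 s).
Proof.
move=> bu bv av kn ks sk1 /=; have /andP[t0 tT] : 0 <= t <= T := t0T.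
have [mu_ _] := bu.
have kT := node_leT (ltnW kn).
rewrite /stepped_guide /stepped_strategy; have [-> ->] := stepped_before u1 kn sk1.
rewrite /= ks.
have ba := stepped1_bctrl u1 num; have bak := stepped1_bctrl u1 k.
have bb := stepped2_bctrl num mu_; have bbk := stepped2_bctrl k mu_.
(* At step [k], [alpha] was consulted on a partial guide control. This agrees with the final one
   before [node k], so the answers of [alpha] agree there as well. *)
have zE : guide_pos k (stepped u1 k).1 = trajectory T f t x (stepped u1 num).1 v (node k).
  rewrite (@guide_pos_ae k _ (stepped u1 num).1 _ _ (ltnW kn) bak ba); last first.
    by apply: ae_eq_before => r _ rk; have [<-] := stepped_before u1 (ltnW kn) rk.
  rewrite /guide_pos -(trajectory_restrict hyp x t0 (node_ge k) kT ba bv).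
  congr (_ _); apply: (trajectory_ae cf x t0 (node_ge k) kT).
  - exact/(sub_control_on kT)/(bctrl_control_on ba).
  - exact/(sub_control_on kT)/(bctrl_control_on ba).
  - by apply: sub_control_on kT _; have [] := salpha.1 _ (bctrl_control1 ba).
  - exact/(sub_control_on kT)/(bctrl_control_on bv).
  - exact: aeW.
  - by apply: ae_mono av => r hr /(subset_itv_cc (lexx t) kT); exact: hr.
have xE : real_pos k u1 (stepped u1 k).2 = trajectory T f t x u1 (stepped u1 num).2 (node k).
  rewrite /real_pos -(trajectory_restrict hyp x t0 (node_ge k) kT bu bb).
  congr (_ _); apply: (trajectory_ae cf x t0 (node_ge k) kT).
  - exact/(sub_control_on kT)/(bctrl_control_on bu).
  - exact/(sub_control_on kT)/(bctrl_control_on bu).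
  - exact/(sub_control_on kT)/(bctrl_control_on bbk).
  - exact/(sub_control_on kT)/(bctrl_control_on bb).
  - exact: aeW.
  - by apply: ae_eq_before => r _ rk; have [_ <-] := stepped_before u1 (ltnW kn) rk.
by rewrite zE xE.
Qed.

End SteppedStrategy.

(** The right end is excluded because at a node the feedback is already the next one. *)
Lemma Int_le_co {R : realType} (a b : R) (p q : R -> R) : bmeas a b p -> bmeas a b q ->
  (forall s, a <= s -> s < b -> p s <= q s) -> Int a b p <= Int a b q.
Proof.
move=> /bmeas_integrable ip /bmeas_integrable iq pq.
have sub : `[a, b[%classic `<=` `[a, b]%classic by apply: subset_itvl; rewrite bnd_simp.
have ipo : (@lebesgue_measure R).-integrable `[a, b[%classic (EFin \o p).
  exact: integrableS ip.
have iqo : (@lebesgue_measure R).-integrable `[a, b[%classic (EFin \o q).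
  exact: integrableS iq.
rewrite /Int -!Rintegral_itv_bndo_bndc//; apply: le_Rintegral => // s.
by rewrite /= in_itv/= => /andP[]; exact: pq.
Qed.

Lemma common_radius {R : realFieldType} {I : finType} (P : I -> R -> Prop) :
  (forall i d d', d' <= d -> P i d -> P i d') ->
  (forall i, exists2 d, 0 < d & P i d) -> exists2 d, 0 < d & forall i, P i d.
Proof.
move=> mono hP.
have /choice[d dP] : forall i, exists d, 0 < d /\ P i d.
  by move=> i; have [d] := hP i; exists d.
have d0 i : 0 < d i by case: (dP i).
have hd i : P i (d i) by case: (dP i).
have S0 : 0 <= \sum_j (d j)^-1 by apply: sumr_ge0 => j _; rewrite invr_ge0 ltW.
exists (1 + \sum_j (d j)^-1)^-1; first by rewrite invr_gt0 ltr_wpDr.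
move=> i; apply: mono (hd i); rewrite -[leRHS]invrK lef_pV2 ?posrE ?invr_gt0 ?ltr_wpDr//.
rewrite (bigD1 i)//= addrCA lerDl addr_ge0// sumr_ge0// => j _.
by rewrite invr_ge0 ltW.
Qed.

(** * Gradient of the penalty *)

Section Penalty.
Context {R : realType} {n : nat}.
Implicit Types (w : 'rV[R]_n) (th K l : R).

(** The gradient at [w] of [th * K * snorm l w]. *)
Definition pgrad th K l w : 'rV[R]_n := (th * K / snorm l w) *: w.

Lemma pgrad_le th K l w : 0 <= th <= 1 -> 0 <= K -> 0 < l -> enorm (pgrad th K l w) <= K.
Proof.
move=> /andP[th0 th1] K0 l0; have sp := snorm_gt0 w l0.
rewrite enormZ ger0_norm ?divr_ge0 ?mulr_ge0 ?snorm_ge0//.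
rewrite mulrAC ler_pdivrMr//; apply: ler_pM; rewrite ?mulr_ge0 ?enorm_ge0 ?snorm_geE//.
by rewrite ler_piMl.
Qed.

Lemma pgrad_lip th th' K l w w' : 0 <= th' <= 1 -> 0 <= K -> 0 < l ->
  enorm (pgrad th K l w - pgrad th' K l w') <=
    `|th - th'| * K + K * (2 * enorm (w - w') / l).
Proof.
move=> /andP[th0 th1] K0 l0; have sp := snorm_gt0 w l0.
have -> : pgrad th K l w - pgrad th' K l w' = ((th - th') * K / snorm l w) *: w
   + (th' * K) *: ((snorm l w)^-1 *: w - (snorm l w')^-1 *: w').
  rewrite /pgrad scalerBr !scalerA addrA -scalerDl; congr (_ *: _ - _).
  by rewrite -mulrDl -mulrDl subrK.
apply: (le_trans (enormD _ _)); rewrite !enormZ; apply: lerD.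
  rewrite !normrM (ger0_norm K0) (@ger0_norm _ (snorm l w)^-1) ?invr_ge0 ?snorm_ge0//.
  rewrite [leLHS](_ : _ = (`|th - th'| * K) * (enorm w / snorm l w)); last by ring.
  by rewrite ler_piMr ?mulr_ge0// ler_pdivrMr// mul1r snorm_geE.
rewrite ger0_norm ?mulr_ge0//; apply: ler_pM; rewrite ?mulr_ge0 ?enorm_ge0//.
  by rewrite ler_piMl.
exact: snorm_grad_lip.
Qed.

End Penalty.

(** * Moduli of continuity uniform over controls of bounded energy *)

Section LocalEstimates.
Context {R : realType} {n m1 m2 : nat}.
Variables (T : R) (U1 : set 'rV[R]_m1) (U2 : set 'rV[R]_m2).
Variables (f : R -> 'rV[R]_n -> 'rV[R]_m1 -> 'rV[R]_m2 -> 'rV[R]_n)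
  (g : R -> 'rV[R]_n -> 'rV[R]_m1 -> 'rV[R]_m2 -> R) (h : 'rV[R]_n -> R).
Variables (L c rho1 rho2 sigma1 sigma2 mu mu0 mu1 mu2 : R).
Hypothesis hyp : standing_hyp T f g h U1 U2 L c rho1 rho2 sigma1 sigma2 mu mu0 mu1 mu2.

Lemma ham_uniformly_cont (B K e : R) : 0 <= K -> 0 <= B -> 0 < e ->
  exists2 d, 0 < d & forall s x q u1 u2 s' x' q' u1' u2',
    s \in `[0, T] -> U1 u1 -> U2 u2 -> enorm x <= B -> enorm u1 <= B -> enorm u2 <= B ->
    enorm q' <= K -> s' \in `[0, T] -> U1 u1' -> U2 u2' ->
    `|s - s'| <= d -> enorm (x - x') <= d -> enorm (q - q') <= d ->
    enorm (u1 - u1') <= d -> enorm (u2 - u2') <= d ->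
    `|ham f g s x q u1 u2 - ham f g s' x' q' u1' u2'| <= e.
Proof.
move=> K0 B0 e0; have L0 := ltW (hyp_L hyp).
pose F := L * (1 + B + B `^ sigma1 + B `^ sigma2).
have F0 : 0 <= F by rewrite mulr_ge0// !addr_ge0// powR_ge0.
pose e1 := e / (2 + n%:R * K + F).
have D0 : 0 < 2 + n%:R * K + F by rewrite -addrA ltr_wpDr// addr_ge0// mulr_ge0.
have e10 : 0 < e1 by rewrite divr_gt0.
have [dg dg0 hg] := uniformly_cont (U1_closed hyp) (U2_closed hyp) B
  (cont_on_gameP (g_continuous hyp)) e10.
have [df df0 hf] : exists2 d, 0 < d & forall i, forall s x u1 u2 s' x' u1' u2',
    s \in `[0, T] -> U1 u1 -> U2 u2 -> enorm x <= B -> enorm u1 <= B -> enorm u2 <= B ->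
    s' \in `[0, T] -> U1 u1' -> U2 u2' ->
    `|s - s'| <= d -> enorm (x - x') <= d -> enorm (u1 - u1') <= d ->
    enorm (u2 - u2') <= d -> `|f s x u1 u2 0 i - f s' x' u1' u2' 0 i| < e1.
  apply: (@common_radius R 'I_n (fun i d => forall s x u1 u2 s' x' u1' u2',
    s \in `[0, T] -> U1 u1 -> U2 u2 -> enorm x <= B -> enorm u1 <= B -> enorm u2 <= B ->
    s' \in `[0, T] -> U1 u1' -> U2 u2' ->
    `|s - s'| <= d -> enorm (x - x') <= d -> enorm (u1 - u1') <= d ->
    enorm (u2 - u2') <= d -> `|f s x u1 u2 0 i - f s' x' u1' u2' 0 i| < e1)).
    move=> i d d' dd hd s x u1 u2 s' x' u1' u2' *.
    by apply: hd => //; exact: le_trans dd.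
  move=> i; exact: (uniformly_cont (U1_closed hyp) (U2_closed hyp) B
    (coord_cont_within i (f_continuous hyp)) e10).
exists (Num.min e1 (Num.min dg df)); first by rewrite !lt_min e10 dg0.
move=> s x q u1 u2 s' x' q' u1' u2' sT U1u U2u xB u1B u2B q'K s'T U1u' U2u'.
rewrite !le_min => /and3P[_ sg sf] /and3P[_ xg xf] /and3P[qe _ _] /and3P[_ g1 f1] /and3P[_ g2 f2].
have hG := ltW (hg _ _ _ _ _ _ _ _ sT U1u U2u xB u1B u2B s'T U1u' U2u' sg xg g1 g2).
have hF : enorm (f s x u1 u2 - f s' x' u1' u2') <= n%:R * e1.
  apply: enorm_le_coord => i; rewrite !mxE; apply: ltW; exact: hf.
have fF : enorm (f s x u1 u2) <= F.
  apply: (le_trans (f_growth hyp x sT U1u U2u)); rewrite ler_wpM2l//.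
  rewrite !lerD//.
  - by rewrite (le_trans (jap_le _))// lerD2l.
  - by apply: ge0_ler_powR; rewrite ?nnegrE ?enorm_ge0// (hyp_sigma1 hyp).
  - by apply: ge0_ler_powR; rewrite ?nnegrE ?enorm_ge0// (hyp_sigma2 hyp).
have -> : ham f g s x q u1 u2 - ham f g s' x' q' u1' u2' =
  (g s x u1 u2 - g s' x' u1' u2') - edot (q - q') (f s x u1 u2)
  - edot q' (f s x u1 u2 - f s' x' u1' u2').
  by rewrite /ham edotBl edotBr; ring.
apply: (le_trans (ler_normB _ _)); apply: (le_trans (lerD (ler_normB _ _) (lexx _))).
have h1 : `|edot (q - q') (f s x u1 u2)| <= e1 * F.
  by apply: (le_trans (edot_le_abs _ _)); rewrite ler_pM ?enorm_ge0.
have h2 : `|edot q' (f s x u1 u2 - f s' x' u1' u2')| <= K * (n%:R * e1).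
  by apply: (le_trans (edot_le_abs _ _)); rewrite ler_pM ?enorm_ge0.
apply: (le_trans (lerD (lerD hG h1) h2)).
have -> : e1 + e1 * F + K * (n%:R * e1) = e1 * (1 + n%:R * K + F) by ring.
rewrite /e1 mulrAC ler_pdivrMr// ler_wpM2l ?(ltW e0)//.
by rewrite !lerD2r ler1n.
Qed.

(** [d] may depend on the energy bound [A] but not on [M1], [M2]. Since [nu > 1], [powR_subcritical]
    splits [|u_i| ^ sigma_i] into the constant [Y], small over short times, and a fraction [1 / k]
    of the energy density, small uniformly; each part is allotted [eta / 2]. *)
Lemma small_displacement (nu Z A eta : R) : 1 < nu -> 0 <= Z -> 0 <= A -> 0 < eta ->
  sigma1 * nu <= rho1 -> sigma2 * nu <= rho2 ->
  exists2 d, 0 < d & forall t e x M1 M2 u1 u2 y E1 E2, 0 <= t -> t <= e -> e <= T ->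
    bctrl U1 t e M1 u1 -> bctrl U2 t e M2 u2 -> primitive t e x y (field f u1 u2 y) ->
    E1 = Int t e (fun s => enorm (u1 s) `^ rho1) ->
    E2 = Int t e (fun s => enorm (u2 s) `^ rho2) -> E1 + E2 <= A ->
    (forall s, s \in `[t, e] -> jap (y s) <= Z) ->
    forall a b, t <= a -> a <= b -> b <= e -> b - a <= d -> enorm (y b - y a) <= eta.
Proof.
move=> nu1 Z0 A0 eta0 sn1 sn2; have L0 := ltW (hyp_L hyp).
have [r10 r20] := (ltW (hyp_rho1 hyp), ltW (hyp_rho2 hyp)).
have [s10 s20] := (hyp_sigma1 hyp, hyp_sigma2 hyp).
pose k := 1 + 2 * L * A / eta.
have k1 : 1 <= k by rewrite lerDl divr_ge0 ?mulr_ge0// ltW.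
have k0 : 0 < k by exact: lt_le_trans k1.
have num0 : 0 < nu - 1 by rewrite subr_gt0.
pose Y := k `^ (nu - 1)^-1.
have Y1 : 1 <= Y by rewrite -[leLHS](powRr0 k) ler_powR// invr_ge0 ltW.
have YE : Y `^ (1 - nu) = k^-1.
  rewrite -powRrM (_ : (nu - 1)^-1 * (1 - nu) = -1); last first.
    by field; rewrite gt_eqF.
  by rewrite powR_inv1// ltW.
pose D := L * (Z + 2 * Y) + 1.
have Y0 : 0 <= Y by exact: le_trans Y1.
have D0 : 0 < D by rewrite ltr_wpDl// mulr_ge0// addr_ge0// mulr_ge0.
exists (eta / (2 * D)); first by rewrite divr_gt0// mulr_gt0.
move=> t e x M1 M2 u1 u2 y E1 E2 t0 te eT b1 b2 py hE1 hE2 hE hZ a b ta ab be bad.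
have ate := vbmeas_sub ta be (primitive_vbmeas py).
have [b1' b2'] := (bctrl_sub ta be b1, bctrl_sub ta be b2).
have [bp1 bp2] := (bctrl_powR r10 b1', bctrl_powR r20 b2').
have hE12 : Int a b (fun s => enorm (u1 s) `^ rho1) + Int a b (fun s => enorm (u2 s) `^ rho2) <= A.
  apply: le_trans hE; rewrite hE1 hE2.
  have tb := le_trans ta ab; have ae := le_trans ab be.
  have [bq1 bq2] := (bctrl_powR r10 b1, bctrl_powR r20 b2).
  have mono p : bmeas t e p -> (forall s, 0 <= p s) -> Int a b p <= Int t e p.
    move=> bp p0; rewrite (Int_split ta ae bp).
    rewrite (Int_split ab be (bmeas_sub ta (lexx e) bp)).
    by rewrite addrCA lerDl addr_ge0// Int_ge0.
  by apply: lerD; apply: mono => // s; exact: powR_ge0.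
apply: (le_trans (primitive_dist py ta ab be)).
apply: (@le_trans _ _ (Int a b (fun s => L * (Z + 2 * Y) + L * k^-1 * (enorm (u1 s) `^ rho1 + enorm (u2 s) `^ rho2)))).
  apply: Int_le => [||s sab]; first exact: vbmeas_enorm.
    by apply: bmeasD; [exact: bmeas_cst|apply: bmeasZ; exact: bmeasD].
  have ste := subset_itv_cc ta be sab.
  have sT : s \in `[0, T] by exact: (subset_itv_cc t0 eT).
  have [U1u _] := b1.2 _ ste; have [U2u _] := b2.2 _ ste.
  apply: (le_trans (f_growth hyp (y s) sT U1u U2u)).
  rewrite -mulrA -mulrDr ler_wpM2l//.
  have p1 := powR_subcritical (ltW nu1) s10 sn1 Y1 (enorm_ge0 (u1 s)).
  have p2 := powR_subcritical (ltW nu1) s20 sn2 Y1 (enorm_ge0 (u2 s)).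
  rewrite YE in p1 p2; have := lerD (lerD (hZ _ ste) p1) p2.
  move=> /le_trans; apply; rewrite le_eqVlt; apply/orP; left; apply/eqP; ring.
rewrite IntD; [|exact: bmeas_cst|apply: bmeasZ; exact: bmeasD].
rewrite Int_cst// IntZ ?IntD//; last exact: bmeasD.
have -> : eta = eta / 2 + eta / 2 by rewrite -splitr.
apply: lerD.
  apply: (@le_trans _ _ (D * (eta / (2 * D)))).
    by rewrite ler_pM ?subr_ge0 ?mulr_ge0 ?addr_ge0 ?mulr_ge0// /D lerDl.
  by rewrite le_eqVlt; apply/orP; left; apply/eqP; field; rewrite gt_eqF.
apply: (@le_trans _ _ (L * k^-1 * A)).
  by rewrite ler_wpM2l// mulr_ge0// invr_ge0 ltW.
rewrite mulrAC ler_pdivrMr// /k.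
have -> : eta / 2 * (1 + 2 * L * A / eta) = eta / 2 + L * A by field; rewrite gt_eqF.
by rewrite lerDr divr_ge0// ltW.
Qed.


End LocalEstimates.

(** From [exp (- r b) * (1 + r (b - a)) <= exp (- r a)] the discount releases [r (b - a)] times the
    penalty; [snorm_descent] handles the displacement. The discount is taken at the right end
    throughout, which makes the gradient the one of the later penalty. *)
Lemma penalty_descent {R : realType} {n : nat} (r a b K l : R) (w v : 'rV[R]_n) :
  0 <= r -> 0 <= K -> 0 < l -> 0 <= a -> a <= b ->
  expR (- (r * b)) * K * snorm l v <=
    expR (- (r * a)) * K * snorm l w - r * (b - a) * (expR (- (r * b)) * K * snorm l w)
    + edot (pgrad (expR (- (r * b))) K l w) (v - w) + K * enorm (v - w) ^+ 2 / (2 * l).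
Proof.
move=> r0 K0 l0 a0 ab; have b0 := le_trans a0 ab.
set th := expR (- (r * b)).
have th0 : 0 <= th by exact: expR_ge0.
have th1 : th <= 1 by rewrite -expR0 ler_expR oppr_le0 mulr_ge0.
have tha : th * (1 + r * (b - a)) <= expR (- (r * a)).
  have -> : expR (- (r * a)) = th * expR (r * (b - a)).
    by rewrite -expRD; congr expR; ring.
  by rewrite ler_wpM2l// expR_ge1Dx.
have sp := snorm_gt0 w l0.
have h1 := ler_wpM2r (mulr_ge0 K0 (snorm_ge0 l w)) tha.
have h2 := ler_wpM2l (mulr_ge0 th0 K0) (snorm_descent w v l0).
have h3 : th * K * (enorm (v - w) ^+ 2 / (2 * l)) <= K * (enorm (v - w) ^+ 2 / (2 * l)).
  by rewrite ler_wpM2r ?divr_ge0 ?sqr_ge0 ?mulr_ge0 ?(ltW l0)// ler_piMl.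
have -> : edot (pgrad th K l w) (v - w) = th * K * (edot w (v - w) / snorm l w).
  by rewrite /pgrad edotZl; ring.
lra.
Qed.

Lemma increment_arith (R : realFieldType)
    (H e r P C d Ix Iz Jx Jz Qx Qz pb pa S kk : R) :
  (H - e - r * P - C * d) * d <= Jx - Qx -> Jz - Qz <= (H + e) * d ->
  pb <= pa - r * d * P + (Qx - Qz) + S -> S <= kk * d ^+ 2 ->
  - (2 * e) * d - (C + kk) * d ^+ 2 <= (Ix + Jx - (Iz + Jz) - pb) - (Ix - Iz - pa).
Proof. lra. Qed.

(** * Payoff comparison of the game and the guide *)

Section Doubling.
Context {R : realType} {n m1 m2 : nat}.
Variables (T : R) (U1 : set 'rV[R]_m1) (U2 : set 'rV[R]_m2).
Variables (f : R -> 'rV[R]_n -> 'rV[R]_m1 -> 'rV[R]_m2 -> 'rV[R]_n)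
  (g : R -> 'rV[R]_n -> 'rV[R]_m1 -> 'rV[R]_m2 -> R) (h : 'rV[R]_n -> R).
Variables (L c rho1 rho2 sigma1 sigma2 mu mu0 mu1 mu2 : R).
Hypothesis hyp : standing_hyp T f g h U1 U2 L c rho1 rho2 sigma1 sigma2 mu mu0 mu1 mu2.
Variables (E K Z dl Ab l : R).
Hypotheses (K0 : 0 < K) (dl0 : 0 <= dl) (l0 : 0 < l).
Hypotheses (ZK : Z `^ (mu - 1) <= dl * K) (AK : (Ab * E) `^ ((mu - 1) / mu) <= dl * K).

(** Cost of moving the position from [zs] to [xs]. Were [xs - zs] equal to [wa], [g] would cost
    [3 dl K |wa|], at most the penalty since [3 * dl <= th], and the one-sided Lipschitz condition
    [L] times the penalty: in all the factor [L + 1] that the discount pays. The deviation [D] from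
    [wa] costs the last term, where crude constants suffice because [D] will be [O(b' - a')]. *)
Lemma shift_ham s xs zs wa u b th W D Dm F : s \in `[0, T] -> U1 u -> U2 b ->
  jap xs <= Z -> jap zs <= Z -> enorm u `^ rho1 <= Ab * E -> enorm b `^ rho2 <= Ab * E ->
  3 * dl <= th <= 1 -> enorm (xs - zs - wa) <= D -> D <= Dm -> enorm wa <= W ->
  enorm (f s xs u b - f s zs u b) <= F ->
  ham f g s zs (pgrad th K l wa) u b - (L + 1) * (th * K * snorm l wa)
    - (3 * dl * K + K / l * (L * (2 * W + Dm) + F)) * D
  <= ham f g s xs (pgrad th K l wa) u b.
Proof.
move=> sT U1u U2b xZ zZ uE bE /andP[dth th1] wD DDm waW fF.
have L0 := ltW (hyp_L hyp); have mu1' := hyp_mu hyp.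
have mup : 0 < mu by exact: lt_le_trans mu1'.
have em : 0 <= (mu - 1) / mu by rewrite divr_ge0 ?subr_ge0// ltW.
have K0' := ltW K0.
have th0 : 0 <= th by apply: le_trans dth; rewrite mulr_ge0.
have D0 : 0 <= D by exact: le_trans (enorm_ge0 _) wD.
have AE0 : 0 <= Ab * E by exact: le_trans (powR_ge0 _ _) uE.
set w := xs - zs in wD *.
have wle : enorm w <= enorm wa + D.
  by rewrite -[w](subrKC wa) (le_trans (enormD _ _))// lerD2l.
have sp := snorm_gt0 wa l0; have se := snorm_geE l wa.
have gl : `|g s xs u b - g s zs u b| <= 3 * dl * K * enorm w.
  apply: (le_trans (g_lipschitz hyp xs zs sT U1u U2b)).
  rewrite ler_wpM2r ?enorm_ge0//.
  have -> : 3 * dl * K = dl * K + dl * K + dl * K by ring.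
  have split_exp (y rho : R) : y `^ (rho * (mu - 1) / mu) = (y `^ rho) `^ ((mu - 1) / mu).
    by rewrite -powRrM mulrA.
  rewrite !split_exp !lerD//.
  - apply: le_trans ZK; apply: ge0_ler_powR; rewrite ?subr_ge0 ?nnegrE//.
    + exact: le_trans (japmax_ge1 _ _).
    + exact: le_trans (jap_ge0 _) xZ.
    + exact: japmax_le.
  - by apply: le_trans AK; apply: ge0_ler_powR; rewrite ?nnegrE ?powR_ge0.
  - by apply: le_trans AK; apply: ge0_ler_powR; rewrite ?nnegrE ?powR_ge0.
set df := f s xs u b - f s zs u b.
have mono : edot w df <= L * enorm w ^+ 2.
  by rewrite edotC; exact: (f_monotone hyp).
have cross : - (D * F) <= edot (w - wa) df.
  have := edot_le_abs (w - wa) df; rewrite ler_norml => /andP[hh _].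
  by apply: le_trans hh; rewrite lerN2 ler_pM ?enorm_ge0.
pose k := th * K / snorm l wa.
have k0 : 0 <= k by rewrite divr_ge0 ?mulr_ge0// ltW.
have kl : k <= K / l.
  rewrite /k; apply: (@le_trans _ _ (K / snorm l wa)).
    by rewrite ler_wpM2r ?invr_ge0 ?(ltW sp)// ler_piMl.
  by rewrite ler_wpM2l// lef_pV2 ?posrE// snorm_gel.
have ks : k * enorm wa ^+ 2 <= th * K * snorm l wa.
  have -> : th * K * snorm l wa = k * snorm l wa ^+ 2.
    by rewrite /k; field; rewrite gt_eqF.
  by rewrite ler_wpM2l// lerXn2r ?nnegrE ?enorm_ge0 ?snorm_ge0//.
have w2 : enorm w ^+ 2 <= enorm wa ^+ 2 + (2 * W + Dm) * D.
  apply: (@le_trans _ _ ((enorm wa + D) ^+ 2)).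
    by rewrite lerXn2r ?nnegrE ?addr_ge0 ?enorm_ge0.
  have e1 : enorm wa * D <= W * D by rewrite ler_wpM2r.
  have e2 : D * D <= Dm * D by rewrite ler_wpM2r.
  have -> : (enorm wa + D) ^+ 2 = enorm wa ^+ 2 + (2 * (enorm wa * D) + D * D) by ring.
  by rewrite lerD2l [leRHS]mulrDl lerD// -mulrA ler_wpM2l.
have qdf : edot (pgrad th K l wa) df <= L * (th * K * snorm l wa) + K / l * (L * (2 * W + Dm) + F) * D.
  have -> : edot (pgrad th K l wa) df = k * (edot w df - edot (w - wa) df).
    by rewrite /pgrad edotZl -/k edotBl; ring.
  have e1 : edot w df - edot (w - wa) df <= L * enorm wa ^+ 2 + (L * (2 * W + Dm) + F) * D.
    have e2 := ler_wpM2l L0 w2.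
    have -> : L * enorm wa ^+ 2 + (L * (2 * W + Dm) + F) * D =
       L * (enorm wa ^+ 2 + (2 * W + Dm) * D) + D * F by ring.
    by rewrite lerD ?(le_trans mono)// lerNl.
  apply: (le_trans (ler_wpM2l k0 e1)).
  have -> : k * (L * enorm wa ^+ 2 + (L * (2 * W + Dm) + F) * D) =
     L * (k * enorm wa ^+ 2) + k * ((L * (2 * W + Dm) + F) * D) by ring.
  rewrite -(mulrA (K / l)); apply: lerD; first exact: ler_wpM2l.
  apply: ler_wpM2r => //.
  have W0 := le_trans (enorm_ge0 _) waW; have F0 := le_trans (enorm_ge0 _) fF.
  have Dm0 := le_trans D0 DDm.
  by rewrite mulr_ge0// addr_ge0// mulr_ge0// addr_ge0// mulr_ge0.
have gw : - (th * K * snorm l wa + 3 * dl * K * D) <= g s xs u b - g s zs u b.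
  move: gl; rewrite ler_norml => /andP[gl _]; apply: le_trans gl; rewrite lerN2.
  apply: (@le_trans _ _ (3 * dl * K * (enorm wa + D))).
    by rewrite ler_wpM2l ?mulr_ge0.
  rewrite mulrDr lerD2r; apply: ler_pM; rewrite ?mulr_ge0 ?enorm_ge0//.
  by rewrite ler_wpM2r.
have -> : ham f g s xs (pgrad th K l wa) u b =
    ham f g s zs (pgrad th K l wa) u b + (g s xs u b - g s zs u b)
    - edot (pgrad th K l wa) df.
  by rewrite /ham /df edotBr; ring.
move: gw qdf; move: (g s xs u b - g s zs u b) (edot _ df) (ham _ _ _ _ _ _ _).
move: (th * K * snorm l wa) (3 * dl * K) (K / l * (L * (2 * W + Dm) + F)).
move=> P q1 q2 dg ed hm gw qdf.
have -> : hm - (L + 1) * P - (q1 + q2) * D = hm + (- (P + q1 * D)) - (L * P + q2 * D) by ring.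
by rewrite lerD// ?lerN2// lerD2l.
Qed.

Variables (t : R) (x0 : 'rV[R]_n) (M1 M2 M3 M4 : R).
Variables (u1 : R -> 'rV[R]_m1) (b : R -> 'rV[R]_m2) (a : R -> 'rV[R]_m1) (v : R -> 'rV[R]_m2).
Variables (x z : R -> 'rV[R]_n).
Hypotheses (t0T : t \in `[0, T]).
Hypotheses (bu : bctrl U1 t T M1 u1) (bb : bctrl U2 t T M2 b).
Hypotheses (ba : bctrl U1 t T M3 a) (bv : bctrl U2 t T M4 v).
Hypotheses (px : primitive t T x0 x (field f u1 b x)) (pz : primitive t T x0 z (field f a v z)).

Let r := L + 1.
Let th s := expR (- (r * s)).
Let gx s := g s (x s) (u1 s) (b s).
Let gz s := g s (z s) (a s) (v s).

(** Running payoff gained over the guide, less the discounted penalty; it is almost nondecreasing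
    along the grid. *)
Definition advantage s : R :=
  Int t s gx - Int t s gz - th s * K * snorm l (x s - z s).

(** The feedback is frozen on the whole cell, but the comparison gradient is taken anew at each [a']
    of a finer subdivision. [C] and [Bw] depend on the pointwise bounds of the controls and cannot
    be made small by the grid; they multiply [(b' - a') ^ 2] only, and [increment_ge_of_local]
    removes them. *)
Lemma advantage_increment p p' H e C : t <= p -> p <= p' -> p' <= T ->
  (forall a' b' s, p <= a' -> a' <= s -> s < b' -> b' <= p' ->
    let q := pgrad (th b') K l (x a' - z a') in
    ham f g s (z s) q (a s) (v s) <= H + e /\
    H - e - r * (th b' * K * snorm l (x a' - z a')) - C * (b' - a')
      <= ham f g s (x s) q (u1 s) (b s)) ->
  - (2 * e) * (p' - p) <= advantage p' - advantage p.
Proof.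
move=> tp pp' p'T hq; have /andP[t0 tT] : 0 <= t <= T := t0T.
have L0 := ltW (hyp_L hyp); have r0 : 0 <= r by rewrite addr_ge0.
have pw := primitiveB px pz.
have [Bw Bw0 hBw] := vbmeas_bound (primitive_vbmeas pw).
have bgx := bmeas_running hyp t0 (lexx T) bu bb (primitive_path px).
have bgz := bmeas_running hyp t0 (lexx T) ba bv (primitive_path pz).
apply: (@increment_ge_of_local _ p p' (2 * e) (C + K * Bw ^+ 2 / (2 * l)) advantage pp') => a' b' pa' a'b' b'p'.
have ta' := le_trans tp pa'; have b'T := le_trans b'p' p'T.
have tb' := le_trans ta' a'b'; have a'T := le_trans a'b' b'T.
have [bgx' bgz'] := (bmeas_sub ta' b'T bgx, bmeas_sub ta' b'T bgz).
have d0 : 0 <= b' - a' by rewrite subr_ge0.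
pose q := pgrad (th b') K l (x a' - z a').
have bq u y (w : R -> 'rV[R]_m2) M M' : bctrl U1 t T M u -> bctrl U2 t T M' w ->
    vbmeas t T y -> bmeas a' b' (fun s => edot q (field f u w y s)).
  move=> b1 b2 by_; apply: vbmeas_edot; first exact: vbmeas_cst.
  apply: vbmeas_sub ta' b'T _; exact: (vbmeas_field hyp t0 (lexx T) b1 b2).
have bqx := bq _ _ _ _ _ bu bb (primitive_path px).
have bqz := bq _ _ _ _ _ ba bv (primitive_path pz).
have ex : edot q ((x b' - z b') - (x a' - z a')) =
    Int a' b' (fun s => edot q (field f u1 b x s)) - Int a' b' (fun s => edot q (field f a v z s)).
  rewrite -(edot_primitive q px)// -(edot_primitive q pz)// -edotBr; congr edot.
  by apply/rowP => i; rewrite !mxE; ring.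
have kx : (H - e - r * (th b' * K * snorm l (x a' - z a')) - C * (b' - a')) * (b' - a') <=
    Int a' b' gx - Int a' b' (fun s => edot q (field f u1 b x s)).
  rewrite -Int_cst// -IntB//; apply: Int_le_co => [||s a's sb'].
  - exact: bmeas_cst.
  - exact: bmeasB.
  by have [_] := hq a' b' s pa' a's sb' b'p'.
have kz : Int a' b' gz - Int a' b' (fun s => edot q (field f a v z s)) <= (H + e) * (b' - a').
  rewrite -Int_cst// -IntB//; apply: Int_le_co => [||s a's sb'].
  - exact: bmeasB.
  - exact: bmeas_cst.
  by have [] := hq a' b' s pa' a's sb' b'p'.
have a'0 := le_trans t0 ta'.
have pd := penalty_descent (x a' - z a') (x b' - z b') r0 (ltW K0) l0 a'0 a'b'.
rewrite -/(th b') -/(th a') -/q ex in pd.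
have dw : enorm (x b' - z b' - (x a' - z a')) ^+ 2 <= Bw ^+ 2 * (b' - a') ^+ 2.
  rewrite -exprMn lerXn2r ?nnegrE ?enorm_ge0 ?mulr_ge0//.
  exact: (primitive_lip pw hBw ta' a'b' b'T).
have dw' : K * enorm (x b' - z b' - (x a' - z a')) ^+ 2 / (2 * l) <=
    K * Bw ^+ 2 / (2 * l) * (b' - a') ^+ 2.
  have -> : K * Bw ^+ 2 / (2 * l) * (b' - a') ^+ 2 =
    K * (Bw ^+ 2 * (b' - a') ^+ 2) / (2 * l) by ring.
  rewrite ler_wpM2r ?invr_ge0 ?mulr_ge0 ?(ltW l0)//.
  by rewrite ler_wpM2l// ltW.
have sx : Int t b' gx = Int t a' gx + Int a' b' gx.
  by apply: Int_split => //; exact: bmeas_sub bgx.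
have sz : Int t b' gz = Int t a' gz + Int a' b' gz.
  by apply: Int_split => //; exact: bmeas_sub bgz.
rewrite /advantage sx sz.
exact: increment_arith kx kz pd dw'.
Qed.

End Doubling.

Section Feedback.
Context {R : realType} {n m1 m2 : nat}.
Variables (T : R) (U1 : set 'rV[R]_m1) (U2 : set 'rV[R]_m2).
Variables (f : R -> 'rV[R]_n -> 'rV[R]_m1 -> 'rV[R]_m2 -> 'rV[R]_n)
  (g : R -> 'rV[R]_n -> 'rV[R]_m1 -> 'rV[R]_m2 -> R) (h : 'rV[R]_n -> R).
Variables (L c rho1 rho2 sigma1 sigma2 mu mu0 mu1 mu2 : R).
Hypothesis hyp : standing_hyp T f g h U1 U2 L c rho1 rho2 sigma1 sigma2 mu mu0 mu1 mu2.
Variables (nu E K Z dl Ab l : R).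
Hypotheses (dl0 : 0 <= dl) (dl1 : dl <= 1) (Ldl : L * dl <= c / 2) (l0 : 0 < l).
Hypotheses (K0 : 0 < K) (Z0 : 0 < Z) (KZ : K * Z = E) (Zmu : Z `^ mu <= dl * E).
Hypotheses (ZK : Z `^ (mu - 1) <= dl * K) (AK : (Ab * E) `^ ((mu - 1) / mu) <= dl * K).
Hypotheses (sn1 : sigma1 * nu <= rho1) (sn2 : sigma2 * nu <= rho2).
Hypothesis sub : forall v s r : R, 0 <= v -> 0 <= s -> s * nu <= r ->
  K * v `^ s <= dl * (v `^ r + E).
Let B1 := beta1 L c E.
Let B2 := beta2 L c E.
Hypotheses (B1A : B1 <= Ab * E) (B2A : B2 <= Ab * E).
Variables (rad e d : R).
Hypotheses (radZ : Z <= rad) (rad1 : B1 `^ rho1^-1 <= rad) (rad2 : B2 `^ rho2^-1 <= rad).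
Hypothesis uc : forall s x q u1 u2 s' x' q' u1' u2',
    s \in `[0, T] -> U1 u1 -> U2 u2 -> enorm x <= rad -> enorm u1 <= rad -> enorm u2 <= rad ->
    enorm q' <= K -> s' \in `[0, T] -> U1 u1' -> U2 u2' ->
    `|s - s'| <= d -> enorm (x - x') <= d -> enorm (q - q') <= d ->
    enorm (u1 - u1') <= d -> enorm (u2 - u2') <= d ->
    `|ham f g s x q u1 u2 - ham f g s' x' q' u1' u2'| <= e.
Hypothesis d0 : 0 <= d.

Variables (s sk : R) (zs zk q qk : 'rV[R]_n) (H : R).
Hypotheses (sT : s \in `[0, T]) (skT : sk \in `[0, T]) (zsZ : jap zs <= Z).
Hypotheses (qK : enorm q <= K) (qkK : enorm qk <= K).
Hypotheses (sd : `|s - sk| <= d) (zd : enorm (zs - zk) <= d) (qd : enorm (q - qk) <= d).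
Hypotheses (Hlo : - (4 * L * E) <= H) (Hhi : H <= 4 * L * E).
Hypothesis e0 : 0 <= e.

Let rad_z : enorm zs <= rad.
Proof. exact: le_trans (enorm_le_jap _) (le_trans zsZ radZ). Qed.

Let rad_u1 u : enorm u `^ rho1 <= B1 -> enorm (u : 'rV[R]_m1) <= rad.
Proof.
by move=> uB; apply: le_trans rad1; apply: powR_bound; rewrite ?enorm_ge0 ?(hyp_rho1 hyp).
Qed.

Let rad_u2 u : enorm u `^ rho2 <= B2 -> enorm (u : 'rV[R]_m2) <= rad.
Proof.
by move=> uB; apply: le_trans rad2; apply: powR_bound; rewrite ?enorm_ge0 ?(hyp_rho2 hyp).
Qed.

(** The answer [v] of [alpha] has no pointwise bound. Up to [B2] uniform continuity carries the
    saddle inequality from the node to the current point; above [B2] coercivity alone puts the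
    Hamiltonian below [H]. *)
Lemma guide_ham_le a v : U1 a -> enorm a `^ rho1 <= B1 -> U2 v ->
  (forall w, U2 w -> ham f g sk zk qk a w <= H + e) -> ham f g s zs q a v <= H + 2 * e.
Proof.
move=> U1a aB U2v ha.
have [vB|/ltW vB] := leP (enorm v `^ rho2) B2.
  have := uc sT U1a U2v rad_z (rad_u1 aB) (rad_u2 vB) qkK skT U1a U2v sd zd qd.
  rewrite !subrr !enorm0 => /(_ d0 d0); rewrite ler_norml => /andP[_ h1].
  have := ha _ U2v; lra.
have h1 := ham_le hyp dl1 Ldl K0 Z0 KZ Zmu sn1 sn2 sub sT U1a U2v zsZ qK.
have L0 := ltW (hyp_L hyp).
have h2 : 2 * L * enorm a `^ rho1 <= 2 * L * B1 by rewrite ler_wpM2l// mulr_ge0.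
have c20 : 0 <= c / 2 by rewrite divr_ge0// (ltW (hyp_c hyp)).
have h3 := ler_wpM2l c20 vB; rewrite (beta2E hyp) -/B1 in h3.
have LE : 0 <= L * E by rewrite mulr_ge0// -KZ mulr_ge0// ltW.
apply: (le_trans h1); move: h2 h3 Hlo LE e0.
move: (enorm a `^ rho1) (enorm v `^ rho2) => p1 p2; lra.
Qed.

(** For moderate [u], the answer fits a nearby [v]; uniform continuity passes to [u] at the position
    of the guide, then [shift_ham] passes to that of the game. For large [u] the answer is 0, and
    coercivity applied directly at [xs] gives at least [4 L E >= H]. *)
Lemma real_ham_ge xs wa u b th W D Dm F eta : jap xs <= Z -> U1 u -> U2 b ->
  q = pgrad th K l wa -> 3 * dl <= th <= 1 ->
  enorm b `^ rho2 <= B2 -> eta <= d ->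
  (enorm u `^ rho1 <= B1 -> exists v, [/\ U1 v, enorm v `^ rho1 <= B1,
     enorm (u - v) <= eta & H - e <= ham f g sk zk qk v b]) ->
  (~~ (enorm u `^ rho1 <= B1) -> b = 0) ->
  enorm (xs - zs - wa) <= D -> D <= Dm -> enorm wa <= W ->
  enorm (f s xs u b - f s zs u b) <= F ->
  H - 2 * e - (L + 1) * (th * K * snorm l wa)
    - (3 * dl * K + K / l * (L * (2 * W + Dm) + F)) * D
  <= ham f g s xs q u b.
Proof.
move=> xZ U1u U2b hq hth bB etad small large wD DDm waW fF.
have L0 := ltW (hyp_L hyp); have K0' := ltW K0.
have [D0 W0 F0] : [/\ 0 <= D, 0 <= W & 0 <= F].
  by split; [apply: le_trans wD|apply: le_trans waW|apply: le_trans fF]; exact: enorm_ge0.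
have [uB|uB] := boolP (enorm u `^ rho1 <= B1).
  have [v [U1v vB uv hv]] := small uB.
  have := uc sT U1u U2b rad_z (rad_u1 uB) (rad_u2 bB) qkK skT U1v U2b sd zd qd (le_trans uv etad).
  rewrite subrr enorm0 => /(_ d0); rewrite ler_norml => /andP[h1 _].
  have := shift_ham hyp K0 dl0 l0 ZK AK sT U1u U2b xZ zsZ (le_trans uB B1A)
    (le_trans bB B2A) hth wD DDm waW fF.
  rewrite -hq; apply: le_trans; rewrite !lerD2r.
  move: hv h1; move: (ham _ _ sk _ _ _ _) (ham _ _ s _ _ _ _) => h2 h3; lra.
have qx := ham_ge hyp dl1 Ldl K0 Z0 KZ Zmu sn1 sn2 sub sT U1u U2b xZ qK.
rewrite (large uB) enorm0 powR0 ?mulr0 ?subr0 ?gt_eqF ?(hyp_rho2 hyp)// in qx.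
rewrite (large uB).
have c20 : 0 <= c / 2 by rewrite divr_ge0// (ltW (hyp_c hyp)).
have h3 : c / 2 * B1 <= c / 2 * enorm u `^ rho1.
  by rewrite ler_wpM2l// ltW// ltNge.
rewrite (beta1E hyp) in h3.
apply: le_trans qx.
have th0 : 0 <= th by case/andP: hth => hh _; apply: le_trans hh; rewrite mulr_ge0.
have p1 : 0 <= (L + 1) * (th * K * snorm l wa) by rewrite !mulr_ge0 ?addr_ge0 ?snorm_ge0.
have p2 : 0 <= (3 * dl * K + K / l * (L * (2 * W + Dm) + F)) * D.
  have Dm0 := le_trans D0 DDm; have l0' := ltW l0.
  apply: mulr_ge0 => //; apply: addr_ge0; first by rewrite !mulr_ge0.
  apply: mulr_ge0; first by rewrite divr_ge0.
  by rewrite addr_ge0// mulr_ge0// addr_ge0// mulr_ge0.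
move: h3 p1 p2 Hhi e0; move: ((L + 1) * _) ((3 * dl * K + _) * D) (enorm u `^ rho1) => k1 k2 k3; lra.
Qed.

End Feedback.

(** * The game driven alongside its guide *)

Section Guided.
Context {R : realType} {n m1 m2 : nat}.
Notation mul := (@lebesgue_measure R).
Variables (T : R) (U1 : set 'rV[R]_m1) (U2 : set 'rV[R]_m2).
Variables (f : R -> 'rV[R]_n -> 'rV[R]_m1 -> 'rV[R]_m2 -> 'rV[R]_n)
  (g : R -> 'rV[R]_n -> 'rV[R]_m1 -> 'rV[R]_m2 -> R) (h : 'rV[R]_n -> R).
Variables (L c rho1 rho2 sigma1 sigma2 mu mu0 mu1 mu2 : R).
Hypothesis hyp : standing_hyp T f g h U1 U2 L c rho1 rho2 sigma1 sigma2 mu mu0 mu1 mu2.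
Variables (nu E K Z dl Ab l : R).
Hypotheses (dl0 : 0 <= dl) (dl1 : dl <= 1) (Ldl : L * dl <= c / 2) (l0 : 0 < l).
Hypotheses (K0 : 0 < K) (Z0 : 0 < Z) (KZ : K * Z = E) (Zmu : Z `^ mu <= dl * E).
Hypotheses (ZK : Z `^ (mu - 1) <= dl * K) (AK : (Ab * E) `^ ((mu - 1) / mu) <= dl * K).
Hypotheses (sn1 : sigma1 * nu <= rho1) (sn2 : sigma2 * nu <= rho2).
Hypothesis sub : forall v s r : R, 0 <= v -> 0 <= s -> s * nu <= r ->
  K * v `^ s <= dl * (v `^ r + E).
Let B1 := beta1 L c E.
Let B2 := beta2 L c E.
Let r := L + 1.
Hypotheses (B1A : B1 <= Ab * E) (B2A : B2 <= Ab * E).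
Hypotheses (dl3 : 3 * dl <= expR (- (r * T))) (dlh : L * dl <= expR (- (r * T))).
Variables (rad e d eta : R).
Hypotheses (radZ : Z <= rad) (rad1 : B1 `^ rho1^-1 <= rad) (rad2 : B2 `^ rho2^-1 <= rad).
Hypothesis uc : forall s x q u1 u2 s' x' q' u1' u2',
    s \in `[0, T] -> U1 u1 -> U2 u2 -> enorm x <= rad -> enorm u1 <= rad -> enorm u2 <= rad ->
    enorm q' <= K -> s' \in `[0, T] -> U1 u1' -> U2 u2' ->
    `|s - s'| <= d -> enorm (x - x') <= d -> enorm (q - q') <= d ->
    enorm (u1 - u1') <= d -> enorm (u2 - u2') <= d ->
    `|ham f g s x q u1 u2 - ham f g s' x' q' u1' u2'| <= e.
Hypotheses (d0 : 0 <= d) (e0 : 0 <= e) (etad : m1%:R * eta <= d).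
Variables (ub : R -> 'rV[R]_n -> 'rV[R]_n -> 'rV[R]_m1)
  (phi : R -> 'rV[R]_n -> 'rV[R]_n -> 'rV[R]_m1 -> 'rV[R]_m2)
  (Hf : R -> 'rV[R]_n -> 'rV[R]_n -> R).
Hypothesis hub : forall s z q, U1 (ub s z q) /\ enorm (ub s z q) `^ rho1 <= B1.
Hypothesis hphi : forall s z q u, U2 (phi s z q u) /\ enorm (phi s z q u) `^ rho2 <= B2.
Hypothesis mphi : forall s z q D u, measurable D -> mvec D u -> mvec D (phi s z q \o u).
Hypothesis hsel : forall s z q, s \in `[0, T] -> jap z <= Z -> enorm q <= K ->
    [/\ forall w, U2 w -> ham f g s z q (ub s z q) w <= Hf s z q + e,
      forall u, U1 u -> enorm u `^ rho1 <= B1 -> exists v,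
        [/\ U1 v, enorm v `^ rho1 <= B1, enorm (u - v) <= m1%:R * eta
          & Hf s z q - e <= ham f g s z q v (phi s z q u)],
      forall u, ~~ (enorm u `^ rho1 <= B1) -> phi s z q u = 0 &
      - (4 * L * E) <= Hf s z q <= 4 * L * E].

Definition feedback_grad s w : 'rV[R]_n := pgrad (expR (- (r * s))) K l w.

Variables (t : R) (x0 : 'rV[R]_n) (num : nat) (alpha : (R -> 'rV[R]_m1) -> R -> 'rV[R]_m2).
Hypotheses (t0T : t \in `[0, T]) (num0 : (0 < num)%N).
Hypothesis salpha : strategy T U1 U2 t alpha.
Variables (M M' : R) (u1 : R -> 'rV[R]_m1) (v : R -> 'rV[R]_m2).
Hypotheses (bu : bctrl U1 t T M u1) (bv : bctrl U2 t T M' v).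
Let a := stepped_guide T f t x0 num alpha feedback_grad ub phi u1.
Let b := stepped_strategy T f t x0 num alpha feedback_grad ub phi u1.
Hypothesis av : alpha a = v %[ae mul in `[t, T]%classic].
Let x := trajectory T f t x0 u1 b.
Let z := trajectory T f t x0 a v.
Hypotheses (xZ : forall s, s \in `[t, T] -> jap (x s) <= Z)
  (zZ : forall s, s \in `[t, T] -> jap (z s) <= Z).
Variables (dd eta' : R).
Hypotheses (hdx : forall a' b', t <= a' -> a' <= b' -> b' <= T -> b' - a' <= dd ->
   enorm (x b' - x a') <= eta').
Hypotheses (hdz : forall a' b', t <= a' -> a' <= b' -> b' <= T -> b' - a' <= dd ->
   enorm (z b' - z a') <= eta').
Let step := (T - t) / num%:R.
Hypotheses (stepdd : step <= dd) (stepd : step <= d) (stepK : r * step * K <= d / 2)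
  (etaK : K * (2 * (2 * eta') / l) <= d / 2) (eta'd : eta' <= d).

Lemma B1_ge0 : 0 <= B1.
Proof. exact: (beta1_ge0 hyp K0 Z0 KZ). Qed.

Lemma B2_ge0 : 0 <= B2.
Proof. exact: (beta2_ge0 hyp K0 Z0 KZ). Qed.

Lemma guided_bctrl : bctrl U1 t T (B1 `^ rho1^-1) a /\ bctrl U2 t T (B2 `^ rho2^-1) b.
Proof.
split; first by apply: (stepped1_bctrl hyp) => //; first [exact: hub|exact: B1_ge0].
by apply: (stepped2_bctrl hyp) => //; first [exact: hphi|exact: mphi|exact: B2_ge0|by case: bu].
Qed.

Lemma guided_primitive : primitive t T x0 x (field f u1 b x) /\ primitive t T x0 z (field f a v z).
Proof.
have [ba bb] := guided_bctrl.
have /andP[t0 tT] : 0 <= t <= T := t0T.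
by split; [exact: (trajectory_primitive hyp x0 t0 tT (lexx T) bu bb)|
  exact: (trajectory_primitive hyp x0 t0 tT (lexx T) ba bv)].
Qed.

Let node' := node T t num.
Let adv := advantage g L K l t u1 b a v x z.

Lemma guided_increment k : (k < num)%N ->
  - (2 * (2 * e)) * (node' k.+1 - node' k) <= adv (node' k.+1) - adv (node' k).
Proof.
move=> kn; have [ba bb] := guided_bctrl; have [px pz] := guided_primitive.
have /andP[t0 tT] : 0 <= t <= T := t0T.
have L0 := ltW (hyp_L hyp); have r0 : 0 <= r by rewrite addr_ge0.
have K0' := ltW K0.
have pw := primitiveB px pz.
have [Bw Bw0 hBw] := vbmeas_bound (primitive_vbmeas pw).
have [W W0 hW] := vbmeas_bound (primitive_path pw).
have vF := vbmeasB (vbmeas_field hyp t0 (lexx T) bu bb (primitive_path px))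
  (vbmeas_field hyp t0 (lexx T) bu bb (primitive_path pz)).
have [F F0 hF] := vbmeas_bound vF.
pose Dm := Bw * (T - t).
pose C := (3 * dl * K + K / l * (L * (2 * W + Dm) + F)) * Bw.
have tk : t <= node' k by exact: node_ge.
have kk : node' k <= node' k.+1 by exact: node_le.
have kT : node' k.+1 <= T by exact: node_leT.
have kstep : node' k.+1 = node' k + step by exact: nodeS.
apply: (advantage_increment hyp K0 l0 t0T bu bb ba bv px pz (C := C) tk kk kT).
move=> a' b' s ka' a's sb' b'k q.
have ta' := le_trans tk ka'; have ts := le_trans ta' a's.
have b'T := le_trans b'k kT; have sT := le_trans (ltW sb') b'T.
have kT' := le_trans kk kT; have tb' := le_trans ts (ltW sb').
have in_s : s \in `[t, T] by rewrite in_itv/= ts sT.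
have in_s0 : s \in `[0, T] by rewrite in_itv/= (le_trans t0 ts) sT.
have in_k : node' k \in `[t, T] by rewrite in_itv/= tk kT'.
have in_k0 : node' k \in `[0, T] by rewrite in_itv/= (le_trans t0 tk) kT'.
have in_a : a' \in `[t, T] by rewrite in_itv/= ta' (le_trans a's sT).
have ks := le_trans ka' a's.
have sk1 : s < node' k.+1 by exact: lt_le_trans sb' b'k.
have [aE bE] := stepped_at (x := x0) (grad := feedback_grad) hyp t0T num0 salpha hub hphi mphi
  B1_ge0 B2_ge0 bu bv av kn ks sk1.
rewrite -/a -/b -/x -/z -/node' in aE bE.
set zk := z (node' k) in aE bE; set qk := feedback_grad _ _ in aE bE.
have th01 y : 0 <= y -> 0 <= expR (- (r * y)) <= 1.
  by move=> y0; rewrite expR_ge0 -expR0 ler_expR oppr_le0 mulr_ge0.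
have b'0 := le_trans t0 tb'.
have qK : enorm q <= K by apply: pgrad_le => //; exact: th01.
have qkK : enorm qk <= K by apply: pgrad_le => //; apply: th01; exact: le_trans tk.
have sstep : s - node' k <= step.
  by rewrite lerBlDl -kstep ltW.
have astep : a' - node' k <= step by apply: le_trans sstep; rewrite lerD2r.
have bstep : b' - node' k <= step by rewrite lerBlDl -kstep.
have sd : `|s - node' k| <= d by rewrite ger0_norm ?subr_ge0// (le_trans sstep).
have zd : enorm (z s - zk) <= d.
  by apply: le_trans eta'd; apply: hdz => //; exact: le_trans sstep stepdd.
have qd : enorm (q - qk) <= d.
  (* The gradient changes through the discount, controlled by [stepK], and through the displacements
     of both paths, controlled by [etaK]; each takes [d / 2]. *)
  apply: (le_trans (pgrad_lip _ _ _ (th01 _ (le_trans t0 tk)) K0' l0)).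
  rewrite (splitr d); apply: lerD.
    apply: le_trans stepK; rewrite ler_wpM2r//.
    rewrite distrC ger0_norm; last first.
      by rewrite subr_ge0 ler_expR lerN2 ler_wpM2l// (le_trans ka')// (le_trans a's)// ltW.
    apply: (@le_trans _ _ (r * (b' - node' k))); last by rewrite ler_wpM2l.
    have -> : expR (- (r * b')) = expR (- (r * node' k)) * expR (- (r * (b' - node' k))).
      by rewrite -expRD; congr expR; ring.
    have [h1 h2] := (expR_ge1Dx (- (r * (b' - node' k))), th01 _ (le_trans t0 tk)).
    case/andP: h2 => h2 h3.
    have bk0 : 0 <= b' - node' k by rewrite subr_ge0 (le_trans ks)// ltW.
    have h4 : expR (- (r * node' k)) * (1 - r * (b' - node' k)) <=
       expR (- (r * node' k)) * expR (- (r * (b' - node' k))) by rewrite ler_wpM2l.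
    have h5 : expR (- (r * node' k)) * (r * (b' - node' k)) <= r * (b' - node' k).
      by rewrite ler_piMl// mulr_ge0.
    rewrite lerBlDr [leRHS]addrC -lerBlDr; apply: le_trans h4; rewrite [leRHS]mulrBr mulr1.
    by rewrite lerD2l lerN2.
  apply: le_trans etaK; rewrite ler_wpM2l// ler_wpM2r ?invr_ge0 ?(ltW l0)// ler_wpM2l//.
  have -> : x a' - z a' - (x (node' k) - z (node' k)) =
    (x a' - x (node' k)) - (z a' - z (node' k)).
    by apply/rowP => i; rewrite !mxE; ring.
  apply: (le_trans (enormB _ _)); rewrite mulr_natl mulr2n lerD//.
    by apply: hdx => //; [exact: le_trans sT|exact: le_trans astep _].
  by apply: hdz => //; [exact: le_trans sT|exact: le_trans astep _].
have [sel1 sel2 sel3 /andP[Hlo Hhi]] := hsel in_k0 (zZ in_k) qkK.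
have [U1s _] := bu.2 _ in_s; have [U2s _] := bv.2 _ in_s.
split.
  have [U1a aB] := hub (node' k) zk qk.
  rewrite aE; apply: (guide_ham_le hyp dl1 Ldl K0 Z0 KZ Zmu sn1 sn2 sub radZ rad1 rad2 uc d0
    in_s0 in_k0 (zZ in_s) qK qkK sd zd qd Hlo e0 U1a aB U2s sel1).
have [U2b bB] := hphi (node' k) zk qk (u1 s).
have hsa : enorm (x s - z s - (x a' - z a')) <= Bw * (b' - a').
  apply: (le_trans (primitive_lip pw hBw ta' a's sT)).
  by rewrite ler_wpM2l// lerD2r ltW.
have hDm : Bw * (b' - a') <= Dm by rewrite ler_wpM2l// lerB.
have hth : 3 * dl <= expR (- (r * b')) <= 1.
  have /andP[_ ->] := th01 _ b'0; rewrite andbT (le_trans dl3)//.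
  by rewrite ler_expR lerN2 ler_wpM2l.
have := real_ham_ge hyp dl0 dl1 Ldl l0 K0 Z0 KZ Zmu ZK AK sn1 sn2 sub B1A B2A radZ rad1 rad2 uc d0
   in_s0 in_k0 (zZ in_s) qK qkK sd zd qd Hhi e0 (xZ in_s) U1s U2b (erefl q) hth bB etad
   (sel2 _ U1s) (sel3 (u1 s)) hsa hDm (hW _ in_a).
move=> /(_ F).
rewrite -bE => /(_ (hF _ in_s)); apply: le_trans.
by have -> : C * (b' - a') = (3 * dl * K + K / l * (L * (2 * W + Dm) + F)) * (Bw * (b' - a'))
  by rewrite /C mulrA.
Qed.

(** At time [t] the two positions coincide, so the penalty is at most [K * l]. At time [T] it
    dominates the difference of the terminal payoffs: [h] has Lipschitz constant at most
    [L * dl * K] at scale [Z], and [L * dl] is below the final discount. *)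
Lemma guided_payoff Px Pz :
  Px = Int t T (fun s => g s (x s) (u1 s) (b s)) + h (x T) ->
  Pz = Int t T (fun s => g s (z s) (a s) (v s)) + h (z T) ->
  Pz - K * l - 4 * e * T <= Px.
Proof.
move=> -> ->; have [ba bb] := guided_bctrl; have [px pz] := guided_primitive.
have /andP[t0 tT] : 0 <= t <= T := t0T.
have L0 := ltW (hyp_L hyp); have r0 : 0 <= r by rewrite addr_ge0.
have K0' := ltW K0.
have sum k : (k <= num)%N -> - (4 * e) * (node' k - t) <= adv (node' k) - adv t.
  elim: k => [_|k IH kn]; first by rewrite /node' node0 !subrr mulr0.
  have i1 := guided_increment kn; have i2 := IH (ltnW kn).
  have -> : adv (node' k.+1) - adv t = (adv (node' k.+1) - adv (node' k)) + (adv (node' k) - adv t) by ring.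
  apply: le_trans (lerD i1 i2); rewrite le_eqVlt; apply/orP; left; apply/eqP; ring.
have := sum _ (leqnn num); rewrite /node' node_num// => hsum.
have advt : - (K * l) <= adv t.
  rewrite /adv /advantage !Int_point subr0 sub0r lerN2.
  rewrite (primitive_start px tT) (primitive_start pz tT) subrr snorm0//.
  by rewrite ler_wpM2r ?(ltW l0)// ler_piMl// expR_le1 oppr_le0 mulr_ge0.
have TT : T \in `[t, T] by rewrite in_itv/= tT lexx.
have hh : `|h (x T) - h (z T)| <= expR (- (r * T)) * K * snorm l (x T - z T).
  apply: (le_trans (h_lipschitz hyp _ _)).
  apply: ler_pM; rewrite ?mulr_ge0 ?powR_ge0 ?enorm_ge0 ?snorm_geE//.
  apply: (@le_trans _ _ (L * (dl * K))); last by rewrite mulrA ler_wpM2r.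
  rewrite ler_wpM2l//; apply: le_trans ZK; apply: ge0_ler_powR.
  - by rewrite subr_ge0 (hyp_mu hyp).
  - by rewrite nnegrE; exact: le_trans (japmax_ge1 _ _).
  - by rewrite nnegrE ltW.
  - by apply: japmax_le; [exact: xZ|exact: zZ].
have eT : 4 * e * (T - t) <= 4 * e * T.
  by rewrite ler_wpM2l ?mulr_ge0// gerBl.
move: hh; rewrite ler_norml => /andP[hh _].
move: hsum advt hh eT; rewrite {1}/adv /advantage.
move: (Int t T _) (Int t T _) (adv t) (h (x T)) (h (z T)) => I1 I2 A1 A2 A3.
by rewrite /r; move: (expR _ * K * _) => p; lra.
Qed.

End Guided.

(** * Answers of bounded energy against all controls *)

Section Answers.
Context {R : realType} {n m1 m2 : nat}.
Notation mul := (@lebesgue_measure R).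
Variables (T : R) (U1 : set 'rV[R]_m1) (U2 : set 'rV[R]_m2).
Variables (f : R -> 'rV[R]_n -> 'rV[R]_m1 -> 'rV[R]_m2 -> 'rV[R]_n)
  (g : R -> 'rV[R]_n -> 'rV[R]_m1 -> 'rV[R]_m2 -> R) (h : 'rV[R]_n -> R).
Variables (L c rho1 rho2 sigma1 sigma2 mu mu0 mu1 mu2 : R).
Hypothesis T0 : 0 <= T.
Hypothesis hyp : standing_hyp T f g h U1 U2 L c rho1 rho2 sigma1 sigma2 mu mu0 mu1 mu2.

Definition cost_bounded C : Prop := forall t x M1 M2 u1 u2 E1 E2, t \in `[0, T] ->
  bctrl U1 t T M1 u1 -> bctrl U2 t T M2 u2 ->
  E1 = Int t T (fun s => enorm (u1 s) `^ rho1) ->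
  E2 = Int t T (fun s => enorm (u2 s) `^ rho2) ->
  exists P, [/\ cost T f g h t x u1 u2 = P%:E,
    c / 2 * E1 - C * (jap x `^ mu + E2) <= P & P <= C * (jap x `^ mu + E1) - c / 2 * E2].

Lemma cost_bounds : exists2 C, 1 <= C & cost_bounded C.
Proof.
have [C C1 hC] := payoff_bounds T0 hyp; exists C => //.
move=> t x M1 M2 u1 u2 E1 E2 tT b1 b2 e1 e2.
have /andP[t0 tT'] : 0 <= t <= T := tT.
have py := trajectory_primitive hyp x t0 tT' (lexx T) b1 b2.
eexists; split; first exact: (cost_trajectory hyp x tT b1 b2).
  by have [] := hC _ _ _ _ _ _ _ _ _ _ tT b1 b2 py erefl e1 e2.
by have [] := hC _ _ _ _ _ _ _ _ _ _ tT b1 b2 py erefl e1 e2.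
Qed.

Lemma zero_bctrl {m : nat} (U : set 'rV[R]_m) t : U 0 -> bctrl U t T 0 (fun=> 0).
Proof. by move=> U0; split; [move=> i; exact: measurable_cst|rewrite enorm0]. Qed.

Lemma zero_energy {m : nat} t rho : 0 < rho ->
  Int t T (fun s => enorm ((fun=> 0 : 'rV[R]_m) s) `^ rho) = 0.
Proof.
move=> r0; have -> : 0 = Int t T (fun=> 0) by rewrite /Int Rintegral_cst// mul0r.
by apply: eq_Int => s _; rewrite enorm0 powR0// gt_eqF.
Qed.

Lemma bctrl_control_le {m : nat} (U : set 'rV[R]_m) t M rho r u : 0 <= rho ->
  bctrl U t T M u -> Int t T (fun s => enorm (u s) `^ rho) <= r ->
  control_le T U rho t r u.
Proof.
move=> rho0 bu ur; split; first exact: bctrl_control bu.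
by have -> := EFin_Int (bctrl_powR rho0 bu); rewrite lee_fin.
Qed.

Lemma energy_le {m : nat} (U : set 'rV[R]_m) t M rho b u : 0 <= rho -> 0 <= t <= T ->
  bctrl U t T M u -> 0 <= b -> (forall s, enorm (u s) `^ rho <= b) ->
  Int t T (fun s => enorm (u s) `^ rho) <= T * b.
Proof.
move=> rho0 /andP[t0 tT] bu b0 ub; apply: (@le_trans _ _ (Int t T (fun=> b))).
  by apply: Int_le => [||s _]; [exact: bctrl_powR bu|exact: bmeas_cst|exact: ub].
by rewrite Int_cst// mulrC ler_wpM2r// gerBl.
Qed.

(** Bounds the energy of the answer of [alpha] in the guide system: there Player 1 spends at most
    [J] and the payoff is still at least [W]. *)
Lemma energy_gap (C0 E Xm k I J P : R) : 0 < c -> 0 <= C0 -> Xm <= E -> J <= T * (k * E) ->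
  P <= C0 * (Xm + J) - c / 2 * I -> - (C0 * Xm) <= P ->
  I <= 2 / c * (C0 * (2 + T * k)) * E.
Proof.
move=> c0 C00 XE JE hP PX.
have c20 : 0 < c / 2 by rewrite divr_gt0.
rewrite -(ler_pM2l c20); have -> : c / 2 * (2 / c * (C0 * (2 + T * k)) * E) =
    C0 * (E + (E + T * (k * E))) by field; rewrite gt_eqF.
have : C0 * (Xm + (Xm + J)) <= C0 * (E + (E + T * (k * E))).
  by rewrite ler_wpM2l// !lerD.
by rewrite mulrDr; lra.
Qed.

(** Disposes of an actual control of large energy: the answer spends at most [J], so the payoff
    exceeds every value that [alpha] could guarantee. *)
Lemma energy_excess (C0 E Xm k I J P : R) : 0 < c -> 0 <= C0 -> Xm <= E -> J <= T * (k * E) ->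
  c / 2 * I - C0 * (Xm + J) <= P -> 2 / c * (C0 * (2 + T * k)) * E <= I ->
  C0 * Xm <= P.
Proof.
move=> c0 C00 XE JE hP PI; apply: le_trans hP.
have c20 : 0 < c / 2 by rewrite divr_gt0.
move: PI; rewrite -(ler_pM2l c20).
have -> : c / 2 * (2 / c * (C0 * (2 + T * k)) * E) =
    C0 * (E + (E + T * (k * E))) by field; rewrite gt_eqF.
have : C0 * (Xm + (Xm + J)) <= C0 * (E + (E + T * (k * E))).
  by rewrite ler_wpM2l// !lerD.
by rewrite mulrDr; lra.
Qed.

Lemma good_answers C0 : 1 <= C0 -> cost_bounded C0 -> exists2 Cn, 0 < Cn &
  forall t x N alpha W, t \in `[0, T] -> Cn * jap x `^ mu <= N ->
  strategy T U1 U2 t alpha ->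
  - (C0 * jap x `^ mu) <= W ->
  (forall u1, control_le T U1 rho1 t N u1 ->
     (W%:E <= cost T f g h t x u1 (alpha u1))%E) ->
  forall eps, 0 < eps ->
  exists2 beta, strategy_le T U1 U2 rho2 t N beta &
    forall u1, control T U1 t u1 ->
      ((W - eps)%:E <= cost T f g h t x u1 (beta u1))%E.
Proof.
move=> C01 hC0.
have mu1' := hyp_mu hyp; have Lp := hyp_L hyp; have cp := hyp_c hyp.
have [L0 c0] := (ltW Lp, ltW cp).
have [r10 r20] := (ltW (hyp_rho1 hyp), ltW (hyp_rho2 hyp)).
have C00 : 0 <= C0 by exact: le_trans C01.
have c20 : 0 < c / 2 by rewrite divr_gt0.
have c2i : 0 <= 2 / c by rewrite divr_ge0.
(* [beta1] and [beta2] in units of [E]. All energies are measured in these units, so [A] can be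
   fixed before [dl], and [dl] before [G], without circularity. *)
pose k1 := 16 * L / c; pose k2 := 2 / c * (9 * L + 2 * L * k1).
have k10 : 0 <= k1 by rewrite divr_ge0// mulr_ge0.
have k20 : 0 <= k2 by rewrite mulr_ge0// addr_ge0// mulr_ge0// mulr_ge0.
have Tk1 : 0 <= T * k1 by rewrite mulr_ge0.
have Tk2 : 0 <= T * k2 by rewrite mulr_ge0.
(* [A1] will bound the answer of [alpha] in the guide, [A2] is the threshold of large energy for the
   actual control, and [A] dominates the total energy in each of the two systems. *)
pose A1 := 2 / c * (C0 * (2 + T * k1)).
pose A2 := 2 / c * (C0 * (2 + T * k2)).
have A10 : 0 <= A1 by rewrite mulr_ge0// mulr_ge0// addr_ge0.
have A20 : 0 <= A2 by rewrite mulr_ge0// mulr_ge0// addr_ge0.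
pose A := A1 + A2 + T * k1 + T * k2.
have A0 : 0 <= A by rewrite !addr_ge0.
have TA1 : T * k1 + A1 <= A.
  by rewrite /A -!addrA [leLHS]addrC lerD2l addrCA lerDl addr_ge0.
have TA2 : A2 + T * k2 <= A.
  by rewrite /A -!addrA; apply: ler_wpDl => //; rewrite lerD2l lerDr.
pose Ab := 1 + k1 + k2.
have Ab1 : 1 <= Ab by rewrite /Ab -addrA lerDl addr_ge0.
pose r := L + 1.
have r0 : 0 < r by rewrite ltr_wpDl.
(* [dl * (Qa + Qb) <= 1] serves twice: by [Qa] the factor in [traj_bound] is at most 1, and by [Qb]
   both [3 * dl] and [L * dl] are below the final discount. *)
pose Qa := expR (L * T) * (1 + L * (A + 2 * T)).
pose Qb := (3 + L) * expR (r * T).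
have Qa0 : 0 <= Qa.
  by rewrite mulr_ge0 ?expR_ge0// addr_ge0// mulr_ge0// addr_ge0// mulr_ge0.
have Qb0 : 0 <= Qb by rewrite mulr_ge0 ?expR_ge0// addr_ge0.
have [dl [dl0 dl1 dlQ dlL]] := small_factor (addr_ge0 Qa0 Qb0) L0 c20.
have dl0' := ltW dl0.
have [nu [munu sn1 sn2]] := exponent_gap hyp.
have nu1 : 1 < nu by exact: le_lt_trans munu.
have [G G1 hG] := scales mu1' munu dl0 dl1 Ab1.
have Gp : 0 < G by exact: lt_le_trans G1.
(* Makes [N] at least [T * beta1] and [T * beta2]: the guide control is then one against which
   [alpha] is known to perform, and the answer is admissible. *)
pose Cn := (T * (k1 + k2) + 1) * G.
have Tk : 0 <= T * (k1 + k2) by rewrite mulr_ge0// addr_ge0.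
exists Cn; first by rewrite mulr_gt0// ltr_wpDl.
move=> t x N alpha W tT CnN salpha hW hal eps eps0.
have /andP[t0 tT'] : 0 <= t <= T := tT.
pose Xm := jap x `^ mu.
have Xm1 : 1 <= Xm.
  by rewrite -[leLHS](powRr0 (jap x)) ler_powR ?jap_ge1// (le_trans _ mu1').
have Xm0 : 0 < Xm by exact: lt_le_trans Xm1.
pose E := G * Xm.
have Ep : 0 < E by rewrite mulr_gt0.
have XE : Xm <= E by rewrite ler_peMl// ltW.
have [K [Z [[K0 Z0 KZ Zmu ZK] [XZ AK hsub]]]] := hG (jap x) E (jap_ge1 x) (lexx _).
have K0' := ltW K0; have E0 := ltW Ep.
have LdlC : L * dl <= c / 2 by rewrite mulrC.
have dlA : expR (L * T) * (dl + L * dl * (A + 2 * T)) <= 1.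
  have -> : expR (L * T) * (dl + L * dl * (A + 2 * T)) = dl * Qa by rewrite /Qa; ring.
  by apply: le_trans dlQ; rewrite ler_wpM2l// lerDl.
have dlB : dl * (3 + L) <= expR (- (r * T)).
  rewrite expRN -[leRHS]mul1r ler_pdivlMr ?expR_gt0//.
  by apply: le_trans dlQ; rewrite -mulrA ler_wpM2l// lerDr.
have dl3 : 3 * dl <= expR (- (r * T)).
  by apply: le_trans dlB; rewrite mulrC ler_wpM2l// lerDl.
have dlh : L * dl <= expR (- (r * T)).
  by apply: le_trans dlB; rewrite mulrC ler_wpM2l// lerDr.
have B1E : beta1 L c E = k1 * E by [].
have B2E : beta2 L c E = k2 * E by rewrite /beta2 B1E /k2; ring.
have B1A : beta1 L c E <= Ab * E.
  by rewrite B1E ler_wpM2r// /Ab addrAC lerDr addr_ge0.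
have B2A : beta2 L c E <= Ab * E by rewrite B2E ler_wpM2r// lerDr addr_ge0.
have B10 : 0 <= beta1 L c E by rewrite B1E mulr_ge0.
have B20 : 0 <= beta2 L c E by rewrite B2E mulr_ge0.
(* Error budget: the near-saddles and their uniform continuity lose [4 e T <= eps / 2], the
   smoothing loses [K * l = eps / 2]. The bound [L * E] is the tolerance built into [beta2]. *)
pose e := Num.min (eps / (8 * (T + 1))) (L * E).
have T1 : 0 < T + 1 by rewrite ltr_wpDl.
have e0 : 0 < e by rewrite lt_min divr_gt0 ?mulr_gt0.
have eLE : e <= L * E by rewrite ge_min lexx orbT.
have eT : 4 * e * T <= eps / 2.
  apply: (@le_trans _ _ (4 * (eps / (8 * (T + 1))) * (T + 1))).
    apply: ler_pM => //; first by rewrite mulr_ge0// ltW.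
      by rewrite ler_wpM2l// ge_min lexx.
    by rewrite lerDl.
  by rewrite le_eqVlt; apply/orP; left; apply/eqP; field; rewrite gt_eqF.
pose l := eps / (2 * K).
have l0 : 0 < l by rewrite divr_gt0// mulr_gt0.
have Kl : K * l = eps / 2 by rewrite /l; field; rewrite gt_eqF.
clearbody l.
pose rad := Z + beta1 L c E `^ rho1^-1 + beta2 L c E `^ rho2^-1.
have radZ : Z <= rad by rewrite /rad -addrA lerDl addr_ge0// powR_ge0.
have rad1 : beta1 L c E `^ rho1^-1 <= rad.
  by rewrite /rad addrAC lerDr addr_ge0 ?powR_ge0// ltW.
have rad2 : beta2 L c E `^ rho2^-1 <= rad by rewrite lerDr addr_ge0 ?powR_ge0// ltW.
have rad0 : 0 <= rad by apply: le_trans radZ; exact: ltW.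
have [d d0 uc] := ham_uniformly_cont hyp K0' rad0 e0.
pose eta := d / (m1%:R + 1).
have m10 : 0 < m1%:R + 1 :> R by rewrite ltr_wpDl.
have eta0 : 0 < eta by rewrite divr_gt0.
have etad : m1%:R * eta <= d.
  rewrite /eta mulrCA ler_piMr ?(ltW d0)//.
  by rewrite ler_pdivrMr// mul1r lerDl.
have /choice[sel hsel] := fun p : R * 'rV[R]_n * 'rV[R]_n =>
  near_saddle hyp dl1 LdlC K0 Z0 KZ Zmu sn1 sn2 hsub p.1.1 p.1.2 p.2 e0 eLE eta0.
pose ub s z q := (sel (s, z, q)).1.1.
pose phi s z q := (sel (s, z, q)).1.2.
pose Hf s z q := (sel (s, z, q)).2.
have hub s z q : U1 (ub s z q) /\ enorm (ub s z q) `^ rho1 <= beta1 L c E.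
  by have [[]] := hsel (s, z, q).
have hphi s z q u : U2 (phi s z q u) /\ enorm (phi s z q u) `^ rho2 <= beta2 L c E.
  by have [[_ _ hp _] _] := hsel (s, z, q); exact: hp.
have mphi s z q D u : measurable D -> mvec D u -> mvec D (phi s z q \o u).
  by have [[_ _ _ hp] _] := hsel (s, z, q); exact: hp.
have hsel' s z q : s \in `[0, T] -> jap z <= Z -> enorm q <= K -> _ := (hsel (s, z, q)).2.
pose eta' := Num.min d (l * d / (8 * K)).
have eta'0 : 0 < eta' by rewrite lt_min d0 divr_gt0// mulr_gt0.
have eta'd : eta' <= d by rewrite ge_min lexx.
have etaK : K * (2 * (2 * eta') / l) <= d / 2.
  apply: (@le_trans _ _ (K * (2 * (2 * (l * d / (8 * K))) / l))).
    rewrite ler_wpM2l// ler_wpM2r ?invr_ge0 ?(ltW l0)// !ler_wpM2l//.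
    by rewrite ge_min lexx orbT.
  by rewrite le_eqVlt; apply/orP; left; apply/eqP; field; rewrite !gt_eqF.
have AE0 : 0 <= A * E by rewrite mulr_ge0.
have [dd dd0 hdd] := small_displacement hyp nu1 (ltW Z0) AE0 eta'0 sn1 sn2.
(* The grid must precede the actual control, which is possible because [dd] sees controls only
   through the energy bound [A * E]. *)
pose dm := Num.min dd (Num.min d (d / (2 * r * K))).
have dm0 : 0 < dm by rewrite !lt_min dd0 d0 divr_gt0// !mulr_gt0.
pose num := (Num.bound (T / dm)).+1.
pose step := (T - t) / num%:R.
have step_dm : step <= dm.
  rewrite ler_pdivrMr ?ltr0n// mulrC -ler_pdivrMr//.
  apply: (@le_trans _ _ (T / dm)); first by rewrite ler_wpM2r ?invr_ge0 ?(ltW dm0)// gerBl.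
  have Tdm : 0 <= T / dm by rewrite divr_ge0// ltW.
  by rewrite (le_trans (ltW (archi_boundP Tdm)))// ler_nat leqnSn.
have stepdd : step <= dd by rewrite (le_trans step_dm)// ge_min lexx.
have stepd : step <= d by rewrite (le_trans step_dm)// !ge_min lexx orbT.
have stepK : r * step * K <= d / 2.
  apply: (@le_trans _ _ (r * (d / (2 * r * K)) * K)).
    rewrite ler_wpM2r// ler_wpM2l ?(ltW r0)//.
    by rewrite (le_trans step_dm)// !ge_min lexx !orbT.
  by rewrite le_eqVlt; apply/orP; left; apply/eqP; field; rewrite !gt_eqF.
pose grad := @feedback_grad R n L K l.
have CnE : Cn * jap x `^ mu = (T * (k1 + k2) + 1) * E by rewrite /Cn /E -mulrA.
have TB1 : (T - t) * beta1 L c E <= N.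
  apply: le_trans CnN; rewrite CnE B1E mulrA ler_wpM2r//; apply: (@le_trans _ _ (T * k1)).
    by rewrite ler_wpM2r// gerBl.
  by rewrite mulrDr -addrA lerDl addr_ge0.
have TB2 : (T - t) * beta2 L c E <= N.
  apply: le_trans CnN; rewrite CnE B2E mulrA ler_wpM2r//; apply: (@le_trans _ _ (T * k2)).
    by rewrite ler_wpM2r// gerBl.
  by rewrite mulrDr addrAC lerDr addr_ge0.
have N0 : 0 <= N by apply: le_trans CnN; rewrite CnE mulr_ge0// addr_ge0.
exists (stepped_strategy T f t x num alpha grad ub phi).
  by apply: (stepped_strategy_le hyp).
move=> u1 cu1.
have [U10 U20] := (U1_zero hyp, U2_zero hyp).
have tI : 0 <= t <= T by rewrite t0.
have [w [M [bw uw]]] := control_rep U10 cu1.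
have num0 : (0 < num)%N by [].
pose a := stepped_guide T f t x num alpha grad ub phi w.
pose b := stepped_strategy T f t x num alpha grad ub phi w.
have mw : mvec `[t, T]%classic w by case: bw.
have ba : bctrl U1 t T (beta1 L c E `^ rho1^-1) a by exact: (stepped1_bctrl hyp).
have bb : bctrl U2 t T (beta2 L c E `^ rho2^-1) b by exact: (stepped2_bctrl hyp).
have TT : T \in `[t, T] by rewrite in_itv/= tT' lexx.
have sstr : strategy T U1 U2 t (stepped_strategy T f t x num alpha grad ub phi).
  exact: (stepped_strategyP hyp).
have -> : cost T f g h t x u1 (stepped_strategy T f t x num alpha grad ub phi u1)
    = cost T f g h t x w b.
  apply: (cost_ae hyp x tT cu1 (bctrl_control bw)) => //.
  - exact/sstr.1/(control_control1 U10 cu1).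
  - exact: bctrl_control bb.
  - exact: sstr.2 (control_control1 U10 cu1) (bctrl_control1 bw) TT uw.
have [v [M' [bv av]]] := control_rep U20 (salpha.1 _ (bctrl_control1 ba)).
have [Pz [ePz _ Pz2]] := hC0 t x _ _ a v _ _ tT ba bv erefl erefl.
have [Px [ePx Px1 _]] := hC0 t x _ _ w b _ _ tT bw bb erefl erefl.
rewrite ePx lee_fin.
have WPz : W <= Pz.
  rewrite -lee_fin -ePz -(cost_ae hyp x tT (bctrl_control ba) (bctrl_control ba)
    (salpha.1 _ (bctrl_control1 ba)) (bctrl_control bv) _ av); last exact: aeW.
  by apply: hal; apply: (stepped_guide_le hyp).
have E1a : Int t T (fun s => enorm (a s) `^ rho1) <= T * beta1 L c E.
  apply: (energy_le r10 tI ba B10) => s.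
  by have [] : U1 (a s) /\ enorm (a s) `^ rho1 <= beta1 L c E by exact: (stepped1_spec hyp).
have E2b : Int t T (fun s => enorm (b s) `^ rho2) <= T * beta2 L c E.
  apply: (energy_le r20 tI bb B20) => s.
  by have [] : U2 (b s) /\ enorm (b s) `^ rho2 <= beta2 L c E by exact: (stepped2_spec hyp).
(* The zero control is among those against which [alpha] guarantees [W]. *)
have WXm : W <= C0 * Xm.
  pose o : R -> 'rV[R]_m1 := fun=> 0.
  have z1 : bctrl U1 t T 0 o by exact: zero_bctrl.
  have [v0 [M0 [bv0 av0]]] := control_rep U20 (salpha.1 _ (bctrl_control1 z1)).
  have [P0 [eP0 _ P02]] := hC0 t x _ _ _ v0 0 _ tT z1 bv0
    (esym (zero_energy t (hyp_rho1 hyp))) erefl.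
  have : (W%:E <= cost T f g h t x o v0)%E.
    rewrite -(cost_ae hyp x tT (bctrl_control z1) (bctrl_control z1)
      (salpha.1 _ (bctrl_control1 z1)) (bctrl_control bv0) _ av0); last exact: aeW.
    apply: hal; apply: (bctrl_control_le r10 z1).
    by rewrite zero_energy ?(hyp_rho1 hyp).
  rewrite eP0 lee_fin => /le_trans; apply; apply: (le_trans P02).
  rewrite addr0 gerBl.
  by rewrite mulr_ge0 ?(ltW c20)// Int_ge0// => s _; rewrite powR_ge0.
have E2v : Int t T (fun s => enorm (v s) `^ rho2) <= A1 * E.
  by apply: (energy_gap cp C00 XE _ Pz2 (le_trans hW WPz)); rewrite -B1E.
(* Above the threshold the payoff already exceeds [W]. Below it both systems have energy at most
   [A * E], hence both paths stay within [Z] and the comparison with the guide applies. *)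
have [big|small] := leP (A2 * E) (Int t T (fun s => enorm (w s) `^ rho1)).
  apply: (@le_trans _ _ W); first by rewrite gerBl ltW.
  apply: (le_trans WXm); apply: (energy_excess cp C00 XE _ Px1 big).
  by rewrite -B2E.
have sumz : Int t T (fun s => enorm (a s) `^ rho1) + Int t T (fun s => enorm (v s) `^ rho2) <= A * E.
  by apply: (le_trans (lerD E1a E2v)); rewrite B1E [T * _]mulrA -mulrDl ler_wpM2r.
have sumx : Int t T (fun s => enorm (w s) `^ rho1) + Int t T (fun s => enorm (b s) `^ rho2) <= A * E.
  by apply: (le_trans (lerD (ltW small) E2b)); rewrite B2E [T * _]mulrA -mulrDl ler_wpM2r.
pose px := trajectory_primitive hyp x t0 tT' (lexx T) bw bb.
pose pz := trajectory_primitive hyp x t0 tT' (lexx T) ba bv.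
have jap_Z y : expR (L * T) * (dl + L * dl * (A + 2 * T)) * Z >= y -> y <= Z.
  by move=> /le_trans; apply; rewrite ler_piMl// ltW.
have xZ s : s \in `[t, T] -> jap (trajectory T f t x w b s) <= Z.
  by move=> sT; apply/jap_Z/(traj_bound hyp dl0' K0 Z0 KZ XZ sn1 sn2 hsub t0 tT' (lexx T) (lexx _) bw bb px sumx).
have zZ s : s \in `[t, T] -> jap (trajectory T f t x a v s) <= Z.
  by move=> sT; apply/jap_Z/(traj_bound hyp dl0' K0 Z0 KZ XZ sn1 sn2 hsub t0 tT' (lexx T) (lexx _) ba bv pz sumz).
have hdx := hdd _ _ _ _ _ _ _ _ _ _ t0 tT' (lexx T) bw bb px erefl erefl sumx xZ.
have hdz := hdd _ _ _ _ _ _ _ _ _ _ t0 tT' (lexx T) ba bv pz erefl erefl sumz zZ.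
have PxE := cost_trajectory hyp x tT bw bb.
have PzE := cost_trajectory hyp x tT ba bv.
move: PxE PzE; rewrite ePx ePz => -[PxE] -[PzE].
have := guided_payoff hyp dl0' dl1 LdlC l0 K0 Z0 KZ Zmu ZK AK sn1 sn2 hsub B1A B2A
  dl3 dlh radZ rad1 rad2 uc (ltW d0) (ltW e0) etad hub hphi mphi hsel' tT num0 salpha
  bw bv av xZ zZ hdx hdz stepdd stepd stepK etaK eta'd
  PxE PzE.
rewrite Kl; apply: le_trans.
by rewrite -addrA -opprD lerB// [leRHS]splitr lerD2l.
Qed.

End Answers.

(** * Bounds and equality of values; exchange of the players *)

Section Values.
Context {R : realType} {n m1 m2 : nat}.
Notation mul := (@lebesgue_measure R).
Variables (T : R) (U1 : set 'rV[R]_m1) (U2 : set 'rV[R]_m2).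
Variables (f : R -> 'rV[R]_n -> 'rV[R]_m1 -> 'rV[R]_m2 -> 'rV[R]_n)
  (g : R -> 'rV[R]_n -> 'rV[R]_m1 -> 'rV[R]_m2 -> R) (h : 'rV[R]_n -> R).
Variables (L c rho1 rho2 sigma1 sigma2 mu mu0 mu1 mu2 : R).
Hypothesis T0 : 0 <= T.
Hypothesis hyp : standing_hyp T f g h U1 U2 L c rho1 rho2 sigma1 sigma2 mu mu0 mu1 mu2.

Lemma cost_rep t x u1 u2 : t \in `[0, T] -> control T U1 t u1 -> control T U2 t u2 ->
  exists M1 M2 w1 w2, [/\ bctrl U1 t T M1 w1, bctrl U2 t T M2 w2,
    u1 = w1 %[ae mul in `[t, T]%classic], u2 = w2 %[ae mul in `[t, T]%classic] &
    cost T f g h t x u1 u2 = cost T f g h t x w1 w2].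
Proof.
move=> tT c1 c2; have [w1 [M1 [b1 e1]]] := control_rep (U1_zero hyp) c1.
have [w2 [M2 [b2 e2]]] := control_rep (U2_zero hyp) c2.
exists M1, M2, w1, w2; split => //.
exact: (cost_ae hyp x tT c1 (bctrl_control b1) c2 (bctrl_control b2) e1 e2).
Qed.

Lemma cost_zero_bounds C t x : 0 <= C -> cost_bounded T U1 U2 f g h c rho1 rho2 mu C ->
  t \in `[0, T] ->
  (forall u1, control T U1 t u1 ->
    ((- (C * jap x `^ mu))%:E <= cost T f g h t x u1 (fun=> 0%R))%E) /\
  (forall u2, control T U2 t u2 ->
    (cost T f g h t x (fun=> 0%R) u2 <= (C * jap x `^ mu)%:E)%E).
Proof.
move=> C0 hC tT; have [z1 z2] : bctrl U1 t T 0 (fun=> 0) /\ bctrl U2 t T 0 (fun=> 0).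
  by split; apply: zero_bctrl; [exact: U1_zero hyp|exact: U2_zero hyp].
have c20 : 0 <= c / 2 by rewrite divr_ge0// ltW// (hyp_c hyp).
have E0 (m : nat) rho (u : R -> 'rV[R]_m) : 0 <= Int t T (fun s => enorm (u s) `^ rho).
  by apply: Int_ge0 => s _; rewrite powR_ge0.
split=> u cu.
  have [w [M [bw uw]]] := control_rep (U1_zero hyp) cu.
  rewrite (cost_ae hyp x tT cu (bctrl_control bw) (bctrl_control z2) (bctrl_control z2) uw); last exact: aeW.
  have [P [-> hP _]] := hC _ x _ _ _ _ _ _ tT bw z2 erefl (esym (zero_energy T t (hyp_rho2 hyp))).
  rewrite lee_fin; apply: le_trans hP; rewrite addr0 lerDr.
  by rewrite mulr_ge0.
have [w [M [bw uw]]] := control_rep (U2_zero hyp) cu.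
rewrite (cost_ae hyp x tT (bctrl_control z1) (bctrl_control z1) cu (bctrl_control bw) _ uw); last exact: aeW.
have [P [-> _ hP]] := hC _ x _ _ _ _ _ _ tT z1 bw (esym (zero_energy T t (hyp_rho1 hyp))) erefl.
by rewrite lee_fin; apply: (le_trans hP); rewrite addr0 gerBl mulr_ge0.
Qed.

Lemma zero_strategy t r : 0 <= t <= T -> 0 <= r ->
  strategy_le T U1 U2 rho2 t r (fun _ _ => 0).
Proof.
move=> tT r0; have z : bctrl U2 t T 0 (fun=> 0) by exact/zero_bctrl/(U2_zero hyp).
have zr : control_le T U2 rho2 t r (fun=> 0).
  apply: (bctrl_control_le (ltW (hyp_rho2 hyp)) z).
  by rewrite zero_energy ?(hyp_rho2 hyp).
by split => //; split=> [v _|v w s *]; [exact: bctrl_control z|exact: aeW].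
Qed.

(** Enlarging the strategies raises the value and enlarging the opposing controls lowers it. So the
    pair of restricted strategies and full controls gives the least value [V], and [good_answers]
    shows that no pair exceeds it. Both forms of the upper value are such pairs, and [N] may be any
    larger number, so that one constant can serve both players. *)
Lemma sup_inf_costs : exists C Cn, [/\ 0 < C, 0 < Cn & forall t x N,
  t \in `[0, T] -> Cn * jap x `^ mu <= N ->
  exists2 V, (`|V| <= (C * jap x `^ mu)%:E)%E &
    forall A B, strategy_le T U1 U2 rho2 t N `<=` A -> A `<=` strategy T U1 U2 t ->
      control_le T U1 rho1 t N `<=` B -> B `<=` control T U1 t ->
      sup_inf_cost T f g h A B t x = V].
Proof.
have [C C1 hC] := cost_bounds T0 hyp; have [Cn Cn0 hCn] := good_answers T0 hyp C1 hC.
have C0 : 0 < C by exact: lt_le_trans C1.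
exists C, Cn; split => // t x N tT CnN.
have /andP[t0 tT'] : 0 <= t <= T := tT.
have tI : 0 <= t <= T by rewrite t0.
have X0 : 0 <= jap x `^ mu by rewrite powR_ge0.
have N0 : 0 <= N by rewrite (le_trans _ CnN)// mulr_ge0// ltW.
have [lo hi] := cost_zero_bounds x (ltW C0) hC tT.
pose V := sup_inf_cost T f g h (strategy_le T U1 U2 rho2 t N) (control T U1 t) t x.
have lbV A B : strategy_le T U1 U2 rho2 t N `<=` A -> B `<=` control T U1 t ->
    ((- (C * jap x `^ mu))%:E <= sup_inf_cost T f g h A B t x)%E.
  move=> hA hB; apply: le_trans (ereal_sup_ubound _); last first.
    by exists (fun _ _ => 0); [exact/hA/zero_strategy|reflexivity].
  by apply: le_ereal_inf_tmp => _ [u Bu <-]; apply/lo/hB.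
have zc : control_le T U1 rho1 t N (fun=> 0).
  apply: (bctrl_control_le (ltW (hyp_rho1 hyp)) (zero_bctrl _ _ (U1_zero hyp))).
  by rewrite zero_energy ?(hyp_rho1 hyp).
have le_V A B : A `<=` strategy T U1 U2 t -> control_le T U1 rho1 t N `<=` B ->
    (sup_inf_cost T f g h A B t x <= V)%E.
  move=> hA hB; apply: ge_ereal_sup => _ [alpha Aal <-].
  set m := ereal_inf _.
  have mhi : (m <= (C * jap x `^ mu)%:E)%E.
    apply: le_trans (hi (alpha (fun=> 0)) _); first by apply: ereal_inf_lbound; exists (fun=> 0) => //; exact: hB.
    by apply: (hA _ Aal).1; exact: (bctrl_control1 (zero_bctrl T t (U1_zero hyp))).
  (* [good_answers] requires [W] not to be too low; a guarantee below that level is already beaten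
     by the zero strategy. *)
  have [mlo|mlo] := leP (- (C * jap x `^ mu))%:E m; last by apply: le_trans (ltW mlo) _; exact: lbV.
  have mfin : m \is a fin_num.
    by rewrite fin_numE -ltNye -ltey (lt_le_trans _ mlo) ?ltNyr// (le_lt_trans mhi) ?ltry.
  have [W mW] : exists W, m = W%:E by exists (fine m); rewrite fineK.
  rewrite mW; apply/lee_addgt0Pr => eps eps0.
  have hW : - (C * jap x `^ mu) <= W by rewrite -lee_fin -mW.
  have [|beta sb hb] := hCn t x N alpha W tT CnN (hA _ Aal) hW _ eps eps0.
    by move=> u1 /hB cu; rewrite -mW; apply: ereal_inf_lbound; exists u1.
  rewrite -leeBlDr// -EFinB; apply: le_trans (ereal_sup_ubound _); last by exists beta.
  by apply: le_ereal_inf_tmp => _ [u1 cu <-]; exact: hb.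
exists V.
  have absP (y : \bar R) (b : R) : ((- b)%:E <= y -> y <= b%:E -> `|y| <= b%:E)%E.
    by case: y => [r||]//; rewrite abse_EFin !lee_fin ler_norml => -> ->.
  apply: absP; first exact: lbV.
  apply: ge_ereal_sup => _ [alpha [sal _] <-].
  apply: le_trans (hi (alpha (fun=> 0)) _).
    by apply: ereal_inf_lbound; exists (fun=> 0) => //; case: zc.
  by apply: sal.1; exact: (bctrl_control1 (zero_bctrl T t (U1_zero hyp))).
move=> A B hA1 hA2 hB1 hB2; apply/le_anti/andP; split; first exact: le_V.
apply: ge_ereal_sup => _ [alpha Aal <-]; apply: le_trans (ereal_sup_ubound _); last first.
  by exists alpha; [exact: hA1|reflexivity].
by apply: ereal_inf_le_tmp => _ [u Bu <-]; exists u => //; exact: hB2.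
Qed.

Lemma standing_hyp_swap : standing_hyp T (fun t x u2 u1 => f t x u1 u2)
  (fun t x u2 u1 => - g t x u1 u2) (fun x => - h x) U2 U1
  L c rho2 rho1 sigma2 sigma1 mu mu0 mu2 mu1.
Proof.
pose sw (p : R * 'rV[R]_n * 'rV[R]_m2 * 'rV[R]_m1) := (p.1.1, p.2, p.1.2).
have csw (V : topologicalType) (F : R * 'rV[R]_n * 'rV[R]_m1 * 'rV[R]_m2 -> V) :
    {within game_domain T U1 U2, continuous F} ->
    {within game_domain T U2 U1, continuous (F \o sw)}.
  move=> /subspace_continuousP cF; apply/subspace_continuousP => p [p1 p2 p3].
  apply: cvg_comp (cF (sw p) _) => // A /= hA.
  have sw_cont : sw q @[q --> p] --> sw p.
    have c12 : q.1 @[q --> p] --> p.1 by exact: cvg_fst.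
    apply: (@cvg_pair _ _ _ (nbhs p) (nbhs (p.1.1, p.2)) (nbhs p.1.2)
      _ _ _ (fun q => (q.1.1, q.2)) (fun q => q.1.2)).
      apply: (@cvg_pair _ _ _ (nbhs p) (nbhs p.1.1) (nbhs p.2)
        _ _ _ (fun q => q.1.1) snd); last exact: cvg_snd.
      by apply: (cvg_comp _ _ c12); exact: cvg_fst.
    by apply: (cvg_comp _ _ c12); exact: cvg_snd.
  have := sw_cont _ hA; rewrite /fmap /within /nbhs/= => hn.
  by move: hn; apply: filterS => q hq [q1 q2 q3]; exact: hq.
split; try by case: hyp.
- exact: csw (f_continuous hyp).
- by move=> t x u1 u2 tT c1 c2; rewrite addrAC; exact: (f_growth hyp).
- by move=> t x y u1 u2 tT c1 c2; rewrite addrAC; exact: (f_lipschitz hyp).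
- by move=> t x y u1 u2 tT c1 c2; exact: (f_monotone hyp).
- have := csw _ _ (g_continuous hyp) => /subspace_continuousP cg.
  by apply/subspace_continuousP => p Dp; apply: cvgN; exact: cg.
- move=> t x u1 u2 tT c1 c2; have := g_upper hyp x tT c2 c1; lra.
- move=> t x u1 u2 tT c1 c2; have := g_lower hyp x tT c2 c1; lra.
- move=> t x y u1 u2 tT c1 c2; rewrite -opprD normrN addrAC.
  exact: (g_lipschitz hyp).
- move=> x; apply: (@continuous_comp _ _ _ h -%R x); first exact: (h_continuous hyp).
  exact: (@oppr_continuous _ R).
- by move=> x y; rewrite -opprD normrN; exact: (h_lipschitz hyp).
- by rewrite normrN; exact: (h_zero hyp).
Qed.

(** Stated for controls only: there the running payoff has a bounded representative, so the sign
    passes through the integral and the sum. *)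
Lemma cost_swap t x u1 u2 : t \in `[0, T] -> control T U1 t u1 -> control T U2 t u2 ->
  cost T f g h t x u1 u2 = (- cost T (fun t x u2 u1 => f t x u1 u2)
    (fun t x u2 u1 => (- g t x u1 u2)%R) (fun x => (- h x)%R) t x u2 u1)%E.
Proof.
move=> tT c1 c2; have [M1 [M2 [w1 [w2 [b1 b2 e1 e2 ->]]]]] := cost_rep x tT c1 c2.
rewrite (cost_ae standing_hyp_swap x tT c2 (bctrl_control b2) c1 (bctrl_control b1) e2 e1).
rewrite (cost_trajectory hyp x tT b1 b2) (cost_trajectory standing_hyp_swap x tT b2 b1).
have /andP[t0 tT'] : 0 <= t <= T := tT.
have p := trajectory_primitive hyp x t0 tT' (lexx T) b1 b2.
rewrite -EFinN; congr (_%:E).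
rewrite (@IntN _ t T (fun s => g s (trajectory T f t x w1 w2 s) (w1 s) (w2 s))); last first.
  exact: (bmeas_running hyp t0 (lexx T) b1 b2 (primitive_path p)).
by rewrite opprD !opprK.
Qed.

Lemma inf_sup_cost_swap t x A B : t \in `[0, T] ->
  A `<=` strategy T U2 U1 t -> B `<=` control T U2 t ->
  inf_sup_cost T f g h A B t x = (- sup_inf_cost T (fun t x u2 u1 => f t x u1 u2)
    (fun t x u2 u1 => (- g t x u1 u2)%R) (fun x => (- h x)%R) A B t x)%E.
Proof.
move=> tT hA hB; rewrite /inf_sup_cost /sup_inf_cost ereal_infEN image_comp.
congr (- ereal_sup _)%E; apply: eq_imagel => a Aa /=.
rewrite ereal_supEN oppeK image_comp; congr ereal_inf.
apply: eq_imagel => u Bu /=; rewrite cost_swap ?oppeK//; last exact: hB.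
by apply: (hA _ Aa).1; exact: control_control1 (U2_zero hyp) (hB _ Bu).
Qed.

End Values.

Lemma sub_control_le {R : realType} {m : nat} (T t rho r : R) (U : set 'rV[R]_m) :
  control_le T U rho t r `<=` control T U t.
Proof. by move=> u []. Qed.

Lemma sub_strategy_le {R : realType} {p m : nat} (T t rho r : R)
    (V : set 'rV[R]_p) (U : set 'rV[R]_m) :
  strategy_le T V U rho t r `<=` strategy T V U t.
Proof. by move=> a []. Qed.

Theorem theorem5p4 (R : realType) (n m1 m2 : nat) (T : R)
    (U1 : set 'rV[R]_m1) (U2 : set 'rV[R]_m2)
    (f : R -> 'rV[R]_n -> 'rV[R]_m1 -> 'rV[R]_m2 -> 'rV[R]_n)
    (g : R -> 'rV[R]_n -> 'rV[R]_m1 -> 'rV[R]_m2 -> R)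
    (h : 'rV[R]_n -> R)
    (L c rho1 rho2 sigma1 sigma2 mu mu0 mu1 mu2 : R)
    (T_gt0 : 0 < T)
    (hyp : standing_hyp T f g h U1 U2
             L c rho1 rho2 sigma1 sigma2 mu mu0 mu1 mu2) :
  [/\ forall (t : R) (x : 'rV[R]_n), t \in `[0, T] ->
        upper_value T f g h U1 U2 t x \is a fin_num /\
        lower_value T f g h U1 U2 t x \is a fin_num,
      exists C : R, 0 < C /\
        forall (t : R) (x : 'rV[R]_n), t \in `[0, T] ->
          (`|upper_value T f g h U1 U2 t x| <= (C * jap x `^ mu)%:E)%E /\
          (`|lower_value T f g h U1 U2 t x| <= (C * jap x `^ mu)%:E)%E
    & exists C' : R, 0 < C' /\
        forall (t : R) (x : 'rV[R]_n), t \in `[0, T] ->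
          upper_value T f g h U1 U2 t x =
            upper_value_le T f g h U1 U2 rho1 rho2 (C' * jap x `^ mu) t x /\
          lower_value T f g h U1 U2 t x =
            lower_value_le T f g h U1 U2 rho1 rho2 (C' * jap x `^ mu) t x].
Proof.
have [Cu [Nu [Cu0 Nu0 up]]] := sup_inf_costs (ltW T_gt0) hyp.
have [Cl [Nl [Cl0 Nl0 low]]] := sup_inf_costs (ltW T_gt0) (standing_hyp_swap hyp).
(* The game with exchanged players has its own constants; both conclusions persist for larger
   ones. *)
pose C := Num.max Cu Cl; pose N := Num.max Nu Nl.
have C0 : 0 < C by rewrite lt_max Cu0.
have N0 : 0 < N by rewrite lt_max Nu0.
have main t x : t \in `[0, T] ->
    [/\ (`|upper_value T f g h U1 U2 t x| <= (C * jap x `^ mu)%:E)%E,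
      (`|lower_value T f g h U1 U2 t x| <= (C * jap x `^ mu)%:E)%E,
      upper_value T f g h U1 U2 t x =
        upper_value_le T f g h U1 U2 rho1 rho2 (N * jap x `^ mu) t x &
      lower_value T f g h U1 U2 t x =
        lower_value_le T f g h U1 U2 rho1 rho2 (N * jap x `^ mu) t x].
  move=> tT; have X0 : 0 <= jap x `^ mu by rewrite powR_ge0.
  have [|V Vb hV] := up t x (N * jap x `^ mu) tT.
    by rewrite ler_wpM2r// le_max lexx.
  have [|W Wb hW] := low t x (N * jap x `^ mu) tT.
    by rewrite ler_wpM2r// le_max lexx orbT.
  have V1 : upper_value T f g h U1 U2 t x = V.
    by apply: hV => //; [exact: sub_strategy_le|exact: sub_control_le].
  have W1 : lower_value T f g h U1 U2 t x = (- W)%E.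
    rewrite /lower_value (inf_sup_cost_swap hyp)// hW//.
      exact: sub_strategy_le.
    exact: sub_control_le.
  split; rewrite ?V1 ?W1.
  - by apply: (le_trans Vb); rewrite lee_fin ler_wpM2r// le_max lexx.
  - by rewrite abseN; apply: (le_trans Wb); rewrite lee_fin ler_wpM2r// le_max lexx orbT.
  - by rewrite /upper_value_le hV//; [exact: sub_strategy_le|exact: sub_control_le].
  - rewrite /lower_value_le (inf_sup_cost_swap hyp)//; [|exact: sub_strategy_le|exact: sub_control_le].
    by rewrite hW//; [exact: sub_strategy_le|exact: sub_control_le].
have fin (V : \bar R) (b : R) : (`|V| <= b%:E)%E -> V \is a fin_num.
  by rewrite fin_num_abs => /le_lt_trans; apply; rewrite ltry.
split.
- by move=> t x /(main t x)[/fin ? /fin ? _ _].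
- by exists C; split=> // t x /(main t x)[].
- by exists N; split=> // t x /(main t x)[].
Qed.
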